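(* Let $H$ be a bipartite graph with $h$ vertices and $\ell$ edges that contains a cycle. Let $A,\alpha$ be positive reals such that $\mathrm{ex}(n,H)\leq An^\alpha$ for every $n\in\mathbb{N}$. There exists a constant $C$ such that the following holds for all sufficiently large $n\in\mathbb{N}$ and $k\in\mathbb{R}^+$. Let $\mathcal{I}(n)$ be the set of all $H$-free graphs on $[n]$ and $\mathcal{G}(n,k)$ the set of all graphs on $[n]$ with at most $kn^\alpha$ edges. There exist a collection $\mathcal{S}$ of colored graphs with $n$ vertices and at most $Ck^{1-\lambda(\alpha,H)}n^\alpha$ edges, and functions $g:\mathcal{I}(n)\to\mathcal{S}$ and $h:\mathcal{S}\to\mathcal{G}(n,k)$ such that (a) for every $s\geq 1$, the number of colored graphs in $\mathcal{S}$ with $s$ edges is at most \[\left(\frac{Cn^\alpha}{s}\right)^{\frac{\lambda(\alpha,H)}{\lambda(\alpha,H)-1}\cdot s}\cdot\exp\left(Ck^{1-\lambda(\alpha,H)}n^\alpha\right);\] (b) for every $I\in\mathcal{I}(n)$, $g(I)\subseteq I\subseteq h(g(I))\cup g(I)$. Here $\lambda(\alpha,H)=\frac{1}{m_2(H)(2-\alpha)}$.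
   Context: A colored graph is a graph together with a labelled partition of its edge set; containment $g(I)\subseteq I$ refers to the underlying edge sets. $\mathrm{ex}(n,H)$ is the maximum number of edges of an $H$-free $n$-vertex graph, and $m_2(H)=\max\{\frac{e(F)-1}{v(F)-2}: F\subseteq H, v(F)>2\}$. *)

(* Defs.v *)
From HB Require Import structures.
From mathcomp Require Import all_boot all_order all_algebra finmap.
From mathcomp Require Import reals sequences exp.

Set Implicit Arguments.
Unset Strict Implicit.
Unset Printing Implicit Defensive.

Import Order.TTheory GRing.Theory Num.Theory.

Local Open Scope ring_scope.

Record sgraph (V : finType) := SGraph {
  edges : {set {set V}};
  edgesP : [forall e in edges, #|e| == 2%N] }.

HB.instance Definition _ (V : finType) := [isSub for @edges V].
HB.instance Definition _ (V : finType) := [Finite of sgraph V by <:].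

(* A graph with a labelled partition of its edge set: [coloring G e] is [None]
   when [e] is not an edge, and [Some i] when [e] lies in the part labelled
   [i].  Labels range over all of [nat], so their number is unrestricted. *)
Record cgraph (V : finType) := CGraph {
  coloring : {ffun {set V} -> option nat};
  coloringP : [forall e, (coloring e != None) ==> (#|e| == 2%N)] }.

HB.instance Definition _ (V : finType) := [isSub for @coloring V].
HB.instance Definition _ (V : finType) := [Choice of cgraph V by <:].

Lemma underlying_subproof (V : finType) (G : cgraph V) :
  [forall e in [set e | coloring G e != None], #|e| == 2%N].
Proof.
apply/forall_inP => e; rewrite inE => Ge.
exact: (implyP (forallP (coloringP G) e)).
Qed.

Definition underlying (V : finType) (G : cgraph V) : sgraph V :=
  SGraph (underlying_subproof G).

Section Graphs.
Variable V : finType.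
Implicit Type G : sgraph V.

Definition adj G : rel V := [rel x y | [set x; y] \in edges G].

Definition bipartite G : Prop :=
  exists c : V -> bool, forall x y, adj G x y -> c x != c y.

Definition has_cycle G : Prop :=
  exists s : seq V, (2 < size s)%N /\ ucycle (adj G) s.

(* Subgraphs, not necessarily induced or spanning, as pairs
   (vertex set, edge set). *)
Definition subgraph_of G (F : {set V} * {set {set V}}) : bool :=
  (F.2 \subset edges G) && [forall e in F.2, e \subset F.1].

(* The default value 0 does not change the maximum as soon as [G] has an edge
   and at least three vertices: an edge with an isolated vertex contributes 0. *)
Definition m2 (R : realType) G : R :=
  \big[Num.max/0]_(F : {set V} * {set {set V}}
                     | subgraph_of G F && (2 < #|F.1|)%N)
     ((#|F.2|%:R - 1) / (#|F.1|%:R - 2)).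

Definition lambda (R : realType) (alpha : R) G : R :=
  1 / (m2 R G * (2 - alpha)).

End Graphs.

Definition contains_copy (V W : finType) (H : sgraph V) (G : sgraph W) : bool :=
  [exists f : {ffun V -> W},
     injectiveb f && [forall e in edges H, f @: e \in edges G]].

Definition free_graphs (V : finType) (H : sgraph V) (n : nat) :
    {set sgraph 'I_n} :=
  [set G | ~~ contains_copy H G].

Definition ex (V : finType) (n : nat) (H : sgraph V) : nat :=
  \max_(G in free_graphs H n) #|edges G|.

Definition sparse_graphs (R : realType) (alpha : R) (n : nat) (k : R) :
    {set sgraph 'I_n} :=
  [set G | #|edges G|%:R <= k * n%:R `^ alpha].

(* Main.v *)
(** The main step is a container lemma for a graph [G] on [n] vertices with
    [k n^alpha] edges, [k] large.  A random set of vertices of density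
    [p = (12 A / k)^(1/(2-alpha))] spans too many edges to be [H]-free, even
    after one edge is deleted from every overused set of edges, so copies of [H]
    in [G] can be collected greedily in a balanced way: a set of [j] edges
    lies in a [O(tau^(j-1) / e(G))] fraction of them, where
    [tau = p^(1/m2)] is of order [k^-lambda].  The hypergraph container theorem
    then yields fingerprints of size [O(k^(1-lambda) n^alpha)] and shrinks [G] by
    a constant factor.  Iterating, the sizes of the fingerprints form a
    geometric series because [lambda > 1].

    That [lambda > 1], that is [alpha > 2 - 1/m2], holds because the deletion
    bound [n^(2-1/m2)] for [ex(n,H)] can be beaten by an arbitrarily large
    constant factor.  Let [F] be a strictly balanced subgraph of [H] attaining
    [m2].  In a random graph with [T n^(2-1/m2)] edges, the hypergraph of
    copies of [F] has bounded degree and, after few deletions, no short cycles;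
    accepting edges in a random order unless they complete a copy of [F] with
    edges accepted before can therefore be analysed exactly on a hypertree, and
    accepts a number of edges that grows with [T]. *)
Require Import Defs.
From HB Require Import structures.
From mathcomp Require Import all_boot all_order all_algebra finmap.
From mathcomp Require Import reals sequences exp.
From mathcomp Require Import boolp ring lra zify.

Set Implicit Arguments.
Unset Strict Implicit.
Unset Printing Implicit Defensive.

Import Order.TTheory GRing.Theory Num.Theory.

Local Open Scope ring_scope.

(** * Product measures *)

(** The count in (a) has base of order [k n^alpha / s] before [k] is eliminated, although the first
    fingerprints are chosen from containers with many more than [k n^alpha] edges. Those
    fingerprints are small: if the current container has [x k n^alpha] edges, its fingerprint has
    only [O(x^(1-lambda) k^(1-lambda) n^alpha)]. Charging each fingerprint edge a factor [x^2] costs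
    a product whose logarithm sums to [O(k^(1-lambda) n^alpha)], the exponential in (a), and reduces
    the choices per edge from [x k n^alpha] to [k n^alpha / x], again a geometric series. Finally
    [s <= C k^(1-lambda) n^alpha] is solved for [k], which creates the exponent [lambda/(lambda-1)].
    The colors tell in which round an edge entered the fingerprint, so that the rounds can be
    replayed from the colored graph alone. The strict inequality [lambda > 1] is delicate because
    [A] is arbitrary: to exclude [alpha = 2 - 1/m2], every constant factor has to be beaten, not
    just the one of the deletion method. *)

Section ProductMeasure.
Variables (R : realFieldType) (X O : finType) (p : X -> O -> R).
Hypothesis p_ge0 : forall x a, 0 <= p x a.
Hypothesis p_sum1 : forall x, \sum_a p x a = 1.

Definition pmass (w : {ffun X -> O}) : R := \prod_x p x (w x).

Definition pexp (f : {ffun X -> O} -> R) : R := \sum_w pmass w * f w.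

Lemma pmass_ge0 w : 0 <= pmass w.
Proof. exact: prodr_ge0. Qed.

Lemma pexp_prod (g : X -> O -> R) :
  pexp (fun w => \prod_x g x (w x)) = \prod_x \sum_a p x a * g x a.
Proof.
rewrite /pexp (bigA_distr_bigA (fun x a => p x a * g x a)).
by apply: eq_bigr => w _; rewrite big_split.
Qed.

Lemma eq_pexp f g : f =1 g -> pexp f = pexp g.
Proof. by move=> fg; apply: eq_bigr => w _; rewrite fg. Qed.

Lemma pexp_cst c : pexp (fun=> c) = c.
Proof.
rewrite /pexp -mulr_suml -(eq_bigr _ (fun w _ => mulr1 (pmass w))).
transitivity (pexp (fun w => \prod_x (fun _ _ => 1) x (w x)) * c).
  by congr (_ * c); apply: eq_bigr => w _; rewrite big1.
rewrite (pexp_prod (fun _ _ => 1)) big1 ?mul1r// => x _.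
by under eq_bigr do rewrite mulr1.
Qed.

Lemma pexp_coord x (h : O -> R) : pexp (fun w => h (w x)) = \sum_a p x a * h a.
Proof.
pose g y a := if y == x then h a else 1.
rewrite (eq_pexp (g := fun w => \prod_y g y (w y))) => [|w].
  rewrite pexp_prod (bigD1 x)//= [X in _ * X]big1 ?mulr1 => [|y /negPf yx].
    by apply: eq_bigr => a _; rewrite /g eqxx.
  by rewrite -[RHS](p_sum1 y); apply: eq_bigr => a _; rewrite /g yx mulr1.
by rewrite (bigD1 x)//= /g eqxx big1 ?mulr1// => y /negPf ->.
Qed.

Lemma pexpD f g : pexp (fun w => f w + g w) = pexp f + pexp g.
Proof. by rewrite -big_split; apply: eq_bigr => w _; rewrite mulrDr. Qed.

Lemma pexpZ c f : pexp (fun w => c * f w) = c * pexp f.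
Proof. by rewrite mulr_sumr; apply: eq_bigr => w _; rewrite mulrCA. Qed.

Lemma pexpB f g : pexp (fun w => f w - g w) = pexp f - pexp g.
Proof. by rewrite -sumrB; apply: eq_bigr => w _; rewrite mulrBr. Qed.

Lemma pexp_sum (I : Type) (s : seq I) (P : pred I) (F : I -> {ffun X -> O} -> R) :
  pexp (fun w => \sum_(i <- s | P i) F i w) = \sum_(i <- s | P i) pexp (F i).
Proof.
rewrite exchange_big; apply: eq_bigr => w _.
by rewrite mulr_sumr.
Qed.

Lemma le_pexp f g : (forall w, f w <= g w) -> pexp f <= pexp g.
Proof. by move=> fg; apply: ler_sum => w _; rewrite ler_wpM2l ?pmass_ge0. Qed.

Lemma pexp_attained f : exists w, pexp f <= f w.
Proof.
have [/existsP[w fw]|/existsPn nf] := boolP [exists w, pexp f <= f w].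
  by exists w.
have lt w : f w < pexp f by rewrite ltNge nf.
have : pexp (fun w => pexp f - f w) = 0 by rewrite pexpB pexp_cst subrr.
move/eqP; rewrite /pexp psumr_eq0; last first.
  by move=> w _; rewrite mulr_ge0 ?pmass_ge0// subr_ge0 ltW.
move=> /allP z0; have := pexp_cst 1; rewrite /pexp big1 => [/esym/eqP|w _].
  by rewrite oner_eq0.
have := z0 w (mem_index_enum w); rewrite mulf_eq0 subr_eq0 => /orP[/eqP->|].
  by rewrite mul0r.
by rewrite gt_eqF ?lt.
Qed.

Definition depends_on (T : Type) (S : {set X}) (f : {ffun X -> O} -> T) : Prop :=
  forall w w' : {ffun X -> O}, {in S, w =1 w'} -> f w = f w'.

(* Swapping the coordinates outside S between two independent samples. *)
Lemma pexpM (S S' : {set X}) f g : [disjoint S & S'] ->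
  depends_on S f -> depends_on S' g ->
  pexp (fun w => f w * g w) = pexp f * pexp g.
Proof.
move=> SS' Sf S'g.
pose mix (w w' : {ffun X -> O}) := [ffun x => if x \in S then w x else w' x].
pose h u := (mix u.1 u.2, mix u.2 u.1).
have hK : involutive h.
  case=> w w'; congr pair; apply/ffunP => x; rewrite !ffunE/=;
  by case: ifP => //; rewrite ?ffunE => ->.
have pexp2 f1 g1 : pexp f1 * pexp g1 =
    \sum_u (pmass u.1 * f1 u.1) * (pmass u.2 * g1 u.2).
  rewrite /pexp mulr_suml; under eq_bigr do rewrite mulr_sumr.
  by rewrite pair_big.
rewrite -[LHS]mulr1 -(pexp_cst 1) !pexp2 [RHS](reindex_inj (inv_inj hK))/=.
apply: eq_bigr => -[w w'] _ /=.
have -> : f (mix w w') = f w by apply: Sf => x xS; rewrite ffunE xS.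
have -> : g (mix w' w) = g w.
  apply: S'g => x xS'; rewrite ffunE ifN//.
  by apply/negP => /(disjointFr SS'); rewrite xS'.
have : pmass (mix w w') * pmass (mix w' w) = pmass w * pmass w'.
  rewrite /pmass -!big_split; apply: eq_bigr => x _/=; rewrite !ffunE.
  by case: ifP => // _; rewrite mulrC.
set a := pmass (mix _ _); set b := pmass (mix _ _) => ab.
by rewrite mulr1 [RHS]mulrACA ab; ring.
Qed.

Lemma pexp_prod_indep (I : finType) (s : seq I) (S : I -> {set X})
    (f : I -> {ffun X -> O} -> R) :
  uniq s ->
  {in s &, forall i j, i != j -> [disjoint S i & S j]} ->
  {in s, forall i, depends_on (S i) (f i)} ->
  pexp (fun w => \prod_(i <- s) f i w) = \prod_(i <- s) pexp (f i).
Proof.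
elim: s => [_ _ _|i s IHs /=].
  by rewrite big_nil -[RHS]pexp_cst; apply: eq_pexp => w; rewrite big_nil.
case/andP=> is_s us dS df; rewrite big_cons -IHs//; first last.
- by move=> j js; apply: df; rewrite inE js orbT.
- by move=> j k js ks; apply: dS; rewrite inE ?js ?ks orbT.
rewrite -(@pexpM (S i) (\bigcup_(j <- s) S j)).
- by apply: eq_pexp => w; rewrite big_cons.
- rewrite -setI_eq0; apply/eqP/setP => x; rewrite !inE; apply/negP => /andP[xi].
  rewrite bigcup_seq => /bigcupP[j js xj].
  have ij : i != j by apply: contraNneq is_s => ->.
  have := dS i j (mem_head i s) _ ij; rewrite inE js orbT => /(_ isT).
  by move=> /disjointFr/(_ xi); rewrite xj.
- by apply: df; rewrite mem_head.
- move=> w w' ww'; apply: eq_big_seq => j js; apply: df.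
    by rewrite inE js orbT.
  by move=> x xj; apply: ww'; rewrite bigcup_seq; apply/bigcupP; exists j.
Qed.

End ProductMeasure.

(** * Independent sets in tree-like hypergraphs *)

(** One point is deleted from [S] for every set of [B] that lies inside it. *)
Lemma hitting_removal (X : finType) (S : {set X}) (B : {set {set X}}) :
  {in B, forall E : {set X}, E != set0} ->
  exists I : {set X}, [/\ I \subset S, {in B, forall E : {set X}, ~~ (E \subset I)} &
    (#|S| <= #|I| + #|[set E in B | E \subset S]|)%N].
Proof.
move=> B0; pose B' := [set E in B | E \subset S].
have [x0 _|X0] := pickP (fun _ : X => true); last first.
  have S0 : S = set0 by apply/setP => x; have := X0 x.
  exists set0; rewrite S0 cards0; split=> //.
  by move=> E EB; have /set0Pn[x] := B0 _ EB; have := X0 x.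
pose h (E : {set X}) := odflt x0 [pick x in E].
exists (S :\: h @: B'); split; first exact: subsetDl.
  move=> E EB; apply/negP => ES.
  have EB' : E \in B' by rewrite inE EB (subset_trans ES) ?subsetDl.
  have hE : h E \in E.
    rewrite /h; case: pickP => //= E0; have /set0Pn[x] := B0 _ EB.
    by rewrite E0.
  by have := subsetP ES _ hE; rewrite inE imset_f.
rewrite -(cardsID (h @: B') S) addnC leq_add2l.
by rewrite (leq_trans (subset_leq_card (subsetIr _ _))) ?leq_imset_card.
Qed.

Section Chains.
Variables (X : finType) (Hy : {set {set X}}).
Implicit Types (E F : {set X}) (r es : seq {set X}) (u w x y z : X).

Definition hunion (es : seq {set X}) : {set X} := \bigcup_(E in es) E.

(* The most recent hyperedge comes first. *)
Fixpoint linked_chain (es : seq {set X}) : bool :=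
  if es is E :: r then
    [&& linked_chain r, E \in Hy, E \notin r &
        (r == [::]) || (E :&: hunion r != set0)]
  else true.

(** The analogue of large girth: a connected chain of at most [g] hyperedges neither closes a cycle
    nor contains two hyperedges with two common vertices. *)
Definition treelike (g : nat) : Prop :=
  forall E r, linked_chain (E :: r) -> r != [::] -> (size r < g)%N ->
  (#|E :&: hunion r| <= 1)%N.

(* The ends of the non-backtracking walks from [u] that start away from [E]. *)
Fixpoint branch (i : nat) (u : X) (E : {set X}) : {set X} :=
  if i is j.+1 then
    u |: \bigcup_(E' in [set E' in Hy | (u \in E') && (E' != E)])
           \bigcup_(w in E' :\ u) branch j w E'
  else set0.

Lemma hunion_cons E r : hunion (E :: r) = E :|: hunion r.
Proof.
apply/setP => x; rewrite inE; apply/bigcupP/orP.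
  case=> F; rewrite inE => /orP[/eqP->|Fr] xF; [by left|right].
  by apply/bigcupP; exists F.
case=> [xE|/bigcupP[F Fr xF]]; first by exists E; rewrite ?mem_head.
by exists F; rewrite // inE Fr orbT.
Qed.

Lemma mem_hunion E r x : E \in r -> x \in E -> x \in hunion r.
Proof. by move=> Er xE; apply/bigcupP; exists E. Qed.

Section TreeLike.
Variable g : nat.
Hypothesis tree : treelike g.

(** The explored chain [r] contains [u] only in [E], so tree-likeness forces the next hyperedge of
    the walk to meet [hunion r] in [u] alone. Its other vertices are fresh, which is the same
    situation one level deeper. The conclusion returns the whole chain so that a second walk can be
    appended to it. *)
Lemma branch_walk i u E r y :
  linked_chain r -> E \in r -> u \in E ->
  {in r, forall F : {set X}, u \in F -> F = E} -> (size r + i <= g.+1)%N ->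
  y \in branch i u E ->
  exists r', [/\ linked_chain (r' ++ r), (size r' < i)%N, y \in hunion (r' ++ r),
    {in r', forall F : {set X}, forall z, z \in F -> z \in hunion r -> z = u} &
    y = u \/ y \notin hunion r].
Proof.
elim: i u E r => [|i IHi] u E r; first by rewrite inE.
move=> chr Er uE fresh sr; rewrite inE => /orP[|].
  rewrite inE => /eqP->; exists [::]; split=> //; last by left.
  exact: mem_hunion Er uE.
case/bigcupP=> E'; rewrite inE => /andP[E'H /andP[uE' E'E]].
case/bigcupP=> w; rewrite !inE => /andP[wu wE'] ybr.
have E'r : E' \notin r by apply: contraNN E'E => /fresh ->.
have chr' : linked_chain (E' :: r).
  rewrite /= chr E'H E'r/=; apply/orP; right; apply/set0Pn; exists u.
  by rewrite inE uE' (mem_hunion Er).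
have only_u z : z \in E' -> z \in hunion r -> z = u.
  move=> zE' zr; have := tree chr'.
  have -> : (r != [::]) by apply: contraTneq Er => ->.
  have -> : (size r < g)%N.
    rewrite -ltnS (leq_trans _ sr)// -[X in (X <= _)%N]addn2 leq_add2l ltnS.
    by move: ybr; case: (i) => //; rewrite inE.
  move=> /(_ isT isT)/card_le1_eqP; apply; rewrite !inE ?zE' ?uE' ?zr//.
  exact: mem_hunion Er uE.
have wr : w \notin hunion r by apply: contraNN wu => /(only_u _ wE')->.
have freshw : {in E' :: r, forall F : {set X}, w \in F -> F = E'}.
  move=> F; rewrite inE => /orP[/eqP->//|Fr wF].
  by rewrite (mem_hunion Fr wF) in wr.
have sr' : (size (E' :: r) + i <= g.+1)%N by rewrite /= addSnnS.
have [r' [ch sz yr only yor]] := IHi _ _ _ chr' (mem_head _ _) wE' freshw sr' ybr.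
exists (rcons r' E'); rewrite cat_rcons size_rcons; split=> //.
  move=> F; rewrite mem_rcons inE => /orP[/eqP->|Fr'] z zF zr.
    exact: only_u.
  move: (only F Fr' z zF); rewrite hunion_cons inE zr orbT => /(_ isT) zw.
  by rewrite -zw zr in wr.
right; case: yor => [->//|]; rewrite hunion_cons inE negb_or => /andP[] //.
Qed.

Lemma chain1 E : E \in Hy -> linked_chain [:: E].
Proof. by move=> EH; rewrite /= EH. Qed.

Lemma hunion1 (E : {set X}) : hunion [:: E] = E.
Proof.
apply/setP => x; apply/bigcupP/idP => [[F]|xE]; first by rewrite inE => /eqP->.
by exists E; rewrite ?mem_head.
Qed.

Lemma branch_root i u E : E \in Hy -> u \in E -> (i <= g)%N ->
  {in E :\ u, forall w, u \notin branch i w E}.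
Proof.
move=> EH uE ig w; rewrite !inE => /andP[wu wE]; apply/negP => ub.
have fr : {in [:: E], forall F : {set X}, w \in F -> F = E}.
  by move=> F; rewrite inE => /eqP.
have [r [_ _ _ _]] := branch_walk (chain1 EH) (mem_head _ _) wE fr ig ub.
by rewrite hunion1 uE => -[/esym/eqP|//]; rewrite (negPf wu).
Qed.

(** A common point [y] would be reached by two walks. With the chain of the first one as explored
    part, the second walk can end only at its start [w'] or at a fresh point; [y] is not fresh, and
    [y = w'] contradicts the first walk or the freshness of [w']. Both walks lie in one chain, hence
    the condition on [i.*2]. *)
Lemma branch_disjoint i u E E' w w' :
  E \in Hy -> E' \in Hy -> u \in E -> u \in E' -> w \in E :\ u ->
  w' \in E' :\ u -> (E, w) != (E', w') -> (i.*2 < g)%N ->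
  [disjoint branch i w E & branch i w' E'].
Proof.
move=> EH E'H uE uE'; rewrite !inE => /andP[wu wE] /andP[w'u w'E'] neq ig.
rewrite -setI_eq0; apply/eqP/setP => y; rewrite in_set0 inE.
apply/negP => /andP[yb yb'].
have fr : {in [:: E], forall F : {set X}, w \in F -> F = E}.
  by move=> F; rewrite inE => /eqP.
have sz1 : (size [:: E] + i <= g.+1)%N by clear -ig; rewrite /=; lia.
have [r [ch sz yr only _]] := branch_walk (chain1 EH) (mem_head _ _) wE fr sz1 yb.
have onlyE F z : F \in r ++ [:: E] -> z \in F -> z \in E -> z != w -> F = E.
  rewrite mem_cat inE => /orP[Fr zF zE|/eqP//] /eqP[].
  by apply: (only F Fr z zF); rewrite hunion1.
have [eqE|neE] := eqVneq E' E.
  subst E'; have ww' : w' != w by apply: contraNneq neq => ->.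
  have fr' : {in r ++ [:: E], forall F : {set X}, w' \in F -> F = E}.
    by move=> F Fr w'F; apply: onlyE Fr w'F w'E' ww'.
  have [| |r' [_ _ _ _]] := branch_walk ch _ w'E' fr' _ yb'.
  - by rewrite mem_cat mem_head orbT.
  - by clear -ig sz; rewrite size_cat/=; lia.
  rewrite yr => -[yw'|//]; subst y.
  have [r2 [_ _ _ _]] := branch_walk (chain1 EH) (mem_head _ _) wE fr sz1 yb.
  by rewrite hunion1 w'E' => -[/eqP|//]; rewrite (negPf ww').
have uw : u != w by rewrite eq_sym.
have E'r : E' \notin r ++ [:: E].
  by apply: contraNN neE => E'r; apply/eqP/(onlyE _ u).
have ch' : linked_chain (E' :: r ++ [:: E]).
  rewrite /= ch E'H E'r/=; apply/orP; right; apply/set0Pn; exists u.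
  by rewrite inE uE' (@mem_hunion E) ?mem_cat ?mem_head ?orbT.
have w'r : w' \notin hunion (r ++ [:: E]).
  apply: contraNN w'u => w'r; have := tree ch'.
  have -> : (r ++ [:: E] != [::]) by case: (r).
  have -> : (size (r ++ [:: E]) < g)%N by clear -ig sz; rewrite size_cat/=; lia.
  move=> /(_ isT isT)/card_le1_eqP le1; apply/eqP/le1.
    by rewrite inE uE' (@mem_hunion E) ?mem_cat ?mem_head ?orbT.
  by rewrite inE w'E'.
have fr' : {in E' :: r ++ [:: E], forall F : {set X}, w' \in F -> F = E'}.
  move=> F; rewrite inE => /orP[/eqP//|Fr w'F].
  by rewrite (mem_hunion Fr w'F) in w'r.
have [|r' [_ _ _ _]] := branch_walk ch' (mem_head _ _) w'E' fr' _ yb'.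
  by clear -ig sz; rewrite /= size_cat/=; lia.
rewrite hunion_cons inE yr orbT => -[yw'|//].
by rewrite -yw' yr in w'r.
Qed.

End TreeLike.
End Chains.

Lemma prodr_indicator (R : realFieldType) (I : finType) (A : {set I}) (P : pred I) :
  \prod_(i in A) (P i)%:R = [forall i in A, P i]%:R :> R.
Proof.
have [/forall_inP PA|/forall_inPn[i iA nP]] := boolP [forall i in A, P i].
  by rewrite big1// => i /PA ->.
by rewrite (bigD1 i)//= (negPf nP) mul0r.
Qed.

Lemma sumn_indicator (I : finType) (A : {set I}) (P : pred I) :
  (\sum_(i in A) P i = #|[set i in A | P i]|)%N.
Proof.
by rewrite -big_mkcondr sum1_card; apply: eq_card => i; rewrite inE.
Qed.

Lemma sumr_indicator (R : realFieldType) (I : finType) (A : {set I}) (P : pred I) :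
  \sum_(i in A) (P i)%:R = #|[set i in A | P i]|%:R :> R.
Proof. by rewrite -natr_sum sumn_indicator. Qed.

(** * Random greedy acceptance with discrete arrival times *)

Section GreedyIndependentSet.
Variables (R : realFieldType) (X : finType) (Hy : {set {set X}}).
Variables (r D M g : nat) (kappa : R).
Implicit Types (E F : {set X}) (u x y z : X).

Let d x := #|[set E in Hy | x \in E]|.

Hypothesis r_gt1 : (1 < r)%N.
Hypothesis M_gt0 : (0 < M)%N.
Hypothesis unif : {in Hy, forall E : {set X}, #|E| = r}.
Hypothesis deg : forall x, (d x <= D)%N.
Hypothesis g_gt : (M.*2 < g)%N.
Hypothesis tree : treelike Hy g.
Hypothesis kappa_gt0 : 0 < kappa.
Hypothesis kappa_lt1 : kappa < 1.
Hypothesis kappaD : kappa <= (1 - kappa ^+ r.-1) ^+ D.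

(** The probability that a given hyperedge does not block a vertex arriving at time [i]: each of its
    other [r.-1] vertices has been accepted with probability [i * kappa / M] when that hyperedge is
    disregarded, and these events are independent. *)
Let b (i : nat) : R := 1 - (i%:R * (kappa / M%:R)) ^+ r.-1.

(* Chosen so that a vertex of degree [d x] is accepted with label [i] with
   probability exactly [kappa / M] when one of its hyperedges is ignored.  The
   label [M] stands for a vertex that is never accepted. *)
Let pS x (i : nat) : R := kappa / M%:R / b i ^+ (d x).-1.

Let p x (a : 'I_M.+1) : R :=
  if (a < M)%N then pS x a else 1 - \sum_(i < M) pS x i.

Let MR_gt0 : 0 < M%:R :> R. Proof. by rewrite ltr0n. Qed.

Let b_ge i : (i <= M)%N -> 1 - kappa ^+ r.-1 <= b i.
Proof.
move=> iM; rewrite lerD2l lerN2.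
have i0 : 0 <= i%:R * (kappa / M%:R) by rewrite mulr_ge0// divr_ge0 ?ltW.
rewrite lerXn2r ?nnegrE//; first exact: ltW.
by rewrite mulrCA ger_pMr// ler_pdivrMr ?mul1r ?ler_nat.
Qed.

Let bM_gt0 : 0 < 1 - kappa ^+ r.-1.
Proof. by rewrite subr_gt0 exprn_ilt1 ?ltW// -lt0n -ltnS prednK// ltnW. Qed.

Let b_gt0 i : (i <= M)%N -> 0 < b i.
Proof. by move=> /b_ge; apply: lt_le_trans. Qed.

Let pS_ge0 x i : (i <= M)%N -> 0 <= pS x i.
Proof.
by move=> iM; rewrite !divr_ge0 ?exprn_ge0// ltW// b_gt0.
Qed.

(** The purpose of [kappaD]: the probabilities of the [M] genuine labels add up to at most 1, and
    the label [M] takes the rest. *)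
Let pS_le x i : (i <= M)%N -> pS x i <= M%:R^-1.
Proof.
move=> iM; rewrite /pS mulrAC ger_pMl ?invr_gt0//.
rewrite ler_pdivrMr ?exprn_gt0 ?b_gt0// mul1r (le_trans kappaD)//.
have b1 : 1 - kappa ^+ r.-1 <= 1 by rewrite gerBl exprn_ge0 ?ltW.
apply: (@le_trans _ _ ((1 - kappa ^+ r.-1) ^+ (d x).-1)).
  apply: ler_wiXn2l b1 _ _ _; first exact: ltW.
  exact: leq_trans (leq_pred _) (deg x).
by rewrite lerXn2r ?nnegrE ?b_ge// ltW// b_gt0.
Qed.

Let p_ge0 x a : 0 <= p x a.
Proof.
rewrite /p; case: ltnP => [aM|_]; first by rewrite pS_ge0 ?ltW// ltnW.
rewrite subr_ge0 (le_trans (ler_sum _ _) (_ : \sum_(i < M) M%:R^-1 <= 1))//.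
  by move=> i _; rewrite pS_le// ltnW.
by rewrite sumr_const card_ord -[X in X <= _]mulr_natr mulVf// gt_eqF.
Qed.

Let p_sum1 x : \sum_a p x a = 1.
Proof.
rewrite big_ord_recr/= {2}/p ltnn; under eq_bigr => i _ do rewrite /p /= ltn_ord.
by rewrite addrC subrK.
Qed.

Let Om := {ffun X -> 'I_M.+1}.
Implicit Type w : Om.
Let lab w x (j : nat) : bool := w x == j :> nat.
Let Ex := pexp p.

Let Ex_lab x j : (j < M)%N -> Ex (fun w => (lab w x j)%:R) = pS x j.
Proof.
move=> jM; rewrite /Ex (pexp_coord p_sum1 x (fun a => (a == j :> nat)%:R)).
rewrite (bigD1 (Ordinal (ltnW jM : j < M.+1)%N))//= eqxx mulr1 big1 ?addr0.
  by rewrite /p /= jM.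
move=> a; rewrite -val_eqE/= => /negPf ->; exact: mulr0.
Qed.

(** Labels are arrival times. Disregarding [E], the hyperedge through which [u] is looked at,
    confines the event to the labels in [branch i u E]; events belonging to different branches at a
    vertex are then independent. *)
Fixpoint accepted_off (i : nat) w u E : bool :=
  if i is j.+1 then
    accepted_off j w u E ||
    (w u == j :> nat) && [forall F in [set F in Hy | (u \in F) && (F != E)],
                 ~~ [forall y in F :\ u, accepted_off j w y F]]
  else false.

Fixpoint accepted (i : nat) w : {set X} :=
  if i is j.+1 then
    accepted j w :|: [set x | (w x == j :> nat) &&
      [forall F in [set F in Hy | x \in F], ~~ (F :\ x \subset accepted j w)]]
  else set0.

Lemma branch_mono i u E : branch Hy i u E \subset branch Hy i.+1 u E.
Proof.
elim: i u E => [|i IHi] u E; first by rewrite sub0set.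
rewrite setUS//; apply/bigcupsP => F FH; apply: (bigcup_max F) => //.
by apply/bigcupsP => y yF; apply: (bigcup_max y).
Qed.

Lemma accepted_off_dep i u E :
  depends_on (branch Hy i u E) (fun w => accepted_off i w u E).
Proof.
elim: i u E => [|i IHi] u E // w w' ww' /=.
rewrite (IHi u E w w'); last first.
  by move=> x xb; apply: ww'; apply: subsetP xb; apply: branch_mono.
rewrite ww' ?setU11//; congr (_ || _ && _).
apply: eq_forallb_in => F FH; congr (~~ _); apply: eq_forallb_in => y yF.
apply: IHi => x xb; apply: ww'; rewrite inE; apply/orP; right.
by apply/bigcupP; exists F => //; apply/bigcupP; exists y.
Qed.

Lemma accepted_off_label i w u E : accepted_off i w u E -> (w u < i)%N.
Proof.
elim: i => //= i IHi /orP[/IHi/ltnW//|/andP[/eqP-> _]]; exact: ltnSn.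
Qed.

Lemma accepted_label i w u : u \in accepted i w -> (w u < i)%N.
Proof.
elim: i => /= [|i IHi]; first by rewrite inE.
rewrite !inE => /orP[/IHi/ltnW//|/andP[/eqP-> _]]; exact: ltnSn.
Qed.

Lemma accepted_mono j k w : (j <= k)%N -> accepted j w \subset accepted k w.
Proof.
move=> jk; rewrite -(subnK jk); elim: (k - j)%N => //= m IHm.
by rewrite (subset_trans IHm) ?subsetUl.
Qed.

Lemma accepted_at k w x : x \in accepted k w -> x \in accepted (w x).+1 w.
Proof.
elim: k => [|k IHk]; first by rewrite inE.
rewrite [accepted k.+1 w]/= in_setU => /orP[/IHk//|]; rewrite inE.
by case/andP=> /eqP wk H; rewrite wk in_setU inE wk eqxx H orbT.
Qed.

(** As long as [x] is not accepted, [E] cannot be the hyperedge that blocks [u], so disregarding it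
    changes nothing. This carries the exact probabilities of [accepted_off] over to the actual
    process. *)
Lemma acceptedE j w x u E : E \in Hy -> x \in E -> u \in E -> u != x ->
  x \notin accepted j w -> (u \in accepted j w) = accepted_off j w u E.
Proof.
elim: j x u E => [|j IHj] x u E EH xE uE ux /=; first by rewrite !inE.
rewrite in_setU negb_or => /andP[xA _]; rewrite in_setU (IHj x u E)// inE.
have [labu|_] := eqVneq; last by rewrite !andFb.
have uA : u \notin accepted j w.
  by apply/negP => /accepted_label; rewrite labu ltnn.
congr (_ || _); apply/forall_inP/forall_inP => blk F; rewrite inE.
  move=> /and3P[FH uF FE]; have := blk F; rewrite inE FH uF => /(_ isT).
  apply: contraNN => /forall_inP all; apply/subsetP => y yF.
  have := yF; rewrite !inE => /andP[yu yF'].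
  by rewrite (IHj u y F)// all.
move=> /andP[FH uF]; have [->|FE] := eqVneq F E.
  by apply: contraNN xA => /subsetP; apply; rewrite !inE eq_sym ux.
have := blk F; rewrite inE FH uF FE => /(_ isT).
apply: contraNN => /subsetP all; apply/forall_inP => y yF.
have := yF; rewrite !inE => /andP[yu yF'].
by rewrite -(IHj u y F)// all.
Qed.

Let blocks i w u F : R := \prod_(y in F :\ u) (accepted_off i w y F)%:R.

(** The branches below the pairs [(F, y)] are disjoint from each other and do not contain [u], so
    the expectation of the product factors completely. *)
Let Ex_label_free i u (A : {set {set X}}) :
  (i < M)%N -> A \subset [set F in Hy | u \in F] ->
  {in A, forall F : {set X}, {in F :\ u, forall y,
    Ex (fun w => (accepted_off i w y F)%:R) = i%:R * (kappa / M%:R)}} ->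
  Ex (fun w => (lab w u i)%:R * \prod_(F in A) (1 - blocks i w u F)) =
  pS u i * b i ^+ #|A|.
Proof.
move=> iM AH pN; have ig : (i.*2 < g)%N by rewrite (leq_trans _ g_gt)// ltnS leq_double ltnW.
have ig1 : (i <= g)%N by rewrite (leq_trans _ (ltnW ig))// -addnn leq_addr.
have AP F : F \in A -> F \in Hy /\ u \in F.
  by move=> /(subsetP AH); rewrite inE => /andP[].
pose S F := \bigcup_(y in F :\ u) branch Hy i y F.
have disj F y F' y' : F \in A -> F' \in A -> y \in F :\ u -> y' \in F' :\ u ->
    (F, y) != (F', y') -> [disjoint branch Hy i y F & branch Hy i y' F'].
  move=> /AP[FH uF] /AP[FH' uF'] yF yF' neq.
  exact: (branch_disjoint tree FH FH' uF uF' yF yF' neq ig).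
have disjS F F' : F \in A -> F' \in A -> F != F' -> [disjoint S F & S F'].
  move=> FA FA' FF'; apply/bigcup_disjointP => y yF.
  rewrite disjoint_sym; apply/bigcup_disjointP => y' yF'.
  rewrite disjoint_sym; apply: disj => //.
  by apply: contraNneq FF' => -[->].
have depb F : depends_on (S F) (fun w => 1 - blocks i w u F).
  move=> w w' ww'; congr (1 - _); apply: eq_bigr => y yF; congr (_%:R).
  by rewrite (@accepted_off_dep i y F w w')// => x xb; apply: ww'; apply/bigcupP; exists y.
have Eblocks F : F \in A -> Ex (fun w => 1 - blocks i w u F) = b i.
  move=> FA; rewrite /Ex pexpB (pexp_cst p_sum1); congr (1 - _).
  have [FH uF] := AP _ FA.
  under eq_pexp do rewrite /blocks -big_enum.
  rewrite (@pexp_prod_indep _ _ _ _ p_sum1 _ _ (fun y => branch Hy i y F)).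
  - rewrite (eq_big_seq (fun=> i%:R * (kappa / M%:R))).
      rewrite big_enum prodr_const; congr (_ ^+ _).
      by have := unif FH; rewrite (cardsD1 u) uF => <-.
    by move=> y; rewrite mem_enum => yF; apply: pN.
  - exact: enum_uniq.
  - move=> y y'; rewrite !mem_enum => yF yF' yy'; apply: disj => //.
    by apply: contraNneq yy' => -[->].
  - by move=> y _ w w' ww'; rewrite (accepted_off_dep ww').
rewrite /Ex (@pexpM _ _ _ _ p_sum1 [set u] (\bigcup_(F in A) S F)).
- rewrite -/Ex Ex_lab//; congr (_ * _); rewrite /Ex.
  under eq_pexp do rewrite -big_enum.
  rewrite (@pexp_prod_indep _ _ _ _ p_sum1 _ _ S).
  + rewrite (eq_big_seq (fun=> b i)) ?big_enum ?prodr_const//.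
    by move=> F; rewrite mem_enum => FA; apply: Eblocks.
  + exact: enum_uniq.
  + by move=> F F'; rewrite !mem_enum; apply: disjS.
  + by move=> F _; apply: depb.
- apply/bigcup_disjointP => F FA.
  apply/bigcup_disjointP => y yF; have [FH uF] := AP _ FA.
  rewrite disjoints1; exact: (branch_root tree FH uF ig1 yF).
- by move=> w w' ww'; rewrite /lab ww'// inE.
- move=> w w' ww'; apply: eq_bigr => F FA; apply: depb => x xS; apply: ww'.
  by apply/bigcupP; exists F.
Qed.

Let prod_blocks i w u (A : {set {set X}}) :
  \prod_(F in A) (1 - blocks i w u F) =
  [forall F in A, ~~ [forall y in F :\ u, accepted_off i w y F]]%:R.
Proof.
rewrite -prodr_indicator; apply: eq_bigr => F _; rewrite /blocks prodr_indicator.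
by case: [forall y in F :\ u, accepted_off i w y F]; rewrite ?subrr ?subr0.
Qed.

(** The hyperedges through [u] other than [E] contribute [b i ^+ (d u).-1], which cancels the
    denominator of [pS]: every round adds exactly [kappa / M]. *)
Let Ex_accepted_off i u E : (i <= M)%N -> E \in Hy -> u \in E ->
  Ex (fun w => (accepted_off i w u E)%:R) = i%:R * (kappa / M%:R).
Proof.
elim: i u E => [|i IHi] u E iM EH uE; first by rewrite /Ex pexp_cst// mul0r.
pose A := [set F in Hy | (u \in F) && (F != E)].
have AH : A \subset [set F in Hy | u \in F].
  by apply/subsetP => F; rewrite !inE => /and3P[-> ->].
rewrite /Ex (@eq_pexp _ _ _ p _ (fun w => (accepted_off i w u E)%:R +
   (lab w u i)%:R * \prod_(F in A) (1 - blocks i w u F))).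
  rewrite pexpD -/Ex IHi ?(ltnW iM)// Ex_label_free//.
    rewrite -natr1 mulrDl mul1r; congr (_ + _); rewrite /pS.
    have -> : (d u).-1 = #|A|.
      rewrite /d (cardsD1 E) inE EH uE /=; apply: eq_card => F.
      by rewrite !inE; case: eqP; rewrite ?andbT ?andbF.
    by rewrite divfK// expf_neq0// gt_eqF// b_gt0// ltnW.
  move=> F /(subsetP AH); rewrite inE => /andP[FH uF] y.
  by rewrite !inE => /andP[_ yF]; apply: IHi => //; apply: ltnW.
move=> w; rewrite prod_blocks /= -natrM mulnb -natrD -/(lab w u i) -/A.
case: (boolP (accepted_off i w u E)) => [/accepted_off_label|_] //=.
by rewrite /lab; case: eqP => [->|//]; rewrite ltnn.
Qed.

(** Now no hyperedge is disregarded, so one factor [b i >= 1 - kappa ^+ r.-1] survives the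
    cancellation. In degree 0, where [.-1] truncates, no factor occurs at all. *)
Let Ex_accepted i x : (i < M)%N ->
  kappa / M%:R * (1 - kappa ^+ r.-1) <=
  Ex (fun w => ((lab w x i) && (x \in accepted M w))%:R).
Proof.
move=> iM; pose A := [set F in Hy | x \in F].
have := @Ex_label_free i x A iM (subxx _).
have H : {in A, forall F : {set X}, {in F :\ x, forall y,
    Ex (fun w => (accepted_off i w y F)%:R) = i%:R * (kappa / M%:R)}}.
  move=> F; rewrite inE => /andP[FH xF] y; rewrite !inE => /andP[_ yF].
  by apply: Ex_accepted_off => //; apply: ltnW.
move=> /(_ H) E1; have : kappa / M%:R * (1 - kappa ^+ r.-1) <= pS x i * b i ^+ #|A|.
  have k0 : 0 <= kappa / M%:R by rewrite ltW// divr_gt0.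
  rewrite /pS -/(d x); case: (d x) => [|n] /=.
    by rewrite !expr0 mulr1 divr1 ger_pMr ?divr_gt0// gerBl exprn_ge0// ltW.
  rewrite exprS [b i * _]mulrC mulrA divfK ?ler_wpM2l ?b_ge//; first exact: ltnW.
  by rewrite expf_neq0// gt_eqF// b_gt0// ltnW.
move/le_trans; apply; rewrite -E1; apply: le_pexp => // w.
rewrite prod_blocks -natrM mulnb ler_nat; case: (boolP (lab w x i)) => //= labx.
case: (boolP [forall F in A, _]) => //= /forall_inP free.
rewrite (subsetP (accepted_mono w iM))//= in_setU; apply/orP; right.
rewrite inE; have -> /= : (w x == i :> nat) by exact: labx.
apply/forall_inP => F FA.
have := FA; rewrite inE => /andP[FH xF].
apply: contraNN (free F FA) => /subsetP all; apply/forall_inP => y yF.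
have := yF; rewrite !inE => /andP[yx yF'].
have xA : x \notin accepted i w.
  by apply/negP => /accepted_label; rewrite (eqP labx) ltnn.
by rewrite -(acceptedE FH xF yF' yx xA) all.
Qed.

(* Otherwise the vertex with the largest label would not have been accepted. *)
Lemma accepted_tie w E : E \in Hy -> E \subset accepted M w ->
  exists x y, [/\ x \in E, y \in E, x != y & w x = w y].
Proof.
move=> EH /subsetP sub.
have [x0 x0E] : exists x, x \in E.
  by apply/set0Pn; rewrite -card_gt0 unif// ltnW.
case: (arg_maxnP (fun x => w x : nat) x0E) => x xE0 xmax.
have xE : x \in E := xE0.
have := accepted_at (sub x xE).
rewrite /= in_setU => /orP[/accepted_label|]; first by rewrite ltnn.
rewrite inE eqxx /= => /forall_inP/(_ E); rewrite inE EH xE => /(_ isT).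
move=> /subsetPn[y]; rewrite !inE => /andP[yx yE] yA.
exists x, y; split=> //; first by rewrite eq_sym.
apply/val_inj/eqP; rewrite eqn_leq; have yx' : (w y <= w x)%N := xmax _ yE.
rewrite yx' andbT leqNgt; apply/negP => ylt.
have := accepted_at (sub y yE).
by move=> /(subsetP (accepted_mono w ylt)); rewrite (negPf yA).
Qed.

Let Ex_accepted_card (Vx : {set X}) :
  #|Vx|%:R * (kappa * (1 - kappa ^+ r.-1)) <=
  Ex (fun w => #|[set x in Vx | x \in accepted M w]|%:R).
Proof.
have lab1 w x (c : bool) : \sum_(i < M) (lab w x i && c)%:R <= c%:R :> R.
  case: c; last by rewrite big1// => i _; rewrite andbF.
  have [i0 li0|none] := pickP (fun i : 'I_M => lab w x i).
    rewrite (bigD1 i0)//= li0 big1 ?addr0// => i /negPf ii0.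
    by move: li0; rewrite /lab andbT => /eqP ->; rewrite eq_sym val_eqE ii0.
  by rewrite big1// => i _; rewrite none.
apply: (@le_trans _ _ (Ex (fun w =>
    \sum_(x in Vx) \sum_(i < M) (lab w x i && (x \in accepted M w))%:R))).
  rewrite /Ex pexp_sum mulr_natl -sumr_const; apply: ler_sum => x _.
  rewrite pexp_sum (le_trans _ (ler_sum _ (fun i _ => Ex_accepted x (ltn_ord i))))//.
  rewrite sumr_const card_ord -[X in _ <= X]mulr_natl mulrA mulrCA divff ?mulr1//.
  by rewrite gt_eqF.
apply: le_pexp => // w; rewrite -sumr_indicator; apply: ler_sum => x _.
exact: lab1.
Qed.

(** A fully accepted hyperedge contains a tie. Two given vertices share one of the [M] genuine
    labels with probability at most [M * M^-2], and [r ^ 2] bounds the number of pairs. *)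
Let Ex_tie : Ex (fun w => #|[set E in Hy | E \subset accepted M w]|%:R) <=
  #|Hy|%:R * (r%:R ^+ 2 / M%:R).
Proof.
apply: (@le_trans _ _ (Ex (fun w => \sum_(E in Hy) \sum_(x in E)
    \sum_(y in E | y != x) \sum_(j < M) (lab w x j)%:R * (lab w y j)%:R))).
  apply: le_pexp => // w; rewrite -sumr_indicator; apply: ler_sum => E EH.
  have nn x : 0 <= \sum_(y in E | y != x) \sum_(j < M)
      (lab w x j)%:R * (lab w y j)%:R :> R.
    by apply: sumr_ge0 => y _; apply: sumr_ge0 => j _; rewrite -natrM.
  case: (boolP (E \subset _)) => [sub|_]; last by apply: sumr_ge0.
  have [x [y [xE yE xy wxy]]] := accepted_tie EH sub.
  have wM := accepted_label (subsetP sub _ xE).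
  rewrite (bigD1 x)//= ler_wpDr ?sumr_ge0// (bigD1 y) ?yE 1?eq_sym//=.
  rewrite ler_wpDr//.
    by apply: sumr_ge0 => z _; apply: sumr_ge0 => j _; rewrite -natrM.
  rewrite (bigD1 (Ordinal wM))//= /lab -wxy eqxx mulr1 ler_wpDr//.
  by apply: sumr_ge0 => j _; rewrite -natrM.
rewrite /Ex pexp_sum mulr_natl -sumr_const; apply: ler_sum => E EH.
rewrite pexp_sum (@le_trans _ _ (\sum_(x in E) (r%:R / M%:R)))//; last first.
  by rewrite sumr_const (unif EH) -[X in X <= _]mulr_natl mulrA -expr2.
apply: ler_sum => x xE; rewrite pexp_sum.
rewrite (@le_trans _ _ (\sum_(y in E | y != x) M%:R^-1))//; last first.
  rewrite sumr_const -[X in X <= _]mulr_natl ler_wpM2r ?invr_ge0//.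
  rewrite ler_nat -(unif EH); apply: subset_leq_card; apply/subsetP => y.
  by case/andP.
apply: ler_sum => y /andP[yE yx]; rewrite pexp_sum.
rewrite (@le_trans _ _ (\sum_(j < M) (M%:R^-1 * M%:R^-1)))//; last first.
  by rewrite sumr_const card_ord -[X in X <= _]mulr_natl mulrA divff ?mul1r// gt_eqF.
apply: ler_sum => j _; have jM := ltnW (ltn_ord j).
rewrite (@pexpM _ _ _ _ p_sum1 [set x] [set y]).
- by rewrite -/Ex !Ex_lab// ler_pM ?pS_ge0 ?pS_le.
- by rewrite disjoints1 inE eq_sym.
- by move=> w w' ww'; rewrite /lab ww'// inE.
- by move=> w w' ww'; rewrite /lab ww'// inE.
Qed.

(** Only ties produce hyperedges inside the accepted set, and these are destroyed by deleting a
    vertex each. A large [M] makes this loss negligible. *)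
Lemma greedy_independent_set (Vx : {set X}) :
  {in Hy, forall E : {set X}, E \subset Vx} ->
  exists I : {set X}, [/\ I \subset Vx,
    {in Hy, forall E : {set X}, ~~ (E \subset I)} &
    #|Vx|%:R * (kappa * (1 - kappa ^+ r.-1)) - #|Hy|%:R * (r%:R ^+ 2 / M%:R)
     <= #|I|%:R].
Proof.
move=> HV.
have [w] := pexp_attained p_ge0 p_sum1 (fun w =>
  #|[set x in Vx | x \in accepted M w]|%:R -
  #|[set E in Hy | E \subset accepted M w]|%:R).
rewrite pexpB => le_w.
have [E /unif EH|I [IS nI cI]] :=
    @hitting_removal _ [set x in Vx | x \in accepted M w] Hy.
  by rewrite -card_gt0 EH ltnW.
exists I; split=> //.
  by rewrite (subset_trans IS)//; apply/subsetP => x; rewrite inE => /andP[].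
rewrite (le_trans (lerB (Ex_accepted_card Vx) Ex_tie))// (le_trans le_w)//.
rewrite lerBlDr -natrD ler_nat (leq_trans cI)// leq_add2l subset_leq_card//.
apply/subsetP => E; rewrite !inE => /andP[-> /subsetP sub] /=.
by apply/subsetP => x /sub; rewrite inE => /andP[].
Qed.

End GreedyIndependentSet.

(** * Dense graphs without copies of a balanced graph *)

Section RandomSubset.
Variables (R : realFieldType) (X : finType) (rho : R).
Hypothesis rho_ge0 : 0 <= rho.
Hypothesis rho_le1 : rho <= 1.

Definition coin (x : X) (a : bool) : R := if a then rho else 1 - rho.

Lemma coin_ge0 x a : 0 <= coin x a.
Proof. by case: a; rewrite /coin// subr_ge0. Qed.

Lemma coin_sum1 x : \sum_a coin x a = 1.
Proof. by rewrite big_bool/= addrC subrK. Qed.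

Definition heads (w : {ffun X -> bool}) : {set X} := [set x | w x].

Lemma pexp_subset (S : {set X}) :
  pexp coin (fun w => (S \subset heads w)%:R) = rho ^+ #|S|.
Proof.
pose g x (a : bool) : R := ((x \in S) ==> a)%:R.
rewrite (@eq_pexp _ _ _ coin _ (fun w => \prod_x g x (w x))).
  rewrite pexp_prod (bigID (mem S))/= [X in _ * X]big1 ?mulr1 => [|x /negPf xS].
    rewrite -prodr_const; apply: eq_bigr => x xS.
    by rewrite big_bool/= /g xS /= mulr1 mulr0 addr0.
  by rewrite big_bool/= /g xS /= !mulr1 addrC subrK.
move=> w; have [/subsetP sub|/subsetPn[x xS]] := boolP (S \subset heads w).
  rewrite big1// => x _; rewrite /g; case: (boolP (x \in S)) => //= /sub.
  by rewrite inE => ->.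
by rewrite inE => /negPf wx; rewrite (bigD1 x)//= /g xS wx mul0r.
Qed.

Lemma pexp_card_subsets (B : {set {set X}}) :
  pexp coin (fun w => #|[set S in B | S \subset heads w]|%:R) =
  \sum_(S in B) rho ^+ #|S|.
Proof.
under eq_pexp do rewrite -sumr_indicator.
by rewrite pexp_sum; apply: eq_bigr => S _; rewrite pexp_subset.
Qed.

Lemma pexp_card_heads (Y : {set X}) :
  pexp coin (fun w => #|[set x in Y | x \in heads w]|%:R) = #|Y|%:R * rho.
Proof.
under eq_pexp do rewrite -sumr_indicator.
rewrite pexp_sum mulr_natl -sumr_const; apply: eq_bigr => x _.
under eq_pexp do rewrite -sub1set.
by rewrite pexp_subset cards1.
Qed.

(** Deletion method. From the random part of [Y] one removes the points of degree above [D], by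
    double counting at most [e / D] times the number of surviving sets of [A], and then one point of
    each surviving set of [B]. *)
Lemma sparse_subset (Y : {set X}) (A B : {set {set X}}) (e D : nat) :
  (0 < D)%N -> {in A, forall E : {set X}, #|E| = e} ->
  {in B, forall S : {set X}, S != set0} ->
  exists W : {set X}, [/\ W \subset Y, {in B, forall S : {set X}, ~~ (S \subset W)},
    forall x, (#|[set E in [set E in A | E \subset W] | x \in E]| <= D)%N &
    #|Y|%:R * rho - e%:R / D%:R * (#|A|%:R * rho ^+ e) -
      \sum_(S in B) rho ^+ #|S| <= #|W|%:R].
Proof.
move=> D_gt0 Ae B0; have DR : 0 < D%:R :> R by rewrite ltr0n.
have [w] := pexp_attained coin_ge0 coin_sum1 (fun w =>
  #|[set x in Y | x \in heads w]|%:R -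
  e%:R / D%:R * #|[set S in A | S \subset heads w]|%:R -
  #|[set S in B | S \subset heads w]|%:R).
rewrite !pexpB pexpZ !pexp_card_subsets pexp_card_heads.
rewrite (eq_bigr (fun=> rho ^+ e)) => [|E /Ae->//]; rewrite sumr_const.
rewrite -[rho ^+ e *+ _]mulr_natl => le_w.
pose A' := [set E in A | E \subset heads w].
pose high := [set x | D < #|[set E in A' | x \in E]|]%N.
have high_le : (#|high| * D <= e * #|A'|)%N.
  apply: (@leq_trans (\sum_x #|[set E in A' | x \in E]|)); last first.
    rewrite (eq_bigr (fun x => (\sum_(E in A') (x \in E))%N)) => [|x _]; last first.
      by rewrite sumn_indicator.
    rewrite exchange_big mulnC -sum_nat_const; apply: leq_sum => E.
    rewrite inE => /andP[/Ae <- _].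
    by rewrite -sum1_card [X in (_ <= X)%N]big_mkcond; apply: leq_sum => x _; case: ifP.
  rewrite -sum_nat_const [X in (_ <= X)%N](bigID (mem high))/=.
  rewrite (leq_trans _ (leq_addr _ _))//; apply: leq_sum => x.
  by rewrite inE => /ltnW.
have [I [IS nI cI]] := hitting_removal ([set x in Y | x \in heads w] :\: high) B0.
exists I; split=> //.
- by rewrite (subset_trans IS)// subDset; apply/subsetP => x; rewrite !inE => /andP[->]; rewrite orbT.
- move=> x; have [xh|xh] := boolP (x \in high); last first.
    rewrite inE -leqNgt in xh; rewrite (leq_trans _ xh)// subset_leq_card//.
    apply/subsetP => E; rewrite !inE => /andP[/andP[-> EI] ->]; rewrite andbT /=.
    apply: subset_trans EI _; apply: subset_trans IS _.
    by apply/subsetP => y; rewrite !inE => /andP[_ /andP[_]].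
  rewrite (_ : [set E in _ | _] = set0) ?cards0//; apply/setP => E.
  rewrite !inE; apply/negP => /andP[/andP[_ /subsetP EI] /EI/(subsetP IS)].
  by rewrite inE xh.
rewrite (le_trans le_w)// lerBlDr.
have c1 : (#|[set x in Y | x \in heads w]| <= #|high| + (#|I| +
    #|[set S in B | S \subset heads w]|))%N.
  rewrite -(cardsID high) leq_add ?subset_leq_card ?subsetIr// (leq_trans cI)//.
  rewrite leq_add2l subset_leq_card//; apply/subsetP => E; rewrite !inE.
  move=> /andP[-> /subsetP EI]; apply/subsetP => x /EI; rewrite !inE.
  by case/andP=> _ /andP[].
have c2 : #|high|%:R <= e%:R / D%:R * #|A'|%:R :> R.
  by rewrite mulrAC ler_pdivlMr// -!natrM ler_nat.
rewrite lerBlDr -natrD; apply: (@le_trans _ _ (#|high|%:R + (#|I| +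
    #|[set S in B | S \subset heads w]|)%:R)); first by rewrite -natrD ler_nat.
by rewrite addrC lerD2l.
Qed.

End RandomSubset.

Section SumSeq.
Variables (R : realFieldType) (T : finType).

(** Sequences are summed with the head innermost, so that the newest copy of a chain is summed first
    while the older ones are fixed. *)
Fixpoint sumseq (k : nat) (F : seq T -> R) : R :=
  if k is j.+1 then sumseq j (fun t => \sum_x F (x :: t)) else F [::].

Lemma le_sumseq k F G : (forall t, size t = k -> F t <= G t) ->
  sumseq k F <= sumseq k G.
Proof.
elim: k F G => [|k IHk] F G FG /=; first exact: FG.
by apply: IHk => t tk; apply: ler_sum => x _; apply: FG; rewrite /= tk.
Qed.

Lemma sumseqZ k c F : sumseq k (fun t => c * F t) = c * sumseq k F.
Proof.
elim: k F => [//|k IHk] F /=; rewrite -IHk.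
by congr (sumseq k _); apply/funext => t; rewrite mulr_sumr.
Qed.

Lemma sumseq_exchange (I : finType) (P : pred I) k (F : I -> seq T -> R) :
  \sum_(i | P i) sumseq k (F i) = sumseq k (fun t => \sum_(i | P i) F i t).
Proof.
elim: k F => [//|k IHk] F /=; rewrite IHk.
by congr (sumseq k _); apply/funext => t; rewrite exchange_big.
Qed.

Lemma sumseq_ge0 k F : (forall t, 0 <= F t) -> 0 <= sumseq k F.
Proof.
elim: k F => [|k IHk] F F0 /=; first exact: F0.
by apply: IHk => t; apply: sumr_ge0.
Qed.

Lemma sumseq_ge k F t : (forall t, 0 <= F t) -> size t = k -> F t <= sumseq k F.
Proof.
elim: k F t => [|k IHk] F [|x t]//= F0 [tk].
apply: le_trans (IHk (fun t => \sum_x F (x :: t)) t _ tk); last first.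
  by move=> t'; apply: sumr_ge0.
by rewrite (bigD1 x)//= lerDl sumr_ge0.
Qed.

End SumSeq.

(** * Chains of copies of a pattern *)

Section Copies.
Variables (U : finType) (Fe : {set {set U}}).
Hypothesis Fe2 : {in Fe, forall f : {set U}, #|f| = 2%N}.

Definition copy n (phi : {ffun U -> 'I_n}) : {set {set 'I_n}} :=
  [set phi @: f | f : {set U} in Fe].

Definition copies n : {set {set {set 'I_n}}} :=
  [set copy phi | phi : {ffun U -> 'I_n} in [set psi : {ffun U -> 'I_n} | injectiveb psi]].

Section Fixed_n.
Variable n : nat.
Implicit Types (phi : {ffun U -> 'I_n}) (t : seq {ffun U -> 'I_n}).
Implicit Types (S : {set {set 'I_n}}).

Definition cunion t : {set {set 'I_n}} := hunion (map (@copy n) t).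

Fixpoint linked_copies t : bool :=
  if t is phi :: t' then
    [&& linked_copies t', injectiveb phi &
        (t' == [::]) || (copy phi :&: cunion t' != set0)]
  else true.

(** The way in which a first short cycle can appear: the newest copy shares at least two edges with
    the earlier ones but also brings new edges. *)
Definition bad_copies t : bool :=
  if t is phi :: t' then
    [&& linked_copies t', injectiveb phi,
        (1 < #|copy phi :&: cunion t'|)%N & ~~ (copy phi \subset cunion t')]
  else false.

Definition bad_unions (g : nat) : {set {set {set 'I_n}}} :=
  [set S | [exists k : 'I_g, exists t : k.+2.-tuple {ffun U -> 'I_n},
              bad_copies t && (cunion t == S)]].

Lemma card_copy phi : injectiveb phi -> #|copy phi| = #|Fe|.
Proof. by move=> /injectiveP inj; rewrite card_imset//; apply: imset_inj. Qed.

Lemma copy_edge phi : injectiveb phi ->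
  {in copy phi, forall x : {set 'I_n}, #|x| = 2%N}.
Proof.
move=> /injectiveP inj x /imsetP[f fF ->].
by rewrite card_imset ?Fe2.
Qed.

Lemma copiesP (E : {set {set 'I_n}}) :
  reflect (exists2 phi : {ffun U -> 'I_n}, injectiveb phi & E = copy phi)
    (E \in copies n).
Proof.
apply: (iffP imsetP) => [[phi]|[phi inj ->]]; first by rewrite inE; exists phi.
by exists phi; rewrite // inE.
Qed.

(** A copy [E] sharing two edges with a chain must lie inside its union, since the union would be
    bad otherwise ([key]). This is impossible for a new copy ([nosub]): let [E1] be the newest copy
    of the chain. Either two edges of [E] lie in the union of the older copies, and one descends;
    or, as [#|Fe| > 2], two of them lie in [E1], so that [E] is contained in [E1] and equals it. *)
Lemma treelike_copies (g : nat) (W : {set {set 'I_n}}) : (2 < #|Fe|)%N -> (1 < g)%N ->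
  {in bad_unions g, forall S : {set {set 'I_n}}, ~~ (S \subset W)} ->
  treelike [set E in copies n | E \subset W] g.
Proof.
move=> e3 g1 noB; set Hy := [set E in copies n | _].
have lift es : linked_chain Hy es ->
    exists2 t, es = map (@copy n) t & linked_copies t /\ cunion t \subset W.
  elim: es => [_|E r IHr /= /and4P[/IHr[t -> [tl tW]] EH _ lk]].
    by exists [::] => //; split=> //; apply/subsetP => x /bigcupP[].
  move: EH; rewrite inE => /andP[/copiesP[phi inj Ep] EW].
  exists (phi :: t); rewrite ?Ep//; split.
    by rewrite /= tl inj -Ep; move: lk; rewrite -size_eq0 size_map size_eq0.
  by rewrite /cunion /= hunion_cons subUset -Ep EW.
have HyE E : E \in Hy -> #|E| = #|Fe|.
  by rewrite inE => /andP[/copiesP[phi inj ->] _]; rewrite card_copy.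
have key E r : linked_chain Hy r -> E \in Hy -> (size r < g)%N ->
    (1 < #|E :&: hunion r|)%N -> E \subset hunion r.
  move=> /lift[t -> [tl tW]] EH sr two; apply: contraT => nsub.
  move: EH; rewrite inE => /andP[/copiesP[phi inj Ep] EW].
  have t0 : t != [::].
    apply: contraTneq two => ->; rewrite /= -leqNgt.
    have -> : hunion [::] = set0 :> {set {set 'I_n}}.
      by apply/setP => x; rewrite inE; apply/bigcupP => -[].
    by rewrite setI0 cards0.
  have k0 : ((size t).-1 < g)%N.
    by rewrite (leq_ltn_trans _ sr)// size_map leq_pred.
  have sz : size (phi :: t) == (Ordinal k0).+2 by rewrite /= prednK// lt0n size_eq0.
  have /noB/negP[] : cunion (phi :: t) \in bad_unions g.
    rewrite inE; apply/existsP; exists (Ordinal k0); apply/existsP; exists (Tuple sz).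
    by rewrite /= tl inj -Ep two nsub eqxx.
  by rewrite /cunion /= hunion_cons subUset -Ep EW.
have nosub E r : linked_chain Hy r -> E \in Hy -> E \notin r -> (size r < g)%N ->
    E \subset hunion r -> False.
  elim: r => [|E1 r IHr]; first move=> _ EH _ _.
    rewrite (_ : hunion [::] = set0); last first.
      by apply/setP => x; rewrite inE; apply/bigcupP => -[].
    rewrite subset0 => /eqP E0; have := HyE _ EH; rewrite E0 cards0 => e0.
    by rewrite -e0 in e3.
  move=> ch EH; rewrite inE negb_or => /andP[EE1 Er] sr.
  have /= /and4P[chr E1H _ _] := ch.
  rewrite hunion_cons => sub.
  have nE1 : ~~ (E \subset E1).
    apply: contraNN EE1 => EE; rewrite eqEcard EE/=.
    by rewrite (HyE _ E1H) (HyE _ EH).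
  have [le1|gt1] := leqP #|E :&: hunion r| 1; last first.
    by apply: IHr => //; [exact: ltnW|apply: key => //; exact: ltnW].
  have c1 : linked_chain Hy [:: E1] by rewrite /= E1H.
  case/negP: nE1; rewrite -(hunion1 E1); apply: key => //; rewrite hunion1.
  have h : (2 < #|(E :&: E1) :|: (E :&: hunion r)|)%N.
    rewrite (leq_trans e3)// -(HyE _ EH) subset_leq_card//.
    by rewrite -setIUr subsetI subxx sub.
  have {h} := leq_trans h (leq_card_setU _ _).1.
  by clear -le1; lia.
move=> E r ch r0 sr; rewrite leqNgt; apply/negP => two.
have /= /and4P[chr EH Er _] := ch.
by apply: (nosub E r) => //; apply: key.
Qed.

End Fixed_n.
End Copies.

(** * Expected numbers of chains and of bad unions *)

Section CopyWeights.
Variables (R : realType) (U : finType) (Fe : {set {set U}}).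
Variables (m T : R).
Hypothesis Fe2 : {in Fe, forall f : {set U}, #|f| = 2%N}.
Hypothesis m_gt0 : 0 < m.
Hypothesis T_ge1 : 1 <= T.

Let v := #|U|.
Let e := #|Fe|.

Definition subpattern (K : {set U} * {set {set U}}) : bool :=
  (K.2 \subset Fe) && [forall f in K.2, f \subset K.1].

(* [n ^ - excess K] is the order of the expected number of ways to extend a
   partial copy [K] of the pattern to a whole copy. *)
Definition excess (K : {set U} * {set {set U}}) : R :=
  (#|K.1|%:R - 2) - (#|K.2|%:R - 1) / m.

Hypothesis e_m : e%:R - 1 = m * (v%:R - 2).
Hypothesis excess_ge0 : forall K, subpattern K -> (2 < #|K.1|)%N -> 0 <= excess K.
Variable delta : R.
Hypothesis excess_ge : forall K, subpattern K -> (2 < #|K.1|)%N -> K.2 != Fe ->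
  delta <= excess K.

Section Fixed_n.
Variable n : nat.
Hypothesis n_gt0 : (0 < n)%N.
Let N : R := n%:R.
(** The density at which the random graph has of order [T * n ^ (2 - 1/m)] edges. *)
Let rho : R := T * N `^ (- m^-1).
Implicit Types (phi : {ffun U -> 'I_n}) (t : seq {ffun U -> 'I_n}).
Implicit Types (S : {set {set 'I_n}}) (K : {set U} * {set {set U}}).

Let N_ge1 : 1 <= N. Proof. by rewrite ler1n. Qed.
Let N_gt0 : 0 < N. Proof. exact: lt_le_trans ltr01 N_ge1. Qed.

Let rho_ge0 : 0 <= rho.
Proof. by rewrite mulr_ge0 ?powR_ge0// (le_trans ler01). Qed.

(** By [e_m] the exponent of [N] on the left is exactly [- excess K]. *)
Lemma extension_weight K c : subpattern K -> c <= excess K ->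
  N ^+ (v - #|K.1|) * rho ^+ (e - #|K.2|) <= T ^+ e * N `^ (- c).
Proof.
case/andP=> KF _ cK.
have vK : (#|K.1| <= v)%N by apply: max_card.
have eK : (#|K.2| <= e)%N by apply: subset_leq_card.
have -> : N ^+ (v - #|K.1|) * rho ^+ (e - #|K.2|) = T ^+ (e - #|K.2|) *
    N `^ ((v - #|K.1|)%:R + - m^-1 * (e - #|K.2|)%:R).
  rewrite exprMn mulrCA powRD; last by rewrite (gt_eqF N_gt0) implybT.
  by rewrite powRrM !powR_mulrn ?powR_ge0 ?ltW.
apply: ler_pM; rewrite ?powR_ge0 ?exprn_ge0 ?(le_trans ler01)//.
  by rewrite ler_weXn2l// leq_subr.
apply: ler_powR => //.
have -> : (v - #|K.1|)%:R + - m^-1 * (e - #|K.2|)%:R = - excess K; last first.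
  by rewrite lerN2.
rewrite /excess !natrB//.
have -> : e%:R = m * (v%:R - 2) + 1 by rewrite -e_m subrK.
by field; rewrite gt_eqF.
Qed.

(** All vertices landing in [cover S] are recorded, not only the ends of shared edges, so that each
    of them has at most [2 * #|S|] possible images. *)
Let profile S phi : {set U} * {set {set U}} :=
  ([set u | phi u \in cover S], [set f in Fe | phi @: f \in S]).

Lemma card_profile S phi : injectiveb phi ->
  #|copy Fe phi :&: S| = #|(profile S phi).2|.
Proof.
move=> /injectiveP inj; rewrite -(card_imset _ (imset_inj inj)).
apply: eq_card => x; rewrite !inE; apply/andP/imsetP.
  by case=> /imsetP[f fF ->] fS; exists f; rewrite // inE fF.
by case=> f; rewrite inE => /andP[fF fS] ->; rewrite imset_f.
Qed.

Lemma profile_subpattern S phi : subpattern (profile S phi).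
Proof.
apply/andP; split=> /=; first by apply/subsetP => f; rewrite inE => /andP[].
apply/forall_inP => f; rewrite inE => /andP[_ fS]; apply/subsetP => u uf.
by rewrite inE; apply/bigcupP; exists (phi @: f) => //; apply: imset_f.
Qed.

Lemma card_profile_fiber S (K1 : {set U}) : S != set0 ->
  {in S, forall x : {set 'I_n}, #|x| = 2%N} ->
  (#|[set phi : {ffun U -> 'I_n} | [set u | phi u \in cover S] == K1]|
    <= (2 * #|S|) ^ v * n ^ (v - #|K1|))%N.
Proof.
move=> S0 S2; pose F u : pred 'I_n := [pred i | (u \in K1) ==> (i \in cover S)].
have cS : (#|cover S| <= 2 * #|S|)%N.
  rewrite (leq_trans (leq_card_cover S).1)//.
  by rewrite mulnC -sum_nat_const; apply: leq_sum => x xS; rewrite S2.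
apply: (@leq_trans #|family F|).
  apply: subset_leq_card; apply/subsetP => phi; rewrite inE => /eqP defK.
  by apply/familyP => u; rewrite inE /= -defK inE implybb.
rewrite card_family foldrE big_map big_enum/= (bigID (mem K1))/=.
apply: leq_mul.
  rewrite (eq_bigr (fun=> #|cover S|)) => [|u uK]; last first.
    by apply: eq_card => i; rewrite inE /= uK.
  rewrite prod_nat_const.
  apply: leq_trans (_ : (2 * #|S|) ^ #|K1| <= _)%N; first by case: #|K1| => // k; rewrite leq_exp2r.
  rewrite leq_pexp2l ?max_card// muln_gt0 card_gt0//.
rewrite (eq_bigr (fun=> n)) => [|u uK].
  rewrite prod_nat_const (_ : #|_| = (v - #|K1|)%N)//.
  by rewrite /v -(cardsC K1) addKn; apply: eq_card => u; rewrite !inE.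
rewrite -[RHS](card_ord n); apply: eq_card => i; rewrite !inE /=.
by rewrite (negPf (uK : u \notin K1)).
Qed.

(** The copies are grouped by profile: there are boundedly many groups, and [extension_weight]
    bounds each of them. *)
Lemma extension_sum S (P : pred {ffun U -> 'I_n}) c : S != set0 ->
  {in S, forall x : {set 'I_n}, #|x| = 2%N} ->
  (forall phi, P phi -> injectiveb phi && (c <= excess (profile S phi))) ->
  \sum_(phi | P phi) rho ^+ #|copy Fe phi :\: S| <=
  #|{: {set U} * {set {set U}}}|%:R * ((2 * #|S|) ^ v)%:R * (T ^+ e * N `^ (- c)).
Proof.
move=> S0 S2 PS; rewrite (partition_big (profile S) xpredT)//=.
rewrite -mulrA mulr_natl -sumr_const; apply: ler_sum => K _.
have [/existsP[phi0 /andP[P0 /eqP pK]]|/existsPn none] :=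
    boolP [exists phi, P phi && (profile S phi == K)]; last first.
  rewrite big_pred0 => [|phi]; last exact/negbTE/none.
  by rewrite mulr_ge0// mulr_ge0 ?powR_ge0// exprn_ge0// (le_trans ler01).
have [_ cK] := andP (PS _ P0); rewrite pK in cK.
have subK : subpattern K by rewrite -pK profile_subpattern.
rewrite (eq_bigr (fun=> rho ^+ (e - #|K.2|))) => [|phi /andP[Pphi /eqP <-]]; last first.
  have [inj _] := andP (PS _ Pphi).
  by rewrite cardsD (card_copy _ inj) (card_profile _ inj).
rewrite sumr_const -[X in X <= _]mulr_natl.
apply: (@le_trans _ _ (((2 * #|S|) ^ v)%:R *
    (N ^+ (v - #|K.1|) * rho ^+ (e - #|K.2|)))); last first.
  by rewrite ler_wpM2l// extension_weight.
rewrite mulrA ler_wpM2r ?exprn_ge0// -natrX -natrM ler_nat.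
apply: leq_trans (card_profile_fiber K.1 S0 S2).
apply: subset_leq_card; apply/subsetP => phi; rewrite unfold_in inE.
by case/andP=> _ /eqP <-.
Qed.

Lemma linked_copies_edges t : linked_copies Fe t ->
  {in cunion Fe t, forall x : {set 'I_n}, #|x| = 2%N} /\
  (#|cunion Fe t| <= e * size t)%N.
Proof.
elim: t => [_|phi t IHt] /=.
  have -> : cunion Fe [::] = set0 :> {set {set 'I_n}}.
    by apply/setP => x; rewrite inE; apply/bigcupP => -[].
  by rewrite cards0; split=> // x; rewrite inE.
case/and3P=> /IHt[e2 sz] inj _; rewrite /cunion /= hunion_cons; split.
  by move=> x; rewrite inE => /orP[/(copy_edge Fe2 inj)|/e2].
rewrite (leq_trans (leq_card_setU _ _).1)// mulnS (card_copy _ inj) leq_add2l.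
exact: sz.
Qed.

Lemma card_cunion_cons phi t :
  #|cunion Fe (phi :: t)| = (#|cunion Fe t| + #|copy Fe phi :\: cunion Fe t|)%N.
Proof.
rewrite [cunion Fe (phi :: t)]hunion_cons -/(cunion Fe t) setUC.
by rewrite cardsU cardsD setIC addnBA// subset_leq_card// subsetIl.
Qed.

Let step (k : nat) : R :=
  #|{: {set U} * {set {set U}}}|%:R * ((2 * (e * k)) ^ v)%:R * T ^+ e.

Hypothesis e_gt2 : (2 < e)%N.

Lemma small_pattern K : subpattern K -> (#|K.1| <= 2)%N -> (#|K.2| <= 1)%N.
Proof.
move=> /andP[KF /forall_inP sub] K1; apply/card_le1_eqP => f f' fK f'K.
have full g : g \in K.2 -> g = K.1.
  move=> gK; apply/eqP; rewrite eqEcard sub//= (leq_trans K1)//.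
  by rewrite Fe2// (subsetP KF).
by rewrite (full f)// (full f').
Qed.

Lemma excess_pattern K : subpattern K -> K.2 != set0 -> 0 <= excess K.
Proof.
move=> subK; have [/(excess_ge0 subK)//|K1 K2] := ltnP 2 #|K.1|.
have [/andP[KF /forall_inP sub] K20] := (subK, K2).
case/set0Pn: K20 => f0 f0K.
have f02 : #|f0| = 2%N by rewrite Fe2// (subsetP KF).
have c2 : #|K.1| = 2%N.
  by apply/eqP; rewrite eqn_leq K1 -f02 subset_leq_card// sub.
have c1 : #|K.2| = 1%N.
  by apply/eqP; rewrite eqn_leq small_pattern//= card_gt0.
by rewrite /excess c2 c1 !subrr mul0r subr0.
Qed.

Lemma step_ge0 k : 0 <= step k.
Proof. by rewrite /step -natrM mulr_ge0// exprn_ge0// (le_trans ler01). Qed.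

Lemma step_bound t (P : pred {ffun U -> 'I_n}) c : linked_copies Fe t ->
  t != [::] ->
  (forall phi, P phi -> injectiveb phi && (c <= excess (profile (cunion Fe t) phi))) ->
  \sum_(phi | P phi) rho ^+ #|copy Fe phi :\: cunion Fe t| <=
    step (size t) * N `^ (- c).
Proof.
move=> lt t0 Pc; have [e2 sz] := linked_copies_edges lt.
have S0 : cunion Fe t != set0.
  case: t t0 lt {Pc e2 sz} => // phi t _ /= /and3P[_ inj _].
  rewrite [cunion _ _]hunion_cons setU_eq0 negb_and -card_gt0.
  by rewrite (card_copy _ inj) (leq_trans _ e_gt2).
apply: le_trans (extension_sum S0 e2 Pc) _.
rewrite mulrA ler_wpM2r ?powR_ge0// /step ler_wpM2r ?exprn_ge0 ?(le_trans ler01)//.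
rewrite ler_wpM2l// ler_nat; case: (v) => // i.
by rewrite leq_exp2r// leq_pmul2l.
Qed.

(** For fixed [T], copies of the pattern are as frequent as edges at this density; this is the
    threshold described by [m]. *)
Lemma scaleE : T ^+ e * N `^ (2 - m^-1) = (n ^ v)%:R * rho ^+ e.
Proof.
rewrite natrX exprMn mulrCA; congr (_ * _).
rewrite -powR_mulrn ?ltW// -powR_mulrn ?powR_ge0// -powRrM -powRD; last first.
  by rewrite (gt_eqF N_gt0) implybT.
congr (_ `^ _); have -> : e%:R = m * (v%:R - 2) + 1 by rewrite -e_m subrK.
by field; rewrite gt_eqF.
Qed.

Lemma copies_weight :
  #|copies Fe n|%:R * rho ^+ e <= T ^+ e * N `^ (2 - m^-1).
Proof.
rewrite scaleE ler_wpM2r ?exprn_ge0// ler_nat.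
by rewrite (leq_trans (leq_imset_card _ _))// (leq_trans (max_card _))// card_ffun card_ord.
Qed.

Let chain_term t : R := (linked_copies Fe t)%:R * rho ^+ #|cunion Fe t|.
Let bad_term t : R := (bad_copies Fe t)%:R * rho ^+ #|cunion Fe t|.

(** Each further copy shares an edge with the chain, so its profile has nonnegative excess and it
    costs only a constant factor. *)
Lemma chains_weight k : sumseq k.+1 chain_term <=
  T ^+ e * N `^ (2 - m^-1) * \prod_(i < k) step i.+1.
Proof.
elim: k => [|k IHk].
  rewrite big_ord0 mulr1 /= scaleE.
  have -> : (n ^ v)%N = #|{: {ffun U -> 'I_n}}| by rewrite card_ffun card_ord.
  rewrite mulr_natl -[X in _ <= X]sumr_const; apply: ler_sum => phi _.
  rewrite /chain_term /=; case: (boolP (injectiveb phi)) => [inj|_]; last first.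
    by rewrite mul0r exprn_ge0.
  by rewrite mul1r /cunion /= hunion1 (card_copy _ inj).
rewrite big_ord_recr/= mulrA [_ * step _]mulrC.
apply: le_trans (ler_wpM2l (step_ge0 k.+1) IHk).
rewrite -sumseqZ; apply: (@le_sumseq _ _ k.+1
  (fun t => \sum_phi chain_term (phi :: t))) => t tk.
rewrite /chain_term; case: (boolP (linked_copies Fe t)) => lt; last first.
  by rewrite /= mul0r mulr0 big1// => phi _; rewrite (negPf lt) mul0r.
pose P phi := injectiveb phi && (copy Fe phi :&: cunion Fe t != set0).
have t0 : t != [::] by case: (t) tk.
have Pc phi : P phi -> injectiveb phi && (0 <= excess (profile (cunion Fe t) phi)).
  case/andP=> inj meet; rewrite inj excess_pattern ?profile_subpattern//.
  by rewrite -card_gt0 -(card_profile _ inj) card_gt0.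
have := step_bound lt t0 Pc; rewrite oppr0 powRr0 mulr1 tk => le_step.
rewrite /= mul1r mulrC; apply: le_trans (ler_wpM2l _ le_step); last by rewrite exprn_ge0.
rewrite mulr_sumr [X in _ <= X]big_mkcond; apply: ler_sum => phi _.
rewrite lt (negPf t0) /= -/(P phi); case: (P phi).
  by rewrite mul1r card_cunion_cons exprD.
by rewrite mul0r.
Qed.

(** The last copy shares at least two edges but not all of them. Its profile then has more than two
    vertices and fewer edges than the pattern, so strict balance saves the factor [N ^ delta]. *)
Lemma bad_weight k : sumseq k.+2 bad_term <=
  T ^+ e * N `^ (2 - m^-1) * \prod_(i < k.+1) step i.+1 * N `^ (- delta).
Proof.
rewrite big_ord_recr/= mulrA -mulrA mulrC.
apply: le_trans (ler_wpM2l (mulr_ge0 (step_ge0 k.+1) (powR_ge0 _ _)) (chains_weight k)).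
rewrite -sumseqZ; apply: (@le_sumseq _ _ k.+1
  (fun t => \sum_phi bad_term (phi :: t))) => t tk.
rewrite /bad_term /chain_term; case: (boolP (linked_copies Fe t)) => lt; last first.
  by rewrite /= mul0r mulr0 big1// => phi _; rewrite (negPf lt) mul0r.
pose P phi := [&& injectiveb phi, (1 < #|copy Fe phi :&: cunion Fe t|)%N &
   ~~ (copy Fe phi \subset cunion Fe t)].
have t0 : t != [::] by case: (t) tk.
have Pc phi : P phi -> injectiveb phi && (delta <= excess (profile (cunion Fe t) phi)).
  case/and3P=> inj two nsub; rewrite inj; have sp := profile_subpattern (cunion Fe t) phi.
  rewrite (card_profile _ inj) in two.
  apply: excess_ge => //; first by rewrite ltnNge; apply: contraTN two => /(small_pattern sp); rewrite -leqNgt.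
  apply: contraNneq nsub => K2; apply/subsetP => x /imsetP[f fF ->].
  have : f \in (profile (cunion Fe t) phi).2 by rewrite K2.
  by rewrite inE => /andP[].
have := step_bound lt t0 Pc; rewrite tk => le_step.
rewrite /= mul1r mulrC; apply: le_trans (ler_wpM2l _ le_step); last by rewrite exprn_ge0.
rewrite mulr_sumr [X in _ <= X]big_mkcond; apply: ler_sum => phi _.
rewrite lt /= -/(P phi); case: (P phi).
  by rewrite mul1r card_cunion_cons exprD.
by rewrite mul0r.
Qed.

Lemma bad_unions_weight g : \sum_(S in bad_unions Fe n g) rho ^+ #|S| <=
  T ^+ e * N `^ (2 - m^-1) * (\sum_(k < g) \prod_(i < k.+1) step i.+1) * N `^ (- delta).
Proof.
have bt0 t : 0 <= bad_term t by rewrite mulr_ge0 ?exprn_ge0.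
rewrite mulr_sumr mulr_suml.
apply: le_trans (ler_sum _ (fun (k : 'I_g) _ => bad_weight k)).
pose F S t : R := (S == cunion Fe t)%:R * bad_term t.
apply: (@le_trans _ _ (\sum_S \sum_(k < g) sumseq k.+2 (F S))); last first.
  rewrite exchange_big; apply: ler_sum => k _; rewrite sumseq_exchange.
  apply: le_sumseq => t _; rewrite (bigD1 (cunion Fe t))//= /F eqxx mul1r.
  by rewrite big1 ?addr0// => S /negPf ->; rewrite mul0r.
rewrite [X in X <= _]big_mkcond; apply: ler_sum => S _.
have F0 t : 0 <= F S t by rewrite mulr_ge0.
have S0 : 0 <= \sum_(k < g) sumseq k.+2 (F S).
  by apply: sumr_ge0 => k _; apply: sumseq_ge0.
case: ifP => //; rewrite inE => /existsP[k /existsP[t /andP[bt /eqP tS]]].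
rewrite (bigD1 k)//= ler_wpDr//.
  by apply: sumr_ge0 => i _; apply: (@sumseq_ge0 _ _ i.+2).
apply: le_trans (@sumseq_ge _ _ k.+2 _ t F0 (size_tuple t)).
by rewrite /F tS eqxx mul1r /bad_term bt mul1r -tS.
Qed.

End Fixed_n.
End CopyWeights.

Lemma finite_positive_bound (R : realFieldType) (I : finType) (P : pred I) (f : I -> R) :
  (forall i, P i -> 0 < f i) -> exists2 d : R, 0 < d & forall i, P i -> d <= f i.
Proof.
move=> f0; exists (\big[Num.min/1]_(i | P i) f i) => [|i Pi]; first exact: lt_bigmin.
exact: bigmin_le_cond.
Qed.

Lemma nat_above (R : realType) (x : R) : exists n : nat, x <= n%:R.
Proof.
exists (Num.bound `|x|); rewrite (le_trans (ler_norm x))// ltW//.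
by rewrite archi_boundP.
Qed.

Lemma powR_large (R : realType) (d C : R) : 0 < d ->
  exists n0 : nat, forall n : nat, (n0 <= n)%N -> C <= n%:R `^ d.
Proof.
move=> d0; have [n0 n0P] := nat_above (Num.max C 0 `^ d^-1).
exists n0 => n n0n; have C0 : 0 <= Num.max C 0 by rewrite le_max lexx orbT.
apply: (@le_trans _ _ (Num.max C 0)); first by rewrite le_max lexx.
have -> : Num.max C 0 = (Num.max C 0 `^ d^-1) `^ d.
  by rewrite -powRrM mulVf ?lt0r_neq0// powRr1.
apply: ge0_ler_powR; rewrite ?nnegrE ?powR_ge0//; first exact: ltW.
by rewrite (le_trans n0P)// ler_nat.
Qed.

Lemma expR_le_1Bx (R : realType) (y : R) : 0 <= y -> y <= 2^-1 ->
  expR (- (2 * y)) <= 1 - y.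
Proof.
move=> y0 y2; rewrite expRN -[X in _ <= X]invrK lef_pV2 ?posrE ?expR_gt0//; last first.
  by rewrite invr_gt0; lra.
apply: le_trans (expR_ge1Dx (2 * y)); rewrite -div1r ler_pdivrMr; nra.
Qed.

(** * Beating the deletion bound by any constant factor *)

Section DenseFreeGraphs.
Variables (R : realType) (U : finType) (Fe : {set {set U}}) (m : R).
Hypothesis Fe2 : {in Fe, forall f : {set U}, #|f| = 2%N}.
Hypothesis m_gt0 : 0 < m.
Hypothesis e_gt2 : (2 < #|Fe|)%N.
Hypothesis e_m : #|Fe|%:R - 1 = m * (#|U|%:R - 2).
Hypothesis balanced : forall K, subpattern Fe K -> (2 < #|K.1|)%N ->
  #|K.2|%:R - 1 <= m * (#|K.1|%:R - 2).
Hypothesis strictly : forall K, subpattern Fe K -> (2 < #|K.1|)%N -> K.2 != Fe ->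
  #|K.2|%:R - 1 < m * (#|K.1|%:R - 2).

Lemma bad_unions_neq0 n g S : S \in bad_unions Fe n g -> S != set0.
Proof.
rewrite inE => /existsP[k /existsP[[t sz] /= /andP[bt /eqP <-]]].
case: t bt {sz} => // phi t /= /and4P[_ inj _ _].
rewrite [cunion _ _]hunion_cons setU_eq0 negb_and -card_gt0 (card_copy _ inj).
by rewrite (leq_trans _ e_gt2).
Qed.

Lemma card_pairs_ge n : (1 < n)%N ->
  n%:R ^+ 2 / 4 <= #|[set x : {set 'I_n} | #|x| == 2%N]|%:R :> R.
Proof.
move=> n2; rewrite card_draws card_ord ler_pdivrMr// -natrX -natrM ler_nat.
have := bin2 n; have := odd_double_half (n * n.-1).
by rewrite oddM; case: n n2 => [|[|n]]//= _; rewrite -mul2n -?bin2; nia.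
Qed.

Lemma dense_free_graph (B : R) : exists n : nat, (0 < n)%N /\
  exists W : {set {set 'I_n}}, [/\ {in W, forall x : {set 'I_n}, #|x| = 2%N},
    forall phi : {ffun U -> 'I_n}, injectiveb phi -> ~~ (copy Fe phi \subset W) &
    B * n%:R `^ (2 - m^-1) < #|W|%:R].
Proof.
have [d d0 dP] : exists2 d : R, 0 < d & forall K,
    [&& subpattern Fe K, (2 < #|K.1|)%N & K.2 != Fe] -> d <= excess m K.
  apply: finite_positive_bound => K /and3P[sK K1 K2].
  by rewrite subr_gt0 ltr_pdivrMr// mulrC strictly.
have [e eE] : exists k : nat, k = #|Fe| by eexists.
have e2 : (2 < e)%N by rewrite eE.
(* The final independent set has at least [B' / 32] times [n ^ (2 - 1/m)] elements; 33 makes the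
   inequality strict. *)
have [B' B'1 B'B] : exists2 x : R, 1 <= x & 33 * B <= x.
  by exists (Num.max (33 * B) 1); rewrite le_max lexx ?orbT.
(* This is the value of [D * kappa ^+ e.-1], which does not depend on [T]. Hence
   [(1 - kappa ^+ e.-1) ^+ D] stays above [exp (- 2 c)], while [kappa = B' / T] becomes small with
   large [T]. *)
have [c cE] : exists c : R, c = 16 * e%:R * B' ^+ e.-1 by eexists.
have [T TP] := nat_above (2 * B' * expR (2 * c)).
have c0 : 0 <= c by rewrite cE !mulr_ge0// exprn_ge0// (le_trans ler01).
have exp1 : 1 <= expR (2 * c) by apply: le_trans (expR_ge1Dx _); rewrite lerDl mulr_ge0.
have T2 : 2 * B' <= T%:R.
  by rewrite (le_trans _ TP)// ler_peMr// mulr_ge0// (le_trans ler01).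
have T1 : 1 <= T%:R :> R by lra.
have T0 : 0 < T%:R :> R by lra.
(* With this degree bound, removing edges in too many copies costs at most [T / 16 * Q], a quarter
   of the expected number of edges. *)
pose D := (16 * e * T ^ e.-1)%N.
have [kappa kE] : exists x : R, x = B' / T%:R by eexists.
have k0 : 0 < kappa by rewrite kE divr_gt0//; lra.
have khalf : kappa <= 2^-1 by rewrite kE ler_pdivrMr//; lra.
have kp : kappa ^+ e.-1 <= 2^-1.
  apply: le_trans (khalf); rewrite -[X in _ <= X]expr1.
  have k1 : kappa <= 1 by lra.
  apply: ler_wiXn2l k1 _ _ _; first exact: ltW.
  by case: (e) e2 => [|[|i]].
have kD : kappa <= (1 - kappa ^+ e.-1) ^+ D.
  have ybnd : expR (- (2 * kappa ^+ e.-1)) <= 1 - kappa ^+ e.-1.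
    by apply: expR_le_1Bx; rewrite // exprn_ge0// ltW.
  apply: (@le_trans _ _ (expR (- (2 * kappa ^+ e.-1)) ^+ D)); last first.
    by rewrite lerXn2r ?nnegrE ?expR_ge0//; lra.
  have -> : expR (- (2 * kappa ^+ e.-1)) ^+ D = (expR (2 * c))^-1.
    rewrite -expRM_natl mulrN expRN; congr (expR _)^-1.
    rewrite cE /D kE expr_div_n !natrM natrX; field.
    by rewrite expf_neq0// gt_eqF.
  rewrite -[X in _ <= X]div1r ler_pdivlMr ?expR_gt0// kE mulrAC ler_pdivrMr// mul1r.
  by apply: le_trans TP; rewrite ler_wpM2r ?expR_ge0//; lra.
have D0 : (0 < D)%N.
  have T0' : (0 < T)%N by rewrite -(ltr0n R).
  by rewrite !muln_gt0 expn_gt0 T0' (leq_trans _ e2).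
(* The ties then cost at most [kappa / 4] per edge of [W], half of the main term [kappa / 2]. *)
have [M0 MP] := nat_above (4 * D%:R * e%:R ^+ 2 / kappa).
pose M := M0.+1.
have {MP} MP : 4 * D%:R * e%:R ^+ 2 <= kappa * M%:R.
  by rewrite [X in _ <= X]mulrC -ler_pdivrMr// (le_trans MP)// ler_nat.
pose g := M.*2.+1.
have M0' : 0 < M%:R :> R by rewrite ltr0n.
pose stp (k : nat) : R :=
  #|{: {set U} * {set {set U}}}|%:R * ((2 * (e * k)) ^ #|U|)%:R * T%:R ^+ e.
have [Cs CsE] : exists x : R, x = \sum_(k < g) \prod_(i < k.+1) stp i.+1 by eexists.
(* Beyond [n1] the bad unions weigh at most [T / 16 * Q]; beyond [n2] the density [rho] is at most
   1. *)
have [n1 n1P] := powR_large (16 * T%:R ^+ e.-1 * Cs) d0.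
have m'0 : 0 < m^-1 by rewrite invr_gt0.
have [n2 n2P] := powR_large T%:R m'0.
have [n [n1n n2n n_gt1]] : exists n, [/\ (n1 <= n)%N, (n2 <= n)%N & (1 < n)%N].
  exists (n1 + n2 + 2)%N; split; [|by rewrite addnAC leq_addl|by rewrite addn2].
  by rewrite -addnA leq_addr.
have n_gt0 : (0 < n)%N := ltnW n_gt1.
have N0 : 0 < n%:R :> R by rewrite ltr0n.
exists n; split=> //.
have [Q QE] : exists x : R, x = n%:R `^ (2 - m^-1) by eexists.
have Q0 : 0 < Q by rewrite QE powR_gt0.
have [rho rE] : exists x : R, x = T%:R * n%:R `^ (- m^-1) by eexists.
have r0 : 0 <= rho by rewrite rE mulr_ge0 ?powR_ge0.
have r1 : rho <= 1.
  rewrite rE powRN ler_pdivrMr ?powR_gt0// mul1r; exact: n2P.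
have A2 : {in copies Fe n, forall E : {set {set 'I_n}}, #|E| = e}.
  by move=> E /copiesP[phi inj ->]; rewrite (card_copy _ inj) eE.
have B0 : {in bad_unions Fe n g, forall S : {set {set 'I_n}}, S != set0}.
  by move=> S /bad_unions_neq0.
pose Y := [set x : {set 'I_n} | #|x| == 2%N].
have [W [WY noB degW cW]] := sparse_subset r0 r1 Y D0 A2 B0.
have W2 : {in W, forall x : {set 'I_n}, #|x| = 2%N}.
  by move=> x /(subsetP WY); rewrite inE => /eqP.
have eb K : subpattern Fe K -> (2 < #|K.1|)%N -> 0 <= excess m K.
  by move=> sK K1; rewrite subr_ge0 ler_pdivrMr// mulrC balanced.
have ed K : subpattern Fe K -> (2 < #|K.1|)%N -> K.2 != Fe -> d <= excess m K.
  by move=> sK K1 K2; apply: dP; rewrite sK K1 K2.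
have h1 : n%:R ^+ 2 / 4 * rho <= #|Y|%:R * rho by rewrite ler_wpM2r// card_pairs_ge.
have h1' : n%:R ^+ 2 / 4 * rho = T%:R / 4 * Q.
  rewrite rE QE powRD ?(gt_eqF N0) ?implybT// -powR_mulrn ?ltW//; ring.
have h2 : e%:R / D%:R * (#|copies Fe n|%:R * rho ^+ e) <= T%:R / 16 * Q.
  have := copies_weight m_gt0 T1 e_m n_gt0.
  rewrite -eE -QE -rE => hw; apply: le_trans (ler_wpM2l _ hw) _.
    by rewrite divr_ge0.
  rewrite /D le_eqVlt; apply/orP; left; apply/eqP.
  rewrite -(prednK (ltnW (ltnW e2))) exprS /= !natrM natrX; field.
  by apply/andP; split; [rewrite expf_neq0 ?gt_eqF|rewrite addrC natr1 pnatr_eq0].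
have h3 : \sum_(S in bad_unions Fe n g) rho ^+ #|S| <= T%:R / 16 * Q.
  have := bad_unions_weight Fe2 m_gt0 T1 e_m eb ed n_gt0 e_gt2 g.
  rewrite -eE -QE -rE -CsE => hw; apply: le_trans hw _.
  rewrite powRN ler_pdivrMr ?powR_gt0//.
  apply: le_trans (ler_wpM2l _ (n1P _ n1n)); last first.
    by rewrite mulr_ge0 ?divr_ge0// ltW.
  rewrite le_eqVlt; apply/orP; left; apply/eqP.
  by rewrite -{1}(prednK (ltnW (ltnW e2))) exprS; field.
have cW' : T%:R / 8 * Q <= #|W|%:R by lra.
pose Hy := [set E in copies Fe n | E \subset W].
have g1 : (1 < g)%N by rewrite /g /M doubleS.
have tree : treelike Hy g by exact: (treelike_copies e_gt2 g1 noB).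
have gM : (M.*2 < g)%N by [].
have r_gt1 : (1 < e)%N := ltnW e2.
have unif : {in Hy, forall E : {set {set 'I_n}}, #|E| = e}.
  by move=> E; rewrite inE => /andP[/A2].
have k1 : kappa < 1 by lra.
have HyW : {in Hy, forall E : {set {set 'I_n}}, E \subset W}.
  by move=> E; rewrite inE => /andP[].
have [I [IW nI cI]] :=
  greedy_independent_set r_gt1 (ltn0Sn M0) unif degW gM tree k0 k1 kD HyW.
exists I; split.
- by move=> x /(subsetP IW)/W2.
- move=> phi inj; apply/negP => sub.
  have /nI/negP[] // : copy Fe phi \in Hy.
  rewrite inE (subset_trans sub IW) andbT; apply/copiesP; by exists phi.
have HyD : (#|Hy| <= #|W| * D)%N.
  apply: (@leq_trans (\sum_(x in W) #|[set E in Hy | x \in E]|)); last first.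
    by rewrite -sum_nat_const; apply: leq_sum => x _; apply: degW.
  rewrite (eq_bigr (fun x => (\sum_(E in Hy) (x \in E))%N)) => [|x _]; last first.
    by rewrite sumn_indicator.
  rewrite exchange_big -sum1_card; apply: leq_sum => E EH.
  rewrite sumn_indicator card_gt0.
  have /set0Pn[x xE] : E != set0 by rewrite -card_gt0 unif// (ltn_trans _ e2).
  by apply/set0Pn; exists x; rewrite inE xE (subsetP (HyW _ EH)).
have h4 : #|Hy|%:R * (e%:R ^+ 2 / M%:R) <= #|W|%:R * (kappa / 4).
  apply: (@le_trans _ _ ((#|W| * D)%:R * (e%:R ^+ 2 / M%:R))).
    by rewrite ler_wpM2r ?divr_ge0 ?exprn_ge0// ler_nat.
  rewrite natrM -mulrA ler_wpM2l// mulrA ler_pdivrMr//; lra.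
have h5 : #|W|%:R * (kappa / 2) <= #|W|%:R * (kappa * (1 - kappa ^+ e.-1)).
  by rewrite ler_wpM2l// (ler_wpM2l (ltW k0))//; lra.
rewrite -QE.
have h6 : T%:R / 8 * Q * (kappa / 4) <= #|W|%:R * (kappa / 4).
  by rewrite ler_wpM2r// divr_ge0// ltW.
have h7 : T%:R / 8 * Q * (kappa / 4) = B' / 32 * Q by rewrite kE; field; rewrite gt_eqF.
have h8 : B * Q < B' / 32 * Q by rewrite ltr_pM2r//; lra.
apply: lt_le_trans cI; apply: lt_le_trans (lerB h5 h4); rewrite -mulrBr.
have -> : kappa / 2 - kappa / 4 = kappa / 4 by field.
by apply: lt_le_trans h6; rewrite h7.
Qed.

End DenseFreeGraphs.

(** * From [m2] to a lower bound on [ex] *)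

Section TuranLowerBound.
Variables (R : realType) (V : finType) (H : sgraph V).
Implicit Types (F K : {set V} * {set {set V}}).

Let density F : R := (#|F.2|%:R - 1) / (#|F.1|%:R - 2).

Lemma card_edge (W : finType) (G : sgraph W) :
  {in edges G, forall e : {set W}, #|e| = 2%N}.
Proof. by move=> e eG; apply/eqP/(forall_inP (edgesP G)). Qed.

Lemma le_m2 F : subgraph_of H F -> (2 < #|F.1|)%N -> density F <= m2 R H.
Proof.
move=> sF F1; apply: (le_bigmax_cond _ (fun F => density F)).
by rewrite sF F1.
Qed.

Lemma next2_neq (T : eqType) (s : seq T) x : (2 < size s)%N -> uniq s -> x \in s ->
  next s (next s x) != x.
Proof.
move=> s2 us xs; have [i s' def] := rot_to xs.
rewrite -!(next_rot i us) def; have := us; rewrite -(rot_uniq i) def.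
have : (2 < size (x :: s'))%N by rewrite -def size_rot.
case: s' {def} => [|y [|z t]]//= _ /andP[]; rewrite !inE !negb_or eqxx.
move=> /and3P[/negPf xy xz _] _.
by rewrite [y == x]eq_sym xy eqxx eq_sym.
Qed.

(** A cycle with [s] vertices has [s] edges, and [(s - 1) / (s - 2) > 1]. *)
Lemma m2_gt1 : has_cycle H -> 1 < m2 R H.
Proof.
case=> s [s2 /andP[cyc us]].
pose F := ([set x in s], [set [set x; next s x] | x in s]) : {set V} * {set {set V}}.
have c1 : #|F.1| = size s by rewrite cardsE; apply/card_uniqP.
have c2 : #|F.2| = size s.
  rewrite card_in_imset; first exact/card_uniqP.
  move=> x y xs ys exy; apply/eqP; apply: contraT => xy.
  have nx : x \in [set y; next s y] by rewrite -exy set21.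
  have ny : y \in [set x; next s x] by rewrite exy set21.
  move: nx ny; rewrite !inE [y == x]eq_sym (negPf xy) /= => /eqP xn /eqP yn.
  by have := next2_neq s2 us xs; rewrite -yn -xn eqxx.
have sF : subgraph_of H F.
  apply/andP; split.
    by apply/subsetP => _ /imsetP[x xs ->]; have := next_cycle cyc xs.
  apply/forall_inP => _ /imsetP[x xs ->]; rewrite subUset !sub1set !inE.
  by rewrite mem_next xs.
rewrite (lt_le_trans _ (le_m2 sF _)) ?c1// /density c1 c2.
have s2R : 2 < (size s)%:R :> R by rewrite ltr_nat.
by rewrite ltr_pdivlMr ?mul1r; lra.
Qed.

Hypothesis cycH : has_cycle H.

(** Among the subgraphs attaining [m2], one with the fewest edges is strictly balanced. *)
Lemma m2_core : exists F, [/\ subgraph_of H F, (2 < #|F.1|)%N, density F = m2 R H &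
  forall K, subgraph_of H K -> (2 < #|K.1|)%N -> (#|K.2| < #|F.2|)%N ->
  density K < m2 R H].
Proof.
pose P F := [&& subgraph_of H F, (2 < #|F.1|)%N & density F == m2 R H].
(* The maximum is attained by a subgraph and not by the default value 0, since [m2] exceeds 1. *)
have [F0 PF0] : exists F, P F.
  apply/existsP; apply: contraT => /existsPn none.
  have : m2 R H < m2 R H; last by rewrite ltxx.
  rewrite {1}/m2; apply: bigmax_lt => [|F /andP[sF F1]].
    by rewrite (lt_trans _ (m2_gt1 cycH)).
  rewrite lt_neqAle le_m2// andbT.
  by have := none F; rewrite /P sF F1.
case: (arg_minnP (fun F => #|F.2|) PF0) => F /and3P[sF F1 /eqP dF] minF.
exists F; split=> // K sK K1 KF; rewrite lt_neqAle le_m2// andbT.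
apply: contraTN KF => dK; rewrite -leqNgt; apply: minF.
by rewrite /P sK K1 dK.
Qed.

(** A graph without the core of [H] has no copy of [H] either. The vertices of the core are turned
    into a type, so that the core becomes a pattern on all of [U]. *)
Lemma ex_lower_bound (B : R) : exists2 n : nat, (0 < n)%N &
  B * n%:R `^ (2 - (m2 R H)^-1) < (ex n H)%:R.
Proof.
have [F [sF F1 dF minF]] := m2_core.
set m := m2 R H in dF minF *; have m1 : 1 < m by apply: m2_gt1.
have [/subsetP F2H /forall_inP FF] := andP sF.
pose U := {x : V | x \in F.1}.
pose up (g : {set U}) : {set V} := val @: g.
pose Fe : {set {set U}} := [set g | up g \in F.2].
have up_inj : injective up by apply: imset_inj; apply: val_inj.
have cU : #|{: U}| = #|F.1| by rewrite card_sig.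
have upFe : up @: Fe = F.2.
  apply/setP => f; apply/imsetP/idP => [[g]|fF]; first by rewrite inE => gF ->.
  have : up [set x : U | val x \in f] = f.
    apply/setP => x; apply/imsetP/idP => [[y]|xf]; first by rewrite inE => yf ->.
    have xF : x \in F.1 by apply: subsetP xf; apply: FF.
    by exists (exist _ x xF); rewrite ?inE.
  by move=> e; exists [set x : U | val x \in f]; rewrite // inE e.
have cFe : #|Fe| = #|F.2| by rewrite -upFe card_imset.
have F1R : 2 < #|F.1|%:R :> R by rewrite ltr_nat.
have m0 : 0 < m by lra.
have dE : #|F.2|%:R - 1 = m * (#|F.1|%:R - 2).
  by rewrite -dF divfK// gt_eqF//; lra.
have Fe2 : {in Fe, forall f : {set U}, #|f| = 2%N}.
  move=> f; rewrite inE => /F2H/card_edge <-.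
  by rewrite card_imset//; apply: val_inj.
(* Since [m > 1], the number of edges minus 1 exceeds the number of vertices minus 2, which is at
   least 1. *)
have e_gt2 : (2 < #|Fe|)%N.
  have F1R3 : 3 <= #|F.1|%:R :> R by rewrite ler_nat.
  rewrite cFe -(ltr_nat R) -ltrBrDr // -(ltrD2r (- 1)) dE.
  have : 0 < (m - 1) * (#|F.1|%:R - 2) by rewrite mulr_gt0// subr_gt0.
  by rewrite mulrBl mul1r; lra.
pose lift (K : {set U} * {set {set U}}) := (up K.1, up @: K.2).
have liftP (K : {set U} * {set {set U}}) : subpattern Fe K -> [/\ subgraph_of H (lift K),
    #|(lift K).1| = #|K.1| & #|(lift K).2| = #|K.2|].
  case/andP=> /subsetP KF /forall_inP sub; split.
  - apply/andP; split; first by apply/subsetP => _ /imsetP[f /KF fF ->];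
      apply: F2H; rewrite inE in fF.
    by apply/forall_inP => _ /imsetP[f fK ->]; apply: imsetS; apply: sub.
  - by rewrite card_imset//; apply: val_inj.
  - by rewrite card_imset.
have [//| | |n [n0 [W [W2 freeW cW]]]] := @dense_free_graph R U Fe m Fe2 m0 e_gt2 _ _ _ B.
- by rewrite cFe cU.
- move=> K /liftP[sK K1 K2] K1gt; have := le_m2 sK; rewrite /density K1 K2.
  have K1R : 2 < #|K.1|%:R :> R by rewrite ltr_nat.
  move=> /(_ K1gt); rewrite ler_pdivrMr//; lra.
- move=> K sK K1gt KF; have [sK' K1 K2] := liftP K sK.
  have K1R : 2 < #|K.1|%:R :> R by rewrite ltr_nat.
  have := minF _ sK'; rewrite /density K1 K2 => /(_ K1gt).
  rewrite ltr_pdivrMr; last lra; apply.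
  rewrite -cFe; apply: proper_card; rewrite properEneq KF.
  by have [] := andP sK.
have GW : [forall e in W, #|e| == 2%N] by apply/forall_inP => e /W2 ->.
exists n => //; apply: lt_le_trans cW _; rewrite ler_nat.
have free : SGraph GW \in free_graphs H n.
  rewrite inE; apply/negP => /existsP[f /andP[/injectiveP inj /forall_inP sub]].
  pose phi := [ffun u : U => f (val u)].
  have /negP[] : ~~ (copy Fe phi \subset W).
    by apply: freeW; apply/injectiveP => x y; rewrite !ffunE => /inj/val_inj.
  apply/subsetP => _ /imsetP[g gF ->]; rewrite inE in gF.
  have -> : phi @: g = f @: up g; last exact: sub (F2H _ gF).
  by rewrite /up -imset_comp; apply: eq_imset => u; rewrite /= ffunE.
exact: (@leq_bigmax_cond _ (mem (free_graphs H n)) (fun G => #|edges G|) _ free).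
Qed.

(* In other words [lambda alpha H > 1] when [alpha < 2]. *)
Lemma exponent_gt (A alpha : R) : 0 < A ->
  (forall n : nat, (ex n H)%:R <= A * n%:R `^ alpha) ->
  2 - (m2 R H)^-1 < alpha.
Proof.
move=> A0 Hex; rewrite ltNge; apply/negP => le_a.
have [n n0] := ex_lower_bound A; apply/negP; rewrite -leNgt.
apply: le_trans (Hex n) _; rewrite (ler_wpM2l (ltW A0))//.
by apply: ler_powR; rewrite // ler1n.
Qed.

End TuranLowerBound.

(** * Hypergraph containers *)

Section Containers.
Variable R : realFieldType.

Definition wdeg (X : finType) (w : {set X} -> R) (S : {set X}) : R :=
  \sum_(A : {set X} | S \subset A) w A.

Definition wfree (X : finType) (w : {set X} -> R) (I : {set X}) : Prop :=
  forall A : {set X}, A \subset I -> w A = 0.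

(* [F I] is a pair (fingerprint of [I], vertices of [Y] certified to lie
   outside [I]); the second component is determined by the first. *)
Definition container_system (X : finType) (free : {set X} -> Prop) (Y : {set X})
    (s : nat) (c : R) (F : {set X} -> {set X} * {set X}) : Prop :=
  (forall I, free I -> [/\ (F I).1 \subset I, (#|(F I).1| <= s)%N,
     (F I).2 \subset Y, [disjoint (F I).2 & I] & c <= #|(F I).2|%:R]) /\
  (forall I I', free I -> free I' -> (F I).1 \subset I' -> (F I').1 \subset I ->
     (F I).2 = (F I').2).

Definition uniform_weight (X : finType) (Y : {set X}) (t : nat) (w : {set X} -> R) :=
  (forall A, 0 <= w A) /\
  (forall A, w A != 0 -> #|A| = t /\ A \subset Y).

(** The codegree condition of container theorems: vertex degrees are at most [K] times [E / #|Y|],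
    and each further vertex of [S] lowers the bound by a factor [p]. *)
Definition spread_weight (X : finType) (Y : {set X}) (K p E : R) (w : {set X} -> R) :=
  E <= \sum_A w A /\
  (forall S : {set X}, S != set0 -> wdeg w S <= K * p ^+ #|S|.-1 * E / #|Y|%:R).

Lemma sum_wdeg1 (X : finType) (w : {set X} -> R) :
  \sum_v wdeg w [set v] = \sum_A w A * #|A|%:R.
Proof.
rewrite (exchange_big_dep xpredT)//=; apply: eq_bigr => A _.
rewrite mulr_natr -sumr_const.
by apply: eq_bigl => v; rewrite sub1set.
Qed.

Lemma sum_wdeg (X : finType) (w : {set X} -> R) (Q : pred {set X}) :
  (forall A, 0 <= w A) ->
  \sum_(S | Q S) wdeg w S <= \sum_A w A * (2 ^ #|A|)%:R.
Proof.
move=> w0; rewrite (exchange_big_dep xpredT)//=; apply: ler_sum => A _.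
rewrite sumr_const -[X in X <= _]mulr_natr ler_wpM2l// ler_nat -card_powerset.
by apply: subset_leq_card; apply/subsetP => S; rewrite powersetE => /andP[].
Qed.

(** For two sets each of which contains the first heavy vertex of the other: these two vertices then
    coincide. *)
Lemma ohead_filter_eq (T : eqType) (s : seq T) (P Q : pred T) x y :
  ohead (filter P s) = Some x -> ohead (filter Q s) = Some y -> Q x -> P y -> x = y.
Proof.
elim: s => //= z s IHs; case: ifP => Pz; case: ifP => Qz /=.
- by move=> [<-] [<-].
- by move=> [<-] _; rewrite Qz.
- by move=> _ [<-] _; rewrite Pz.
- exact: IHs.
Qed.

Section Step.
Variables (X : finType) (Y : {set X}) (t L : nat) (K K' p E : R).
Variable w : {set X} -> R.
Let N : R := #|Y|%:R.

Hypothesis K_gt0 : 0 < K.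
Hypothesis K'K : 8 * K <= K'.
Hypothesis K'K2 : (2 ^ (t + 6))%:R * K ^+ 2 <= K'.
Hypothesis p_gt0 : 0 < p.
Hypothesis E_gt0 : 0 < E.
Hypothesis N_gt0 : 0 < N.
Hypothesis L_le : L%:R <= 2 * (p * N).
Hypothesis w_unif : uniform_weight Y t.+2 w.
Hypothesis w_spread : spread_weight Y K p E w.

Let E' := p * E / 4.
Let d := E / (4 * N).
Let K'_gt0 : 0 < K'. Proof. by apply: lt_le_trans K'K; rewrite mulr_gt0. Qed.
Let w0 A : 0 <= w A. Proof. exact: w_unif.1. Qed.

Let thr (S : {set X}) : R := K' * p ^+ #|S|.-1 * E' / N.

(** Saturation starts at half the threshold because a single link adds at most the other half; no
    set ever exceeds [thr]. *)
Definition saturated (b : {set X} -> R) (S : {set X}) : bool :=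
  (S != set0) && (thr S / 2 <= wdeg b S).

Definition unsat (b : {set X} -> R) (B : {set X}) : bool :=
  [forall S : {set X}, (S \subset B) ==> ~~ saturated b S].

Definition link (b : {set X} -> R) (v : X) (B : {set X}) : R :=
  if (v \notin B) && unsat b B then w (v |: B) else 0.

Definition link_deg (b : {set X} -> R) (v : X) : R := \sum_B link b v B.

(** [b] is the sum of the links of the [i] fingerprint vertices chosen so far. The upper bound on
    its total limits the saturated sets; the lower bound makes it heavy enough after [L] rounds. *)
Let invariant (i : nat) (b : {set X} -> R) : Prop :=
  [/\ uniform_weight Y t.+1 b,
      forall S : {set X}, S != set0 -> wdeg b S <= thr S,
      \sum_B b B <= i%:R * (K * E / N) & d * i%:R <= \sum_B b B].

Let link_ge0 b v B : 0 <= link b v B.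
Proof. by rewrite /link; case: ifP. Qed.

Lemma wdeg_link b v (S : {set X}) : v \notin S ->
  wdeg (link b v) S <= wdeg w (v |: S).
Proof.
move=> vS; pose P := [set B : {set X} | (S \subset B) && (v \notin B)].
apply: (@le_trans _ _ (\sum_(B in P) w (v |: B))).
  rewrite /wdeg [X in _ <= X]big_mkcond [X in X <= _]big_mkcond; apply: ler_sum => B _.
  rewrite inE /link; case: ifP => // SB; case: (v \notin B) => //=.
  by case: ifP.
rewrite -(@big_imset _ _ _ _ _ (fun B => v |: B) (mem P) w)/=; last first.
  move=> B B'; rewrite !inE => /andP[_ vB] /andP[_ vB'] eB.
  by rewrite -(setU1K vB) eB setU1K.
rewrite /wdeg [X in _ <= X]big_mkcond [X in X <= _]big_mkcond; apply: ler_sum => A _.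
case: ifP => [/imsetP[B]|_]; last by case: ifP.
by rewrite inE => /andP[SB _] ->; rewrite setUS.
Qed.

Lemma link_deg_le b v : link_deg b v <= K * E / N.
Proof.
have -> : link_deg b v = wdeg (link b v) set0.
  by apply: eq_bigl => B; rewrite sub0set.
apply: le_trans (wdeg_link _ _) _; first by rewrite inE.
rewrite setU0; have := w_spread.2 [set v].
by rewrite cards1 expr0 mulr1; apply; rewrite -card_gt0 cards1.
Qed.

Lemma invariant_step b v i : d <= link_deg b v -> invariant i b ->
  invariant i.+1 (fun B => b B + link b v B).
Proof.
move=> dv [[b0 bU] bthr bup blow].
have sumD : \sum_B (b B + link b v B) = \sum_B b B + link_deg b v by rewrite big_split.
split.
- split=> [A|A]; first by rewrite addr_ge0.
  have [bA0|/bU//] := eqVneq (b A) 0; rewrite bA0 add0r /link.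
  case: ifP => [/andP[vA _] /w_unif.2[cA AY]|]; last by rewrite eqxx.
  split; first by move: cA; rewrite cardsU1 vA => -[].
  by apply: subset_trans AY; apply: subsetUr.
- move=> S S0; have -> : wdeg (fun B => b B + link b v B) S =
    wdeg b S + wdeg (link b v) S by rewrite /wdeg big_split.
  have [satS|nsat] := boolP (saturated b S).
    rewrite [wdeg (link b v) S]big1 ?addr0 ?bthr// => B SB.
    rewrite /link; case: ifP => // /andP[_ /forallP/(_ S)].
    by rewrite SB satS.
  have half : wdeg b S <= thr S / 2.
    by move: nsat; rewrite /saturated S0 /= -ltNge => /ltW.
  have [vS|vS] := boolP (v \in S).
    rewrite [wdeg (link b v) S]big1 ?addr0 ?bthr// => B /subsetP/(_ v vS) vB.
    by rewrite /link vB.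
  rewrite [thr S]splitr lerD// (le_trans (wdeg_link b vS))//.
  have vS0 : v |: S != set0 by apply/set0Pn; exists v; rewrite setU11.
  apply: le_trans (w_spread.2 _ vS0) _.
  rewrite cardsU1 vS add1n /= /thr /E' -/N.
  have -> : K' * p ^+ #|S|.-1 * (p * E / 4) / N / 2 = K' / 8 * p ^+ #|S| * E / N.
    have cS : (0 < #|S|)%N by rewrite card_gt0.
    rewrite -{2}(prednK cS) exprS; field; exact: lt0r_neq0.
  rewrite ler_pM2r ?invr_gt0// ler_pM2r// ler_pM2r ?exprn_gt0//.
  by rewrite ler_pdivlMr// mulrC.
- rewrite sumD -natr1 mulrDl mul1r lerD//; exact: link_deg_le.
- by rewrite sumD -natr1 mulrDr mulr1 lerD.
Qed.

(** Only hyperedges containing a saturated set are lost. Such a set has large degree in [b], the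
    total of [b] is at most [L * K * E / N], and each hyperedge of [b] has [2 ^ t.+1] subsets;
    [K'K2] is what makes the loss at most [E / 2]. *)
Lemma sum_link_deg_ge b i : (i <= L)%N -> invariant i b ->
  E / 2 <= \sum_v link_deg b v.
Proof.
move=> iL [[b0 bU] bthr bup blow].
have le1 : \sum_(A : {set X} | unsat b A) w A <= \sum_v link_deg b v.
  rewrite (eq_bigr (fun v => \sum_(A : {set X} | (v \in A) && unsat b (A :\ v)) w A)).
    rewrite (exchange_big_dep xpredT)//= big_mkcond; apply: ler_sum => A _.
    have s0 : 0 <= \sum_(v | (v \in A) && unsat b (A :\ v)) w A by apply: sumr_ge0.
    case: ifP => // uA; have [wA|wA] := eqVneq (w A) 0; first by rewrite {1}wA.
    have [cA _] := w_unif.2 _ wA.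
    have /set0Pn[v vA] : A != set0 by rewrite -card_gt0 cA.
    rewrite (bigD1 v)//= ?lerDl ?sumr_ge0// vA; apply/forall_inP => S SA.
    exact: (implyP (forallP uA S) (subset_trans SA (subsetDl _ _))).
  move=> v _; rewrite /link_deg [LHS](bigID (fun B : {set X} => (v \notin B) && unsat b B))/=.
  rewrite [X in _ + X]big1 ?addr0 => [|B /negPf]; last by rewrite /link => ->.
  rewrite (reindex_onto (fun A : {set X} => A :\ v) (fun B => v |: B))/=.
    rewrite [LHS]big_mkcond [RHS]big_mkcond; apply: eq_bigr => A _.
    rewrite !inE eqxx /=; have [vA|vA] := boolP (v \in A); last first.
      rewrite andbC; case: eqP => //= eA.
      by rewrite -eA setU11 in vA.
    by rewrite setD1K// eqxx andbT /link !inE eqxx /= setD1K//; case: (unsat _ _).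
  by move=> B /andP[vB _]; rewrite setU1K.
have le2 : \sum_(A : {set X} | ~~ unsat b A) w A <= \sum_(S | saturated b S) wdeg w S.
  rewrite (exchange_big_dep xpredT)//= big_mkcond; apply: ler_sum => A _.
  have s0 : 0 <= \sum_(S | saturated b S && (S \subset A)) w A by apply: sumr_ge0.
  case: ifP => // /forallPn[S]; rewrite negb_imply negbK => /andP[SA satS].
  by rewrite (bigD1 S)/= ?satS// lerDl sumr_ge0.
have le3 : \sum_(S | saturated b S) wdeg w S <= E / 2.
  apply: (@le_trans _ _ (\sum_(S | saturated b S) (8 * K / (K' * p)) * wdeg b S)).
    apply: ler_sum => S /andP[S0 satS].
    apply: le_trans (w_spread.2 S S0) _.
    apply: le_trans (ler_wpM2l _ satS); last by rewrite divr_ge0 ?mulr_ge0// ltW.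
    rewrite le_eqVlt; apply/orP; left; apply/eqP; rewrite /thr /E' -/N.
    by field; rewrite !gt_eqF.
  rewrite -mulr_sumr; apply: (@le_trans _ _ (8 * K / (K' * p) *
      ((2 ^ t.+1)%:R * (L%:R * (K * E / N))))).
    rewrite ler_wpM2l ?divr_ge0 ?mulr_ge0 ?(ltW K_gt0) ?(ltW K'_gt0) ?(ltW p_gt0)//.
    apply: le_trans (sum_wdeg _ b0) _.
    rewrite (eq_bigr (fun A => (2 ^ t.+1)%:R * b A)) => [|A _]; last first.
      have [->|/bU[-> _]] := eqVneq (b A) 0; first by rewrite mul0r mulr0.
      by rewrite mulrC.
    rewrite -mulr_sumr ler_wpM2l// (le_trans bup)// ler_wpM2r ?ler_nat//.
    by rewrite divr_ge0 ?mulr_ge0 ?ltW.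
  apply: (@le_trans _ _ (8 * K / (K' * p) *
      ((2 ^ t.+1)%:R * (2 * (p * N) * (K * E / N))))).
    rewrite ler_wpM2l ?divr_ge0 ?mulr_ge0 ?(ltW K_gt0) ?(ltW K'_gt0) ?(ltW p_gt0)//.
    rewrite ler_wpM2l// ler_wpM2r// divr_ge0 ?mulr_ge0 ?ltW//.
  have -> : 8 * K / (K' * p) * ((2 ^ t.+1)%:R * (2 * (p * N) * (K * E / N))) =
      E / 2 * ((2 ^ (t + 6))%:R * K ^+ 2 / K').
    rewrite addnC !natrX exprD exprS; field.
    by rewrite !gt_eqF.
  by rewrite ger_pMr ?divr_gt0// ler_pdivrMr// mul1r.
have := w_spread.1; rewrite (bigID (unsat b))/= => le4.
lra.
Qed.

(** Light vertices carry at most [N * d = E / 4] of the [E / 2] available, and every other vertex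
    carries at most [K * E / N]. *)
Lemma heavy_vertices b i : (i <= L)%N -> invariant i b ->
  N / (4 * K) <= #|[set v in Y | d <= link_deg b v]|%:R.
Proof.
move=> iL inv; have := sum_link_deg_ge iL inv.
set Rv := [set v in Y | _]; rewrite (bigID (mem Rv))/= => le1.
have le2 : \sum_(v in Rv) link_deg b v <= #|Rv|%:R * (K * E / N).
  rewrite mulr_natl -sumr_const; apply: ler_sum => v _; exact: link_deg_le.
have le3 : \sum_(v | v \notin Rv) link_deg b v <= N * d.
  rewrite /N mulr_natl -sumr_const [X in X <= _]big_mkcond [X in _ <= X]big_mkcond.
  apply: ler_sum => v _; have [vY|vY] := boolP (v \in Y).
    rewrite inE vY /=; have [dv|/ltW//] := leP d (link_deg b v).
    by rewrite /= /d divr_ge0 ?mulr_ge0 ?(ltW E_gt0) ?(ltW N_gt0).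
  rewrite inE (negPf vY) /= /link_deg big1// => B _; rewrite /link; case: ifP => // _.
  apply/eqP; apply: contraNT vY => /w_unif.2[_ /subsetP]; apply; exact: setU11.
have Nd : N * d = E / 4 by rewrite /d; field; rewrite gt_eqF.
have le4 : E / 4 <= #|Rv|%:R * (K * E / N) by rewrite Nd in le3; lra.
have KE : 0 < K * E / N by rewrite divr_gt0 ?mulr_gt0.
rewrite -(ler_pM2r KE); apply: le_trans le4.
rewrite le_eqVlt; apply/orP; left; apply/eqP; field.
by rewrite !gt_eqF.
Qed.

Variable c : R.
Hypothesis L_ge : p * N <= L%:R.
Hypothesis c_le : c <= N / (4 * K).
Hypothesis lower : forall b, uniform_weight Y t.+1 b -> spread_weight Y K' p E' b ->
  exists F, container_system (wfree b) Y (t.+1 * L) c F.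

(** Each round moves the first heavy vertex of [I] into the fingerprint and adds its link to [b]. If
    [I] has no heavy vertex, all heavy vertices of [Y] are certified to lie outside [I] and the
    rounds stop. After [L] rounds [b] satisfies the hypotheses of [lower]. *)
Lemma container_rounds j i b : (i + j)%N = L -> invariant i b ->
  exists F, container_system (fun I => wfree w I /\ wfree b I) Y (j + t.+1 * L) c F.
Proof.
elim: j i b => [|j IHj] i b.
  rewrite addn0 => -> [bU bthr _ blow].
  have [|F [FP FC]] := lower bU.
    split=> //; apply: le_trans blow; rewrite /E' /d.
    apply: (@le_trans _ _ (E / (4 * N) * (p * N))); last first.
      by rewrite ler_wpM2l// divr_ge0 ?mulr_ge0 ?ltW.
    by rewrite le_eqVlt; apply/orP; left; apply/eqP; field; rewrite gt_eqF.
  exists F; split=> [I [_ fI]|I I' [_ fI] [_ fI']]; [exact: FP|exact: FC].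
move=> ijL inv; have iL : (i <= L)%N by rewrite -ijL leq_addr.
have /choice[G GP] v : exists F, d <= link_deg b v ->
    container_system (fun I => wfree w I /\ wfree (fun B => b B + link b v B) I)
      Y (j + t.+1 * L) c F.
  have [dv|_] := boolP (d <= link_deg b v); last by exists (fun=> (set0, set0)).
  have [F FP] := IHj i.+1 _ (etrans (addSnnS i j) ijL) (invariant_step dv inv).
  by exists F.
pose first (I : {set X}) := ohead [seq v <- enum X | (v \in I) && (d <= link_deg b v)].
have firstP I v : first I = Some v -> v \in I /\ d <= link_deg b v.
  rewrite /first; case: filter (mem_filter (fun v => (v \in I) && (d <= link_deg b v))
    ^~ (enum X)) => //= u s mem [<-].
  by have := mem u; rewrite mem_head => /esym/andP[/andP[]].
have firstN I v : first I = None -> v \in I -> ~~ (d <= link_deg b v).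
  rewrite /first => fN vI; apply/negP => dv.
  have : v \in [seq v <- enum X | (v \in I) && (d <= link_deg b v)].
    by rewrite mem_filter vI dv mem_enum.
  by case: filter fN.
pose F I := if first I is Some v then (v |: (G v I).1, (G v I).2)
  else (set0, [set v in Y | d <= link_deg b v]).
have next_free (I : {set X}) v : v \in I -> wfree w I -> wfree b I ->
    wfree (fun B => b B + link b v B) I.
  move=> vI fw fb B BI; rewrite fb// add0r /link; case: ifP => // _.
  by rewrite fw// subUset sub1set vI.
exists F; split.
  move=> I [fw fb]; rewrite /F; case eF: (first I) => [v|] /=.
    have [vI dv] := firstP _ _ eF.
    have [S1 S2 S3 S4 S5] := (GP v dv).1 I (conj fw (next_free _ _ vI fw fb)).
    split=> //; first by rewrite subUset sub1set vI.
    by rewrite cardsU1 addSn -addn1 addnC leq_add// leq_b1.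
  split; rewrite ?sub0set ?cards0//.
  - by apply/subsetP => v; rewrite inE => /andP[].
  - rewrite -setI_eq0; apply/eqP/setP => v; rewrite !inE; apply/negP.
    by case/andP=> /andP[_ dv] vI; have := firstN I v eF vI; rewrite dv.
  - by rewrite (le_trans c_le)// (heavy_vertices iL inv).
(* Mutual containment passes from the fingerprints [v |: _] to the remaining parts; equality would
   not, because [v] may reappear in one of them. *)
move=> I I' [fw fb] [fw' fb']; rewrite /F.
case eF: (first I) => [v|]; case eF': (first I') => [v'|] //=.
- have [vI dv] := firstP _ _ eF; have [vI' dv'] := firstP _ _ eF'.
  rewrite !subUset !sub1set => /andP[vI2 S1] /andP[vI2' S2].
  have evv : v = v'.
    by apply: (ohead_filter_eq eF eF'); rewrite ?vI2 ?vI2'.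
  subst v'; apply: (GP v dv).2 => //; split=> //; exact: next_free.
- have [vI dv] := firstP _ _ eF; rewrite subUset sub1set => /andP[vI' _].
  by have := firstN _ _ eF' vI'; rewrite dv.
- have [vI dv] := firstP _ _ eF'; rewrite subUset sub1set => _ /andP[vI' _].
  by have := firstN _ _ eF vI'; rewrite dv.
Qed.

End Step.

(* Induction on the uniformity, after Nenadov and Pham: the links of the
   fingerprint vertices form a hypergraph of lower uniformity. *)
Theorem hypergraph_containers (t : nat) (K : R) : 0 < K ->
  exists2 dl : R, 0 < dl & forall (X : finType) (Y : {set X}) (L : nat) (p E : R)
    (w : {set X} -> R), 0 < p -> 0 < E -> (0 < #|Y|)%N ->
    p * #|Y|%:R <= L%:R -> L%:R <= 2 * (p * #|Y|%:R) ->
    uniform_weight Y t.+1 w -> spread_weight Y K p E w ->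
    exists F, container_system (wfree w) Y (t.+1 * L) (dl * #|Y|%:R) F.
Proof.
elim: t K => [|t IHt] K K0.
  exists K^-1 => [|X Y L p E w p0 E0 Y0 L1 L2 [w0 wU] [wE wS]]; first by rewrite invr_gt0.
  have N0 : 0 < #|Y|%:R :> R by rewrite ltr0n.
  exists (fun=> (set0, [set v in Y | w [set v] != 0])); split=> // I fI.
  split; rewrite ?sub0set ?cards0//=.
  - by apply/subsetP => v; rewrite inE => /andP[].
  - rewrite -setI_eq0; apply/eqP/setP => v; rewrite !inE; apply/negP.
    by case/andP=> /andP[_ /eqP wv] vI; apply: wv; apply: fI; rewrite sub1set.
  set Rv := [set v in Y | _].
  have le1 : \sum_A w A <= #|Rv|%:R * (K * E / #|Y|%:R).
    have -> : \sum_A w A = \sum_v wdeg w [set v].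
      rewrite sum_wdeg1; apply: eq_bigr => A _.
      have [->|/wU[-> _]] := eqVneq (w A) 0; first by rewrite mul0r.
      by rewrite mulr1.
    rewrite mulr_natl -sumr_const [X in _ <= X]big_mkcond; apply: ler_sum => v _.
    case: ifP => [_|vR].
      have := wS [set v]; rewrite cards1 expr0 mulr1; apply.
      by rewrite -card_gt0 cards1.
    rewrite /wdeg big1// => A; rewrite sub1set => vA; apply/eqP.
    apply: contraFT vR => wA; have [/eqP/cards1P[u Au] AY] := wU _ wA.
    move: vA wA; rewrite Au inE => /eqP -> wu; rewrite inE wu andbT.
    by rewrite (subsetP AY)// Au set11.
  have KE : 0 < K * E / #|Y|%:R by rewrite divr_gt0 ?mulr_gt0.
  rewrite -(ler_pM2r KE); apply: le_trans (le_trans wE le1).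
  by rewrite le_eqVlt; apply/orP; left; apply/eqP; field; rewrite !gt_eqF.
pose K' := Num.max (8 * K) ((2 ^ (t + 6))%:R * K ^+ 2).
have K'1 : 8 * K <= K' by rewrite le_max lexx.
have K'2 : (2 ^ (t + 6))%:R * K ^+ 2 <= K' by rewrite le_max lexx orbT.
have K'0 : 0 < K' by apply: lt_le_trans K'1; rewrite mulr_gt0.
have [dl dl0 IH] := IHt K' K'0.
exists (Num.min dl (4 * K)^-1) => [|X Y L p E w p0 E0 Y0 L1 L2 wU wS].
  by rewrite lt_min dl0 invr_gt0 mulr_gt0.
have N0 : 0 < #|Y|%:R :> R by rewrite ltr0n.
pose c := Num.min dl (4 * K)^-1 * #|Y|%:R.
have cK : c <= #|Y|%:R / (4 * K).
  by rewrite /c mulrC ler_pM2l// ge_min lexx orbT.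
have E'0 : 0 < p * E / 4 by rewrite divr_gt0 ?mulr_gt0.
have lower b : uniform_weight Y t.+1 b -> spread_weight Y K' p (p * E / 4) b ->
    exists F, container_system (wfree b) Y (t.+1 * L) c F.
  move=> bU bS; have [F [FP FC]] := IH X Y L p _ b p0 E'0 Y0 L1 L2 bU bS.
  exists F; split=> // I fI; have [? ? ? ? S5] := FP I fI; split=> //.
  by apply: le_trans S5; rewrite ler_wpM2r// ge_min lexx.
have [|F [FP FC]] := container_rounds K0 K'1 K'2 p0 E0 N0 L2 wU wS L1 cK lower
  (b := fun=> 0) (add0n L).
  split.
  - by split=> // A; rewrite eqxx.
  - move=> S _; rewrite /wdeg big1// divr_ge0// !mulr_ge0 ?exprn_ge0 ?ltW//.
    by rewrite invr_gt0.
  - by rewrite big1// mul0r.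
  - by rewrite mulr0 big1.
exists F; split=> [I fI|I I' fI fI'].
  by rewrite mulSn; apply: FP.
by apply: FC.
Qed.

End Containers.

(** * Balanced supersaturation *)

(** Lets the second moment of a binomial variable control its moment of order [alpha]. *)
Lemma powR_le1D (R : realType) (q a : R) : 0 <= q -> 0 <= a -> a <= 2 ->
  q `^ a <= 1 + q ^+ 2.
Proof.
move=> q0 a0 a2; have [q1|q1] := leP q 1.
  apply: (@le_trans _ _ (1 `^ a)); last by rewrite powR1 lerDl exprn_ge0.
  by apply: ge0_ler_powR; rewrite // nnegrE.
apply: (@le_trans _ _ (q ^+ 2)); last by rewrite lerDr.
by rewrite -powR_mulrn//; apply: ler_powR => //; exact: ltW.
Qed.

Lemma sum_count_mem (T : finType) (P : pred T) (s : seq T) :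
  (\sum_(x | P x) count_mem x s = count P s)%N.
Proof.
elim: s => [|y s IHs] /=; first by rewrite big1.
rewrite big_split/= IHs; congr (_ + _)%N.
rewrite big_mkcond (bigD1 y)//= eqxx big1 ?addn0; first by case: (P y).
by move=> x /negPf xy; rewrite eq_sym xy; case: (P x).
Qed.

Section Supersaturation.
Variables (R : realType) (V : finType) (H : sgraph V).
Variables (A alpha : R).
Hypothesis cycH : has_cycle H.
Hypothesis A_ge1 : 1 <= A.
Hypothesis alpha_ge0 : 0 <= alpha.
Hypothesis alpha_lt2 : alpha < 2.
Hypothesis Hex : forall n : nat, (ex n H)%:R <= A * n%:R `^ alpha.

Let m : R := m2 R H.
Let l := #|edges H|.

Lemma card_le_ex n (S : {set 'I_n}) (I : {set {set 'I_n}}) :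
  {in I, forall x : {set 'I_n}, #|x| = 2%N /\ x \subset S} ->
  (forall phi : {ffun V -> 'I_n}, injectiveb phi -> ~~ (copy (edges H) phi \subset I)) ->
  (#|I| <= ex #|S| H)%N.
Proof.
move=> I2 free; pose h (i : 'I_#|S|) : 'I_n := enum_val i.
have h_inj : injective h by exact: enum_val_inj.
pose J : {set {set 'I_#|S|}} := [set x : {set 'I_#|S|} | h @: x \in I].
have IJ : I = [set h @: x | x : {set 'I_#|S|} in J].
  apply/setP => x; apply/idP/imsetP => [xI|[y]]; last by rewrite inE => ? ->.
  have e : h @: [set i | h i \in x] = x.
    apply/setP => z; apply/imsetP/idP => [[i]|zx]; first by rewrite inE => ? ->.
    have zS : z \in S by apply: subsetP zx; exact: (I2 _ xI).2.
    have [y hy] : exists y, h y = z by exists (enum_rank_in zS z); rewrite /h enum_rankK_in.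
    by exists y; rewrite ?inE hy.
  by exists [set i | h i \in x]; rewrite // inE e.
rewrite IJ card_imset; last exact: imset_inj.
have J2 : [forall x in J, #|x| == 2%N].
  apply/forall_inP => x; rewrite inE => /I2[c2 _].
  by rewrite -c2 card_imset.
have Jfree : SGraph J2 \in free_graphs H #|S|.
  rewrite inE; apply/negP => /existsP[f /andP[/injectiveP inj /forall_inP sub]].
  have /negP[] : ~~ (copy (edges H) [ffun v => h (f v)] \subset I).
    by apply: free; apply/injectiveP => x y; rewrite !ffunE => /h_inj/inj.
  apply/subsetP => _ /imsetP[e eH ->].
  have -> : [ffun v => h (f v)] @: e = h @: (f @: e).
    by rewrite -imset_comp; apply: eq_imset => v; rewrite /= ffunE.
  by have := sub e eH; rewrite inE.
exact: (@leq_bigmax_cond _ (mem (free_graphs H #|S|)) (fun G => #|edges G|) _ Jfree).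
Qed.

Section Fixed_graph.
Variables (n : nat) (G : {set {set 'I_n}}).
Hypothesis G2 : {in G, forall x : {set 'I_n}, #|x| = 2%N}.
Let N : R := n%:R.
Let M : R := #|G|%:R.
Variable p : R.
Hypothesis p_gt0 : 0 < p.
Hypothesis p_le1 : p <= 1.
Hypothesis pN_ge1 : 1 <= p * N.
Hypothesis pM : 12 * A * (p * N) `^ alpha <= p ^+ 2 * M.
Hypothesis M_gt0 : 0 < M.

Lemma pexp_card_powR :
  pexp (coin p) (fun w : {ffun 'I_n -> bool} => #|heads w|%:R `^ alpha) <= 3 * (p * N) `^ alpha.
Proof.
have pN0 : 0 < p * N := lt_le_trans ltr01 pN_ge1.
have c0 := coin_ge0 (X := 'I_n) (ltW p_gt0) p_le1.
have c1 := coin_sum1 (X := 'I_n) p.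
have sq : pexp (coin p) (fun w : {ffun 'I_n -> bool} => #|heads w|%:R ^+ 2) <= (p * N) ^+ 2 + p * N.
  rewrite (@eq_pexp _ _ _ _ _ (fun w : {ffun 'I_n -> bool} =>
    \sum_x \sum_y ([set x; y] \subset heads w)%:R)); last first.
    move=> w; have -> : #|heads w|%:R = \sum_x (x \in heads w)%:R :> R.
      by rewrite -natr_sum -big_mkcond sum1_card.
    rewrite expr2 mulr_suml; apply: eq_bigr => x _; rewrite mulr_sumr.
    by apply: eq_bigr => y _; rewrite subUset !sub1set -mulnb natrM.
  rewrite pexp_sum; under eq_bigr do rewrite pexp_sum.
  under eq_bigr do under eq_bigr do rewrite pexp_subset.
  apply: (@le_trans _ _ (\sum_(x < n) (\sum_(y < n) p ^+ 2 + p))).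
    apply: ler_sum => x _; rewrite (bigD1 x)//= addrC lerD//; last first.
      by rewrite setUid cards1 expr1.
    rewrite [X in _ <= X](bigD1 x)//= ler_wpDl ?exprn_ge0 ?(ltW p_gt0)//.
    by apply: ler_sum => y yx; rewrite cards2 eq_sym yx.
  rewrite !sumr_const card_ord -[X in X <= _]mulr_natr -[p ^+ 2 *+ n]mulr_natr.
  rewrite -/N le_eqVlt.
  by apply/orP; left; apply/eqP; ring.
apply: (@le_trans _ _ (pexp (coin p) (fun w : {ffun 'I_n -> bool} =>
    (p * N) `^ alpha * (1 + (p * N) ^- 2 * #|heads w|%:R ^+ 2)))).
  apply: le_pexp => // w; have {1}-> : #|heads w|%:R = p * N * (#|heads w|%:R / (p * N)).
    by rewrite mulrC divfK// gt_eqF.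
  rewrite powRM ?divr_ge0 ?(ltW pN0)// ler_wpM2l ?powR_ge0//.
  apply: le_trans (powR_le1D _ _ _) _ => //; [by rewrite divr_ge0// ltW|exact: ltW|].
  by rewrite expr_div_n mulrC.
rewrite pexpZ pexpD pexp_cst// pexpZ mulrC ler_wpM2r ?powR_ge0//.
have : (p * N) ^- 2 * pexp (coin p) (fun w : {ffun 'I_n -> bool} => #|heads w|%:R ^+ 2) <=
    (p * N) ^- 2 * ((p * N) ^+ 2 + p * N).
  by rewrite ler_wpM2l// invr_ge0 exprn_ge0// ltW.
rewrite mulrDr mulVf ?expf_neq0 ?(gt_eqF pN0)//.
have : (p * N) ^- 2 * (p * N) <= 1.
  by rewrite mulrC ler_pdivrMr ?exprn_gt0// mul1r expr2 ler_peMl// ltW.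
lra.
Qed.

(** A random vertex set of density [p] spans [p ^+ 2 * M] edges of [G] on average. Deleting an edge
    from each saturated set inside it costs at most a quarter of this, and by [pM] the expected
    value of the Turan bound is at most another quarter, so a copy of [H] survives. A set [S] of
    edges is inside exactly when [cover S] is. *)
Lemma unsaturated_copy (Sat : {set {set {set 'I_n}}}) :
  {in Sat, forall S : {set {set 'I_n}}, S != set0} ->
  \sum_(S in Sat) p ^+ #|cover S| <= p ^+ 2 * M / 4 ->
  exists phi : {ffun V -> 'I_n}, [/\ injectiveb phi, copy (edges H) phi \subset G &
    {in Sat, forall S : {set {set 'I_n}}, ~~ (S \subset copy (edges H) phi)}].
Proof.
move=> Sat0 SatS.
have c0 := coin_ge0 (X := 'I_n) (ltW p_gt0) p_le1.
have c1 := coin_sum1 (X := 'I_n) p.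
have [w] := pexp_attained c0 c1 (fun w : {ffun 'I_n -> bool} =>
  #|[set x in G | x \subset heads w]|%:R -
  (\sum_(S in Sat) (cover S \subset heads w)%:R + A * #|heads w|%:R `^ alpha)).
rewrite pexpB pexp_card_subsets pexpD pexpZ pexp_sum.
rewrite (eq_bigr (fun=> p ^+ 2)) => [|x /G2 ->//]; rewrite sumr_const -mulr_natr.
under eq_bigr do rewrite pexp_subset.
move=> le_w; set W := [set x in G | x \subset heads w] in le_w.
have pM0 : 0 < p ^+ 2 * M by rewrite mulr_gt0 ?exprn_gt0.
have EA : A * pexp (coin p) (fun w : {ffun 'I_n -> bool} => #|heads w|%:R `^ alpha) <= p ^+ 2 * M / 4.
  apply: le_trans (ler_wpM2l (le_trans ler01 A_ge1) pexp_card_powR) _.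
  have -> : A * (3 * (p * N) `^ alpha) = 12 * A * (p * N) `^ alpha / 4 by field.
  by rewrite ler_pM2r ?invr_gt0.
have [I [IW nI cI]] := hitting_removal W Sat0.
have cS : #|[set S in Sat | S \subset W]|%:R <=
    \sum_(S in Sat) (cover S \subset heads w)%:R :> R.
  rewrite sumr_indicator ler_nat subset_leq_card//; apply/subsetP => S.
  rewrite !inE => /andP[-> /subsetP SW] /=; apply/bigcupsP => x /SW.
  by rewrite inE => /andP[].
have cI' : #|W|%:R <= #|I|%:R + #|[set S in Sat | S \subset W]|%:R :> R.
  by rewrite -natrD ler_nat.
have big : (ex #|heads w| H)%:R < #|I|%:R :> R.
  by apply: le_lt_trans (Hex _) _; rewrite -/M in le_w; lra.
have [/existsP[phi /andP[inj sub]]|/existsPn none] := boolP [exists phi : {ffun V -> 'I_n},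
    injectiveb phi && (copy (edges H) phi \subset I)].
  exists phi; split=> //.
    by apply: subset_trans sub (subset_trans IW _); apply/subsetP => x; rewrite inE => /andP[].
  by move=> S /nI; apply: contraNN => /subset_trans; apply.
have : (#|I| <= ex #|heads w| H)%N.
  apply: card_le_ex => [x /(subsetP IW)|phi inj].
    by rewrite inE => /andP[/G2].
  by have := none phi; rewrite inj.
by rewrite leqNgt -(ltr_nat R) big.
Qed.

Let m_gt1 : 1 < m. Proof. exact: m2_gt1. Qed.
Let m_gt0 : 0 < m. Proof. exact: lt_trans ltr01 m_gt1. Qed.
Let tau : R := p `^ m^-1.

Lemma tau_gt0 : 0 < tau. Proof. exact: powR_gt0. Qed.

Lemma tau_le1 : tau <= 1.
Proof.
rewrite -(powRr0 p); apply: ger_powR; first by rewrite p_gt0.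
by rewrite invr_ge0 ltW.
Qed.

(* This is where the definition of [m2] enters. *)
Lemma subcopy_power (phi : {ffun V -> 'I_n}) (S : {set {set 'I_n}}) :
  injectiveb phi -> S \subset copy (edges H) phi -> S != set0 ->
  p ^+ #|cover S| <= p ^+ 2 * tau ^+ #|S|.-1.
Proof.
move=> /injectiveP inj /subsetP sub S0.
pose S' := [set e in edges H | phi @: e \in S].
have SE : S = [set phi @: e | e : {set V} in S'].
  apply/setP => x; apply/idP/imsetP => [xS|[e]]; last by rewrite inE => /andP[_ ?] ->.
  by have /imsetP[e eH xe] := sub x xS; exists e; rewrite // inE eH -xe.
have cS : #|S| = #|S'| by rewrite SE card_imset//; apply: imset_inj.
have cc : #|cover S| = #|cover S'|.
  have -> : cover S = phi @: cover S'; last by rewrite card_imset.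
  apply/setP => z; apply/bigcupP/imsetP => [[x]|[v /bigcupP[e eS' ve] ->]].
    rewrite {1}SE => /imsetP[e eS' ->] /imsetP[v ve ->]; exists v => //.
    by apply/bigcupP; exists e.
  exists (phi @: e); last exact: imset_f.
  by rewrite SE; apply: imset_f.
have sK : subpattern (edges H) (cover S', S').
  apply/andP; split=> /=; first by apply/subsetP => e; rewrite inE => /andP[].
  by apply/forall_inP => e eS'; apply/subsetP => v ve; apply/bigcupP; exists e.
have /set0Pn[e0 e0S] : S' != set0 by rewrite -card_gt0 -cS card_gt0.
have j0 : (0 < #|S'|)%N by rewrite card_gt0; apply/set0Pn; exists e0.
have e0H : e0 \in edges H by move: e0S; rewrite inE => /andP[].
have c2 : (2 <= #|cover S'|)%N.
  rewrite -(card_edge e0H) subset_leq_card//; apply/subsetP => v ve.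
  by apply/bigcupP; exists e0.
have bal : (#|S'|%:R - 1) / m <= #|cover S'|%:R - 2.
  have [c3|c3] := ltnP 2 #|cover S'|.
    have c3R : 2 < #|cover S'|%:R :> R by rewrite ltr_nat.
    have := @le_m2 R V H (cover S', S') sK c3.
    by rewrite /= ler_pdivrMr ?subr_gt0// mulrC -ler_pdivrMr// mulrC.
  have c2' : #|cover S'| = 2%N by apply/eqP; rewrite eqn_leq c3.
  have j1 : #|S'| = 1%N.
    apply/eqP; rewrite eqn_leq j0 andbT.
    exact: (small_pattern (@card_edge V H) sK c3).
  by rewrite c2' j1 !subrr mul0r.
rewrite cc cS -(subnKC c2) exprD ler_wpM2l ?exprn_ge0 ?(ltW p_gt0)//.
rewrite -!powR_mulrn ?powR_ge0 ?(ltW p_gt0)// -powRrM; apply: ger_powR.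
  by rewrite p_gt0.
by rewrite natrB// -subn1 natrB// mulrC.
Qed.

(** Copies are added one by one, each avoiding the sets whose quota is full. All sets together are
    counted [i * 2 ^ l] times, so with quotas of factor [2 ^ (l + 2)] the bound of [subcopy_power]
    gives the full ones total weight at most [p ^+ 2 * M / 4]. The final [+ 1] is the overshoot of
    the last copy. *)
Lemma balanced_family (E0 i : nat) : (0 < E0)%N -> (i <= E0)%N ->
  exists s : seq {set {set 'I_n}}, [/\ size s = i,
    {in s, forall B : {set {set 'I_n}}, exists phi : {ffun V -> 'I_n},
       [/\ injectiveb phi, B = copy (edges H) phi & B \subset G]} &
    forall S : {set {set 'I_n}}, S != set0 ->
      (count (fun B : {set {set 'I_n}} => S \subset B) s)%:R <=
        (2 ^ (l + 2))%:R * tau ^+ #|S|.-1 * E0%:R / M + 1].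
Proof.
move=> E00; have E0R : 0 < E0%:R :> R by rewrite ltr0n.
have [Q QE Q0] : exists2 Q : R, Q = (2 ^ l)%:R & 0 < Q.
  by eexists => //; rewrite ltr0n expn_gt0.
have [K KE K0] : exists2 K : R, K = (2 ^ (l + 2))%:R & 0 < K.
  by eexists => //; rewrite ltr0n expn_gt0.
have KQ : K = Q * 4 by rewrite KE QE expnD natrM.
rewrite -KE; pose thr (S : {set {set 'I_n}}) : R := K * tau ^+ #|S|.-1 * E0%:R / M.
have thr0 S : 0 < thr S by rewrite divr_gt0// !mulr_gt0 ?exprn_gt0 ?tau_gt0.
elim: i => [_|i IHi iE]; first by exists [::]; split=> // S _; rewrite /= addr_ge0 ?(ltW (thr0 S)).
have [s [ss sP sdeg]] := IHi (ltnW iE).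
pose cnt (S : {set {set 'I_n}}) : nat := count (fun B : {set {set 'I_n}} => S \subset B) s.
pose Sat := [set S : {set {set 'I_n}} | (S != set0) && (thr S <= (cnt S)%:R)].
have Sat0 : {in Sat, forall S : {set {set 'I_n}}, S != set0}.
  by move=> S; rewrite inE => /andP[].
have cnt_total : (\sum_S cnt S = i * 2 ^ l)%N.
  under eq_bigr do rewrite /cnt -sum1_count.
  rewrite (exchange_big_dep xpredT)//= -ss.
  rewrite (eq_big_seq (fun=> 2 ^ l)%N) => [|B /sP[phi [inj -> _]]].
    by rewrite big_const_seq count_predT iter_addn_0 mulnC.
  rewrite sum1_card /l -(card_copy (edges H) inj) -card_powerset.
  by apply: eq_card => S; rewrite powersetE.
have [|phi [inj sub uns]] := unsaturated_copy Sat0.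
  pose c : R := p ^+ 2 * M / (K * E0%:R).
  apply: (@le_trans _ _ (\sum_(S in Sat) c * (cnt S)%:R)).
    apply: ler_sum => S; rewrite inE => /andP[S0 satS].
    have : has (fun B : {set {set 'I_n}} => S \subset B) s.
      by rewrite has_count -(ltr0n R) (lt_le_trans (thr0 S)).
    case/hasP=> B /sP[phi [inj -> _]] SB; apply: le_trans (subcopy_power inj SB S0) _.
    apply: le_trans (ler_wpM2l _ satS); last first.
      by rewrite divr_ge0 ?mulr_ge0 ?exprn_ge0 ?(ltW p_gt0)// ltW.
    have gen (y z a b d : R) : 0 < a -> 0 < b -> 0 < d ->
        z * y = z * a / (b * d) * (b * y * d / a).
      by move=> a0 b0 d0; field; rewrite !gt_eqF.
    by rewrite /thr /c -gen.
  rewrite -mulr_sumr; apply: (@le_trans _ _ (c * (E0 * 2 ^ l)%:R)).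
    rewrite ler_wpM2l//.
      by rewrite divr_ge0 ?mulr_ge0 ?exprn_ge0 ?(ltW p_gt0)// ltW.
    rewrite -natr_sum ler_nat; apply: leq_trans (_ : \sum_S cnt S <= _)%N.
      by rewrite [X in (_ <= X)%N](bigID (mem Sat)) leq_addr.
    by rewrite cnt_total leq_mul2r ltnW ?orbT.
  have gen (z a b d : R) : 0 < b -> 0 < d -> z * a / (b * 4 * d) * (d * b) = z * a / 4.
    by move=> b0 d0; field; rewrite !gt_eqF.
  by rewrite /c natrM -QE KQ gen.
exists (copy (edges H) phi :: s); split; rewrite /= ?ss//.
  by move=> B; rewrite inE => /orP[/eqP->|/sP//]; exists phi.
move=> S S0; have [SB|_] := boolP (S \subset _); last by rewrite add0n sdeg.
rewrite add1n -natr1 lerD2r ltW// ltNge; apply/negP => satS.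
by have /uns/negP[] : S \in Sat by rewrite inE S0.
Qed.

Lemma balanced_supersaturation : (0 < l)%N ->
  exists (E : R) (w : {set {set 'I_n}} -> R), [/\ 0 < E, uniform_weight G l w,
    spread_weight G (2 ^ (l + 3))%:R tau E w &
    forall B, w B != 0 -> exists phi : {ffun V -> 'I_n},
      injectiveb phi /\ B = copy (edges H) phi].
Proof.
move=> l0; have K0 : 0 < (2 ^ (l + 2))%:R * tau ^+ l by rewrite mulr_gt0 ?exprn_gt0 ?tau_gt0// ltr0n expn_gt0.
(* The sequence is so long that the quota of every set of at most [l] edges is at least 1 and
   absorbs the [+ 1]. Copies may repeat; multiplicities become weights. *)
have [e0 e0P] := nat_above (M / ((2 ^ (l + 2))%:R * tau ^+ l)).
pose E0 := e0.+1.
have E0P : M <= (2 ^ (l + 2))%:R * tau ^+ l * E0%:R.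
  rewrite mulrC -ler_pdivrMr// (le_trans e0P)// ler_nat; exact: leqnSn.
have [s [ss sP sdeg]] := balanced_family (ltn0Sn e0) (leqnn E0).
pose w (B : {set {set 'I_n}}) : R := (count_mem B s)%:R.
have wP B : w B != 0 -> B \in s.
  by rewrite /w pnatr_eq0 -lt0n -has_count has_pred1.
have wE S : wdeg w S = (count (fun B : {set {set 'I_n}} => S \subset B) s)%:R.
  by rewrite /wdeg -natr_sum sum_count_mem.
exists E0%:R, w; split; first by rewrite ltr0n.
- split=> [B|B /wP/sP[phi [inj -> sub]]]; first by rewrite /w.
  by rewrite (card_copy _ inj).
- split=> [|S S0]; first by rewrite -natr_sum sum_count_mem count_predT ss.
  rewrite wE; have [Sl|Sl] := leqP #|S| l; last first.
    rewrite (_ : count _ s = 0%N).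
      by rewrite divr_ge0// !mulr_ge0 ?exprn_ge0 ?(ltW tau_gt0).
    apply/eqP; rewrite -leqn0 leqNgt -has_count; apply/hasPn => B /sP[phi [inj -> _]].
    by apply: contraTN Sl => /subset_leq_card; rewrite (card_copy _ inj) -leqNgt.
  apply: le_trans (sdeg S S0) _.
  have -> : (2 ^ (l + 3))%:R = 2 * (2 ^ (l + 2))%:R :> R by rewrite -natrM -expnS addnS.
  have -> : 2 * (2 ^ (l + 2))%:R * tau ^+ #|S|.-1 * E0%:R / #|G|%:R =
    (2 ^ (l + 2))%:R * tau ^+ #|S|.-1 * E0%:R / M * 2 by rewrite -!mulrA [LHS]mulrC -!mulrA.
  rewrite [X in _ <= X]mulr_natr mulr2n lerD2l ler_pdivlMr// mul1r (le_trans E0P)//.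
  rewrite ler_wpM2r// ler_wpM2l//; apply: ler_wiXn2l; rewrite ?tau_le1 ?(ltW tau_gt0)//.
  by rewrite (leq_trans (leq_pred _)).
- by move=> B /wP/sP[phi [inj BE _]]; exists phi.
Qed.

End Fixed_graph.
End Supersaturation.

(** * One container step for a dense graph *)

Section GraphContainerStep.
Variables (R : realType) (V : finType) (H : sgraph V).
Variables (A alpha : R).
Hypothesis cycH : has_cycle H.
Hypothesis A_ge1 : 1 <= A.
Hypothesis alpha_lt2 : alpha < 2.
Hypothesis alpha_gt : 2 - (m2 R H)^-1 < alpha.
Hypothesis Hex : forall n : nat, (ex n H)%:R <= A * n%:R `^ alpha.

Definition copy_free n (I : {set {set 'I_n}}) : bool :=
  [forall phi : {ffun V -> 'I_n}, injectiveb phi ==> ~~ (copy (edges H) phi \subset I)].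

Let m := m2 R H.
Let lam := lambda alpha H.
Let m_gt1 : 1 < m. Proof. exact: m2_gt1. Qed.
Let m_gt0 : 0 < m. Proof. exact: lt_trans ltr01 m_gt1. Qed.
Let a2 : 0 < 2 - alpha. Proof. by rewrite subr_gt0. Qed.

Lemma nat_ceil (x : R) : 1 <= x -> exists L : nat, x <= L%:R /\ L%:R <= 2 * x.
Proof.
move=> x1; case: (ex_minnP (nat_above x)) => L xL minL; exists L; split=> //.
case: L xL minL => [|L] xL minL; first by rewrite /= mulr_ge0// (le_trans ler01).
have Lx : L%:R < x by rewrite ltNge; apply/negP => /minL; rewrite ltnn.
by rewrite -natr1; lra.
Qed.

Lemma card_graph_le n (G : {set {set 'I_n}}) :
  {in G, forall x : {set 'I_n}, #|x| = 2%N} -> (#|G| <= n ^ 2)%N.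
Proof.
move=> G2; apply: (@leq_trans #|[set x : {set 'I_n} | #|x| == 2%N]|).
  by apply: subset_leq_card; apply/subsetP => x /G2; rewrite inE => ->.
rewrite card_draws card_ord bin2 (leq_trans (half_leq (leq_mul (leqnn n) (leq_pred n))))//.
by rewrite -divn2 -mulnn leq_div.
Qed.

Lemma m2_edges : (0 < #|edges H|)%N.
Proof.
rewrite lt0n; apply/negP => /eqP l0; have [F [sF F1 dF _]] := m2_core R cycH.
have := m_gt1; rewrite /m -dF; have [FH _] := andP sF.
have -> : #|F.2| = 0%N by apply/eqP; rewrite -leqn0 -l0 subset_leq_card.
have F1R : 2 < #|F.1|%:R :> R by rewrite ltr_nat.
by rewrite ltr_pdivlMr ?mul1r; lra.
Qed.

Lemma graph_container_step : exists d C0 : R, [/\ 0 < d, d <= 2^-1, 0 < C0 &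
  forall n (G : {set {set 'I_n}}), (0 < n)%N ->
  {in G, forall x : {set 'I_n}, #|x| = 2%N} ->
  12 * A * n%:R `^ alpha <= #|G|%:R ->
  exists (s : nat) F, container_system (@copy_free n) G s (d * #|G|%:R) F /\
    s%:R <= C0 * (#|G|%:R / n%:R `^ alpha) `^ (1 - lam) * n%:R `^ alpha].
Proof.
have A12_1 : 1 <= 12 * A by have := A_ge1; lra.
have mV1 : m^-1 < 1 by rewrite invf_lt1.
have mV2 : m^-1 <= 2 - m^-1 by move: mV1; set x := m^-1; lra.
have l0 := m2_edges; pose l := #|edges H|.
have [K KE K0] : exists2 K : R, K = (2 ^ (l + 3))%:R & 0 < K.
  by eexists => //; rewrite ltr0n expn_gt0.
have [d d0 cont] := hypergraph_containers l.-1 K0.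
(* The fingerprint has at most [l * L] edges with [L <= 2 * (tau * #|G|)], and
   [tau = (12 * A / k) ^ lam]. *)
pose C0 : R := 2 * l%:R * (12 * A) `^ lam.
have A12 : 0 < 12 * A by rewrite mulr_gt0// (lt_le_trans ltr01).
exists (Num.min d 2^-1), C0; split.
- by rewrite lt_min d0 invr_gt0 ltr0n.
- by rewrite ge_min lexx orbT.
- by rewrite !mulr_gt0 ?powR_gt0// ltr0n.
move=> n G n0 G2 GA; have N1 : 1 <= n%:R :> R by rewrite ler1n.
have N0 : 0 < n%:R :> R := lt_le_trans ltr01 N1.
pose Na := n%:R `^ alpha; have Na0 : 0 < Na by rewrite powR_gt0.
have M0 : 0 < #|G|%:R :> R by apply: lt_le_trans GA; rewrite mulr_gt0.
pose k := #|G|%:R / Na; have k0 : 0 < k by rewrite divr_gt0.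
have ME : #|G|%:R = k * Na by rewrite divfK// gt_eqF.
have kA : 12 * A <= k by rewrite ler_pdivlMr.
(* With [p ^ (2 - alpha) = q] the requirement [pM] of the supersaturation holds with equality. *)
pose q := 12 * A / k; have q0 : 0 < q by rewrite divr_gt0.
have q1 : q <= 1 by rewrite ler_pdivrMr// mul1r.
pose p := q `^ (2 - alpha)^-1; have p0 : 0 < p by rewrite powR_gt0.
have p1 : p <= 1.
  by rewrite -(powRr0 q); apply: ger_powR; rewrite ?q0// invr_ge0 ltW.
have pq : p `^ (2 - alpha) = q by rewrite -powRrM mulVf ?gt_eqF// powRr1// ltW.
(* [G] has at most [n ^ 2] edges; this is what keeps [p * n] at least 1. *)
have kn : k <= n%:R `^ (2 - alpha).
  rewrite powRB; last by rewrite (gt_eqF N0) implybT.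
  by rewrite ler_wpM2r ?invr_ge0 ?powR_ge0// powR_mulrn// -natrX ler_nat card_graph_le.
have pN : 1 <= p * n%:R.
  have -> : p * n%:R = (q * n%:R `^ (2 - alpha)) `^ (2 - alpha)^-1.
    by rewrite powRM ?powR_ge0 ?ltW// -powRrM mulfV ?gt_eqF// powRr1// ltW.
  rewrite -[X in X <= _](powRr0 (q * n%:R `^ (2 - alpha))); apply: ler_powR.
    by rewrite mulrAC ler_pdivlMr// mul1r (le_trans kn)// ler_peMl ?powR_ge0.
  by rewrite invr_ge0 ltW.
have pM : 12 * A * (p * n%:R) `^ alpha <= p ^+ 2 * #|G|%:R.
  rewrite powRM ?(ltW p0) ?(ltW N0)// -/Na ME.
  have -> : p ^+ 2 = p `^ alpha * q.
    rewrite -pq -powRD ?(gt_eqF p0) ?implybT// -powR_mulrn ?ltW//.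
    by congr (_ `^ _); ring.
  rewrite /q le_eqVlt; apply/orP; left; apply/eqP; field; exact: lt0r_neq0.
have alpha_ge0 : 0 <= alpha.
  apply: ltW; apply: le_lt_trans alpha_gt; apply: le_trans mV2.
  by rewrite invr_ge0 ltW.
have [E [w [E0 wU wS wC]]] :=
  balanced_supersaturation cycH A_ge1 alpha_ge0 alpha_lt2 Hex G2 p0 p1 pN pM M0 l0.
rewrite -/l -KE in wS.
pose tau := p `^ (m2 R H)^-1; have tau0 : 0 < tau by rewrite powR_gt0.
have lamE : lam = (2 - alpha)^-1 * m^-1.
  by rewrite /lam /lambda div1r invfM mulrC.
have tauE : tau = q `^ lam by rewrite lamE powRrM.
(* Needed for rounding [tau * #|G|] up to an integer at the cost of a factor 2; it follows from
   [p * n >= 1] and [1/m <= 2 - 1/m < alpha]. *)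
have tauM : 1 <= tau * #|G|%:R.
  have t1 : n%:R `^ (- m^-1) <= tau.
    have -> : n%:R `^ (- m^-1) = n%:R^-1 `^ m^-1.
      by rewrite -(powR_inv1 (ltW N0)) -powRrM mulN1r.
    apply: ge0_ler_powR; rewrite ?nnegrE ?invr_ge0 ?(ltW N0) ?(ltW p0) ?(ltW m_gt0)//.
    by rewrite -div1r ler_pdivrMr.
  have t2 : n%:R `^ m^-1 <= #|G|%:R.
    apply: (@le_trans _ _ Na).
      by apply: ler_powR => //; apply: le_trans mV2 (ltW alpha_gt).
    by apply: le_trans GA; rewrite ler_peMl ?(ltW Na0).
  apply: (@le_trans _ _ (n%:R `^ (- m^-1) * n%:R `^ m^-1)).
    by rewrite powRN mulVf// gt_eqF// powR_gt0.
  by apply: ler_pM; rewrite ?powR_ge0.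
have [L [L1 L2]] := nat_ceil tauM.
have Gpos : (0 < #|G|)%N by rewrite -(ltr0n R).
have lE : l.-1.+1 = l by rewrite prednK.
rewrite lE in cont.
have [F [FP FC]] := cont _ G L tau E w tau0 E0 Gpos L1 L2 wU wS.
have freew I : copy_free I -> wfree w I.
  move=> /forallP fI B BI; apply/eqP; apply: contraT => /wC[phi [inj BE]].
  by have := fI phi; rewrite inj -BE BI.
exists (l * L)%N, F; split.
  split=> [I /freew/FP[? ? ? ? S5]|I I' /freew fI /freew fI']; last exact: FC.
  by split=> //; apply: le_trans S5; rewrite ler_wpM2r// ge_min lexx.
apply: (@le_trans _ _ (l%:R * (2 * (tau * #|G|%:R)))); first by rewrite natrM ler_wpM2l.
rewrite tauE -/Na -/k ME /q powRM ?invr_ge0 ?(ltW A12) ?(ltW k0)//.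
rewrite powRB ?(gt_eqF k0) ?implybT// powRr1 ?(ltW k0)//.
rewrite -(powR_inv1 (ltW k0)) -powRrM mulN1r powRN /C0.
by rewrite le_eqVlt; apply/orP; left; apply/eqP; ring.
Qed.

End GraphContainerStep.

(** * Iterating the container step *)

Lemma ffact_le_exp (n k : nat) : (n ^_ k <= n ^ k)%N.
Proof.
elim: k n => [|k IHk] n //; rewrite ffactnS expnS leq_mul2l.
apply/orP; right; apply: leq_trans (IHk _) _.
by case: k {IHk} => // k; rewrite leq_exp2r// leq_pred.
Qed.

(** The binomial theorem, after ['C(#|G|, t) <= #|G| ^ t / t!]. With [T] the fingerprint of one
    round and [Z] belonging to the later rounds, a bound of the form [Z ^ s / s!] reproduces
    itself. *)
Lemma sum_bounded_subsets (R : realFieldType) (X : finType) (G : {set X}) (s : nat)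
    (y Z : R) : 0 <= y -> 0 <= Z ->
  \sum_(T : {set X} | (T \subset G) && (#|T| <= s)%N)
     y ^+ #|T| * (Z ^+ (s - #|T|) / (s - #|T|)`!%:R) <=
  (Z + #|G|%:R * y) ^+ s / s`!%:R.
Proof.
move=> y0 Z0; rewrite (partition_big (fun T : {set X} => inord #|T| : 'I_s.+1) xpredT)//=.
rewrite exprDn mulr_suml; apply: ler_sum => t _.
have ts : (t <= s)%N by rewrite -ltnS.
rewrite (eq_bigl (fun T : {set X} => (T \subset G) && (#|T| == t))); last first.
  move=> T; rewrite -andbA; congr (_ && _); have [Ts|Ts] := leqP #|T| s.
    by rewrite -val_eqE/= inordK.
  by apply/esym/negbTE; rewrite neq_ltn (leq_ltn_trans ts Ts) orbT.
rewrite (eq_bigr (fun=> y ^+ t * (Z ^+ (s - t) / (s - t)`!%:R))); last first.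
  by move=> T /andP[_ /eqP ->].
have f0 n : 0 < n`!%:R :> R by rewrite ltr0n fact_gt0.
rewrite sumr_const -[X in X <= _]mulr_natl.
have -> : #|[pred T : {set X} | (T \subset G) && (#|T| == t)]| = 'C(#|G|, t).
  by rewrite -cards_draws; apply: eq_card => T; rewrite !inE.
have le1 : 'C(#|G|, t)%:R <= #|G|%:R ^+ t / t`!%:R :> R.
  by rewrite ler_pdivlMr// -natrX -natrM ler_nat bin_ffact ffact_le_exp.
have -> : Z ^+ (s - t) * (#|G|%:R * y) ^+ t *+ 'C(s, t) / s`!%:R =
    #|G|%:R ^+ t / t`!%:R * (y ^+ t * (Z ^+ (s - t) / (s - t)`!%:R)).
  rewrite -(bin_fact ts) !natrM exprMn -[_ *+ 'C(s, t)]mulr_natr.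
  have C0 : 0 < 'C(s, t)%:R :> R by rewrite ltr0n bin_gt0.
  by field; rewrite !gt_eqF.
by rewrite ler_wpM2r// mulr_ge0 ?divr_ge0 ?exprn_ge0// ltW.
Qed.

Lemma leq_card_bigcup (I T : finType) (P : pred I) (F : I -> {set T}) :
  (#|\bigcup_(i | P i) F i| <= \sum_(i | P i) #|F i|)%N.
Proof.
elim/big_rec2: _ => [|i n A _ IHA]; first by rewrite cards0.
by rewrite (leq_trans (leq_card_setU _ _).1)// leq_add2l.
Qed.

(** * Geometric series as telescoping potentials *)

Section Potential.
Variables (R : realType) (d : R).
Hypothesis d_gt0 : 0 < d.
Hypothesis d_le : d <= 2^-1.

Let r : R := 1 - d.
Let r_gt0 : 0 < r. Proof. by rewrite subr_gt0; have := d_le; lra. Qed.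
Let r_lt1 : r < 1. Proof. by rewrite gtrBl. Qed.

(* Decreases by a definite amount whenever [x > 1] is multiplied by [r]. *)
Definition pot (b x : R) : R := r `^ (- b) - Num.max x r `^ (- b).

Definition gain (b : R) : R := r `^ (- b) - 1.

Lemma le_powRN (b x y : R) : 0 <= b -> 0 < x -> x <= y -> y `^ (- b) <= x `^ (- b).
Proof.
move=> b0 x0 xy; have y0 : 0 < y := lt_le_trans x0 xy.
rewrite !powRN lef_pV2 ?posrE ?powR_gt0//.
by apply: ge0_ler_powR; rewrite ?nnegrE ?(ltW x0) ?(ltW y0).
Qed.

Lemma pot_ge0 b x : 0 <= b -> 0 <= pot b x.
Proof. by move=> b0; rewrite subr_ge0 le_powRN// le_max lexx orbT. Qed.

Lemma pot_le b x : pot b x <= r `^ (- b).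
Proof. by rewrite gerBl powR_ge0. Qed.

Lemma gain_gt0 b : 0 < b -> 0 < gain b.
Proof.
move=> b0; rewrite /gain subr_gt0 powRN invf_gt1 ?powR_gt0//.
have : r `^ b < 1 `^ b by apply: gt0_ltr_powR; rewrite // nnegrE// ltW.
by rewrite powR1.
Qed.

(** Hence [pot / gain] telescopes and bounds the sum of [x ^ (- b)] over the values above 1 of any
    sequence shrinking by the factor [r], whatever its length. Truncating [pot] at [r] and not at 1
    keeps the full decrease in the last round. *)
Lemma pot_step b x x' : 0 <= b -> 1 < x -> x' <= r * x ->
  x `^ (- b) * gain b <= pot b x - pot b x'.
Proof.
move=> b0 x1 xx'; have x0 : 0 < x := lt_trans ltr01 x1.
rewrite /pot; have -> : Num.max x r = x by apply/max_idPl; apply: ltW; apply: lt_trans x1.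
have : (r * x) `^ (- b) <= Num.max x' r `^ (- b).
  apply: le_powRN => //; first by rewrite lt_max r_gt0 orbT.
  by rewrite ge_max xx' ler_peMr// ltW.
rewrite powRM ?(ltW r_gt0) ?(ltW x0)// /gain; lra.
Qed.

End Potential.

Section Iteration.
Variables (R : realType) (X : finType) (U : {set X}) (free : pred {set X}).
Variables (M0 U0 d eta : R).
Hypothesis free_sub : forall I J : {set X}, J \subset I -> free I -> free J.
Hypothesis M0_gt0 : 0 < M0.
Hypothesis U0_ge0 : 0 <= U0.
Hypothesis d_gt0 : 0 < d.
Hypothesis d_le : d <= 2^-1.
Hypothesis eta_gt0 : 0 < eta.
Hypothesis step : forall G : {set X}, G \subset U -> M0 < #|G|%:R ->
  exists (s : nat) F, container_system free G s (d * #|G|%:R) F /\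
    s%:R <= U0 * (#|G|%:R / M0) `^ (- eta).

Let r : R := 1 - d.

(** The three series to be summed over the rounds: the fingerprint sizes [U0 * x ^ (- eta)], the
    discounted choices [M0 / x], and the logarithms of the discounts that have to be paid back. *)
Definition total_bound (x : R) : R := U0 * (pot d eta x / gain d eta).
Definition edge_bound (x : R) : R := M0 * (pot d 1 x / gain d 1).
Definition overhead (x : R) : R :=
  expR (U0 * (4 / eta * (pot d (eta / 2) x / gain d (eta / 2)))).

Let eta2_gt0 : 0 < eta / 2. Proof. by rewrite divr_gt0. Qed.

Lemma pot_gain_ge0 b x : 0 < b -> 0 <= pot d b x / gain d b.
Proof.
move=> b0; rewrite divr_ge0 ?(ltW (gain_gt0 d_gt0 d_le b0))//.
by apply: pot_ge0; rewrite // ltW.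
Qed.

Lemma pot_gain_step b x x' : 0 < b -> 1 < x -> x' <= r * x ->
  pot d b x' / gain d b + x `^ (- b) <= pot d b x / gain d b.
Proof.
move=> b0 x1 xx'; have g0 := gain_gt0 d_gt0 d_le b0.
have := pot_step d_gt0 d_le (ltW b0) x1 xx'.
rewrite -ler_pdivlMr// mulrBl; lra.
Qed.

Lemma total_bound_step x x' : 1 < x -> x' <= r * x ->
  U0 * x `^ (- eta) + total_bound x' <= total_bound x.
Proof.
move=> x1 xx'; rewrite /total_bound -mulrDr ler_wpM2l// addrC.
exact: pot_gain_step.
Qed.

Lemma edge_bound_step x x' : 1 < x -> x' <= r * x ->
  edge_bound x' + M0 / x <= edge_bound x.
Proof.
move=> x1 xx'; rewrite /edge_bound -mulrDr ler_pM2l//.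
by rewrite -(powR_inv1 (ltW (lt_trans ltr01 x1))) pot_gain_step.
Qed.

(** [ln x] is at most [2 / eta * x ^ (eta / 2)]; this spends half of the decay [x ^ (- eta)], and
    the rest still gives a geometric series. Hence [4 / eta] and [eta / 2] in [overhead]. *)
Lemma overhead_step x x' : 1 < x -> x' <= r * x ->
  overhead x' * expR (2 * (U0 * x `^ (- eta)) * ln x) <= overhead x.
Proof.
move=> x1 xx'; have x0 : 0 < x := lt_trans ltr01 x1.
rewrite /overhead -expRD ler_expR.
have ln_le : eta / 2 * ln x <= x `^ (eta / 2).
  by rewrite -ln_powR ltW// ln_sublinear// powR_gt0.
have key : 2 * (U0 * x `^ (- eta)) * ln x <= U0 * (4 / eta * x `^ (- (eta / 2))).
  have -> : 2 * (U0 * x `^ (- eta)) * ln x =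
      U0 * (4 / eta * (x `^ (- eta) * (eta / 2 * ln x))).
    by field; rewrite gt_eqF.
  rewrite ler_wpM2l// ler_wpM2l ?divr_ge0 ?(ltW eta_gt0)//.
  have -> : x `^ (- (eta / 2)) = x `^ (- eta) * x `^ (eta / 2).
    rewrite -powRD ?(gt_eqF x0) ?implybT//; congr (_ `^ _); lra.
  by rewrite ler_wpM2l// powR_ge0.
apply: le_trans (lerD (lexx _) key) _.
rewrite -mulrDr ler_wpM2l// -mulrDr ler_wpM2l ?divr_ge0 ?(ltW eta_gt0)//.
exact: pot_gain_step.
Qed.

(** Labels are sizes of containers, so a finite range suffices, and colorings can be counted as
    elements of a finite type. *)
Let col := {ffun X -> option 'I_#|X|.+1}.
Implicit Types (c : col) (G I T : {set X}).

Definition colored c : {set X} := [set e | c e != None].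

Definition counted (col_ : {set X} -> col) (s : nat) : {set col} :=
  col_ @: [set I : {set X} | free I && (#|colored (col_ I)| == s)].

(* Fingerprint edges chosen while the current container is [G] are coloured
   [#|G|]. *)
Definition coloring_system (G : {set X}) (C : {set X} -> col)
    (fin : {set X} -> {set X}) : Prop :=
  let x := #|G|%:R / M0 in
  [/\ forall I, free I -> [/\ colored (C I) \subset I :&: G,
        I :&: G \subset fin I :|: colored (C I), fin I \subset G,
        #|fin I|%:R <= M0 & #|colored (C I)|%:R <= total_bound x],
      forall I I', free I -> free I' -> C I = C I' -> fin I = fin I',
      forall I e j, free I -> C I e = Some j -> (j <= #|G|)%N &
      forall s, #|counted C s|%:R <= overhead x * (edge_bound x ^+ s / s`!%:R)].

Lemma coloring_system_base G : #|G|%:R <= M0 ->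
  coloring_system G (fun=> [ffun=> None]) (fun=> G).
Proof.
move=> GM x; have supp0 : colored [ffun=> None] = set0.
  by apply/setP => e; rewrite !inE ffunE.
split=> //.
- move=> I _; rewrite supp0 cards0 sub0set setU0 subsetIr; split=> //.
  by rewrite mulr_ge0// pot_gain_ge0.
- by move=> I e j _; rewrite ffunE.
move=> s; have Q1 : 1 <= overhead x.
  rewrite -[X in X <= _]expR0 ler_expR mulr_ge0//.
  by apply: mulr_ge0; [exact: divr_ge0 (ler0n _ _) (ltW eta_gt0)|exact: pot_gain_ge0].
have Y0 : 0 <= edge_bound x by rewrite mulr_ge0 ?pot_gain_ge0// ltW.
case: s => [|s].
  rewrite expr0 fact0 divr1 mulr1 (le_trans _ Q1)// (ler_nat R _ 1).
  apply: leq_trans (_ : #|[set [ffun=> None] : col]| <= 1)%N; last by rewrite cards1.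
  by apply: subset_leq_card; apply/subsetP => c /imsetP[I _ ->]; rewrite set11.
rewrite /counted (_ : [set I | _] = set0) ?imset0 ?cards0.
  by rewrite /= mulr_ge0 ?expR_ge0// divr_ge0 ?exprn_ge0.
by apply/setP => I; rewrite !inE supp0 cards0 andbF.
Qed.

Lemma coloring_system_exists G : G \subset U -> exists C fin, coloring_system G C fin.
Proof.
have [k] := ubnP #|G|; elim: k => // k IHk in G * => /ltnSE-Gk GU.
have [GM|GM] := leP #|G|%:R M0; first by exists (fun=> [ffun=> None]), (fun=> G); apply: coloring_system_base.
have G0 : 0 < #|G|%:R :> R := lt_trans M0_gt0 GM.
pose x : R := #|G|%:R / M0; have x1 : 1 < x by rewrite ltr_pdivlMr ?mul1r.
have x0 : 0 < x := lt_trans ltr01 x1.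
have [s0 [F [[FP FC] s0_le]]] := step GU GM.
(* One system is fixed for each smaller container, so that sets [I] with the same next container
   continue with the same system. *)
have /choice[CF CFP] (G' : {set X}) : exists CF : ({set X} -> col) * ({set X} -> {set X}),
    G' \subset G -> #|G'|%:R <= r * #|G|%:R -> coloring_system G' CF.1 CF.2.
  have [/andP[sub sm]|none] := boolP ((G' \subset G) && (#|G'|%:R <= r * #|G|%:R)); last first.
    by exists (fun=> [ffun=> None], fun=> G') => s1 s2; rewrite s1 s2 in none.
  have G'k : (#|G'| < k)%N.
    apply: leq_trans Gk; rewrite -(ltr_nat R) (le_lt_trans sm)//.
    by rewrite gtr_pMl// gtrBl.
  have [C [fin sys]] := IHk G' G'k (subset_trans sub GU).
  by exists (C, fin).
pose T I := (F (I :&: G)).1.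
(* The fingerprint leaves the container too: later rounds cannot color its edges again, and the
   numbers of colored edges add up. *)
pose next I := G :\: (T I :|: (F (I :&: G)).2).
have freeG I : free I -> free (I :&: G) by apply: free_sub; exact: subsetIl.
have TP I : free I -> [/\ T I \subset I :&: G, (#|T I| <= s0)%N,
    I :&: G \subset T I :|: next I & #|next I|%:R <= r * #|G|%:R].
  move=> fI; have [S1 S2 S3 S4 S5] := FP _ (freeG I fI); split=> //.
    apply/subsetP => e eIG; rewrite !inE; have [//|eT] := boolP (e \in T I).
    have := eIG; rewrite inE => /andP[_ ->]; rewrite andbT /=.
    by apply/negP => eR; have := disjointFr S4 eR; rewrite eIG.
  have cn : (#|next I| + #|(F (I :&: G)).2| <= #|G|)%N.
    rewrite -(cardsID (F (I :&: G)).2 G) addnC leq_add ?subset_leq_card//.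
      by rewrite subsetI S3 subxx.
    by rewrite setDS// subsetUr.
  have : #|next I|%:R + #|(F (I :&: G)).2|%:R <= #|G|%:R :> R by rewrite -natrD ler_nat.
  by rewrite /r mulrBl mul1r; move: S5; lra.
have nextG I : next I \subset G by apply: subsetDl.
have sysI I : free I -> coloring_system (next I) (CF (next I)).1 (CF (next I)).2.
  by move=> fI; apply: CFP; have [] := TP I fI.
have TnextE I I' : free I -> free I' -> T I = T I' -> next I = next I'.
  move=> fI fI' TT; rewrite /next TT (FC (I :&: G) (I' :&: G)) ?freeG//.
    by rewrite -/(T I) TT; have [] := TP I' fI'.
  by rewrite -/(T I') -TT; have [] := TP I fI.
have Tnext I e : free I -> e \in T I -> e \notin next I.
  by move=> _ eT; rewrite !inE eT.
pose lbl : 'I_#|X|.+1 := inord #|G|.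
have lblE : lbl = #|G| :> nat by rewrite inordK// ltnS max_card.
pose C I : col := [ffun e => if e \in T I then Some lbl else (CF (next I)).1 I e].
pose fin I := (CF (next I)).2 I.
have suppC I : free I -> colored (C I) = T I :|: colored ((CF (next I)).1 I).
  by move=> fI; apply/setP => e; rewrite !inE ffunE; case: ifP.
have supp_next I : free I -> colored ((CF (next I)).1 I) \subset next I.
  move=> fI; have [/(_ I fI)[s1 _ _ _ _] _ _ _] := sysI I fI.
  by apply: subset_trans s1 (subsetIr _ _).
have suppD I : free I -> #|colored (C I)| = (#|T I| + #|colored ((CF (next I)).1 I)|)%N.
  move=> fI; rewrite suppC// cardsU -[RHS]subn0; congr (_ - _)%N.
  apply: eq_card0 => e; rewrite inE; apply/negP => /andP[eT /(subsetP (supp_next I fI))].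
  by rewrite (negPf (Tnext I e fI eT)).
have xnext I : free I -> #|next I|%:R / M0 <= r * x.
  by move=> fI; rewrite mulrA ler_pM2r ?invr_gt0//; have [] := TP I fI.
(* The fingerprint of this round can be read off as the edges labelled [#|G|]: later labels are at
   most the size of a strictly smaller container. *)
have TC I I' : free I -> free I' -> C I = C I' -> T I = T I'.
  have half J J' : free J -> free J' -> C J = C J' -> T J \subset T J'.
    move=> fJ fJ' CC; apply/subsetP => e eT; apply: contraT => eT'.
    have := congr1 (fun c : col => c e) CC; rewrite !ffunE eT (negPf eT').
    move=> /esym cl; have [_ _ lab _] := sysI J' fJ'.
    have := lab J' e lbl fJ' cl; rewrite lblE leqNgt => /negP[].
    apply: proper_card; rewrite properEneq nextG andbT.
    apply/eqP => nG; have [_ _ _] := TP J' fJ'.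
    by rewrite nG leNgt gtr_pMl// gtrBl d_gt0.
  by move=> fI fI' CC; apply/eqP; rewrite eqEsubset !half.
exists C, fin; split.
- move=> I fI; have [t1 t2 t3 t4] := TP I fI.
  have [/(_ I fI)[s1 s2 s3 s4 s5] _ _ _] := sysI I fI; split.
  + rewrite suppC// subUset t1 (subset_trans s1)// setIS//.
  + rewrite suppC//; apply/subsetP => e eIG.
    have /setUP[eT|en] := subsetP t3 e eIG; first by rewrite !in_setU eT orbT.
    have : e \in I :&: next I by rewrite inE en andbT; move: eIG; rewrite inE => /andP[].
    by move/(subsetP s2); rewrite !in_setU => /orP[->//|->]; rewrite !orbT.
  + exact: subset_trans s3 (nextG I).
  + exact: s4.
  + rewrite suppD// natrD; apply: le_trans (total_bound_step x1 (xnext I fI)).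
    by rewrite lerD// (le_trans _ s0_le)// ler_nat.
- move=> I I' fI fI' CC; have TT := TC I I' fI fI' CC.
  have nn := TnextE I I' fI fI' TT.
  rewrite /fin -nn; have [_ inj _ _] := sysI I fI; apply: inj => //.
  apply/ffunP => e; have := congr1 (fun c : col => c e) CC; rewrite !ffunE -TT -nn.
  case: ifP => // eT _; have enext := Tnext I e fI eT.
  have none J : free J -> next J = next I -> (CF (next I)).1 J e = None.
    move=> fJ nJ; apply/eqP; apply: contraNT enext => ce.
    by rewrite -nJ (subsetP (supp_next J fJ))// inE nJ.
  by rewrite !none.
- move=> I e j fI; rewrite ffunE; case: ifP => [_ [<-]|_ cj]; first by rewrite lblE.
  have [_ _ lab _] := sysI I fI.
  by rewrite (leq_trans (lab I e j fI cj))// subset_leq_card.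
move=> s; rewrite -/x.
pose P T' := [set I : {set X} | [&& free I, #|colored (C I)| == s & T I == T']].
pose small T' := (T' \subset G) && (#|T'| <= s)%N.
have x'0 : 0 <= x^-1 ^+ 2 by rewrite exprn_ge0// invr_ge0 ltW.
have edge0 y : 0 <= edge_bound y by rewrite mulr_ge0 ?pot_gain_ge0// ltW.
(* Each fingerprint edge of this round gets weight [x ^ -2], so that the [#|G| = x * M0] choices for
   it count as [M0 / x]; [Z] is the part of the edge bound left for the later rounds. *)
pose Z := edge_bound x - M0 / x.
have ZP y : y <= r * x -> edge_bound y <= Z.
  by move=> yx; rewrite lerBrDr edge_bound_step.
have Z0 : 0 <= Z by rewrite (le_trans (edge0 0))// ZP// mulr_ge0// ltW// subr_gt0; have := d_le; lra.
have xt0 i : 0 <= x^-1 ^+ 2 ^+ i by exact: exprn_ge0.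
have Zt0 i j : 0 <= Z ^+ i / j%:R by rewrite divr_ge0// exprn_ge0.
have term T' : small T' -> #|C @: P T'|%:R <=
    overhead x * (x^-1 ^+ 2 ^+ #|T'| * (Z ^+ (s - #|T'|) / (s - #|T'|)`!%:R)).
  move=> _; have [->|/set0Pn[I0]] := eqVneq (P T') set0.
    by rewrite imset0 cards0 /= mulr_ge0 ?expR_ge0// mulr_ge0.
  rewrite inE => /and3P[fI0 /eqP sI0 /eqP TI0].
  have ts0 : (#|T'| <= s0)%N by rewrite -TI0; have [] := TP I0 fI0.
  pose h c : col := [ffun e => if e \in T' then Some lbl else c e].
  have le_h : (#|C @: P T'| <= #|counted (CF (next I0)).1 (s - #|T'|)|)%N.
    apply: leq_trans (leq_imset_card h _).
    apply: subset_leq_card; apply/subsetP => _ /imsetP[I + ->].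
    rewrite inE => /and3P[fI /eqP sI /eqP TI].
    have nI : next I = next I0 by apply: TnextE; rewrite // TI.
    have -> : C I = h ((CF (next I0)).1 I).
      by apply/ffunP => e; rewrite !ffunE TI nI.
    apply: imset_f; apply: imset_f; rewrite inE fI -sI suppD// TI nI addKn.
    exact: eqxx.
  apply: (@le_trans _ _ #|counted (CF (next I0)).1 (s - #|T'|)|%:R); first by rewrite ler_nat.
  have [_ _ _ /(_ (s - #|T'|)%N) le1] := sysI I0 fI0; apply: le_trans le1 _.
  rewrite [X in _ <= X]mulrA; apply: ler_pM; rewrite ?expR_ge0 ?divr_ge0 ?exprn_ge0 ?edge0//.
    (* The weight is paid back here: [x ^ (2 * #|T'|)] is at most [exp (2 * s0 * ln x)], which the
       growth of [overhead] in this round absorbs. *)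
    apply: le_trans (_ : overhead (#|next I0|%:R / M0) *
      expR (2 * (U0 * x `^ (- eta)) * ln x) * x^-1 ^+ 2 ^+ #|T'| <= _); last first.
      by apply: ler_wpM2r (xt0 _) _ _ (overhead_step x1 (xnext I0 fI0)).
    rewrite -mulrA ler_peMr ?expR_ge0// -exprM exprVn ler_pdivlMr ?exprn_gt0// mul1r.
    rewrite -{1}(lnK (x0 : x \is Num.pos)) -expRM_natl ler_expR.
    rewrite ler_pM2r ?ln_gt0// natrM ler_pM2l//.
    by apply: le_trans s0_le; rewrite ler_nat.
  rewrite ler_wpM2r ?invr_ge0// lerXn2r ?nnegrE// ZP// xnext//.
apply: (@le_trans _ _ (\sum_(T' | small T') #|C @: P T'|%:R)).
  rewrite -natr_sum ler_nat; apply: leq_trans (leq_card_bigcup _ _).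
  apply: subset_leq_card; apply/subsetP => _ /imsetP[I + ->].
  rewrite inE => /andP[fI /eqP sI]; apply/bigcupP; exists (T I).
    have [t1 _ _ _] := TP I fI; rewrite /small (subset_trans t1) ?subsetIr//=.
    by rewrite -sI suppD// leq_addr.
  by apply: imset_f; rewrite inE fI sI !eqxx.
apply: le_trans (ler_sum _ term) _; rewrite -mulr_sumr ler_wpM2l ?expR_ge0//.
apply: le_trans (sum_bounded_subsets _ _ x'0 Z0) _.
rewrite (_ : Z + _ = edge_bound x)// /Z; have -> : #|G|%:R = x * M0 by rewrite divfK// gt_eqF.
by field; rewrite gt_eqF.
Qed.

End Iteration.

Lemma copy_freeE (V : finType) (H : sgraph V) n (G : sgraph 'I_n) :
  (G \in free_graphs H n) = copy_free H (edges G).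
Proof.
rewrite inE /contains_copy negb_exists; apply: eq_forallb => f.
rewrite negb_and -implybE; congr (_ ==> ~~ _); apply/forall_inP/subsetP => sub.
  by move=> _ /imsetP[e eH ->]; apply: sub.
by move=> e eH; apply: sub; apply: imset_f.
Qed.

(** This is [s! >= (s / e) ^ s], from a single term of the exponential series at [s]. *)
Lemma expr_div_fact_le (R : realType) (x : R) (s : nat) : 0 <= x -> (0 < s)%N ->
  x ^+ s / s`!%:R <= (x * expR 1 / s%:R) ^+ s.
Proof.
case: s => // s x0 _; have s0 : 0 < s.+1%:R :> R by rewrite ltr0n.
rewrite expr_div_n exprMn -mulrA ler_wpM2l ?exprn_ge0//.
rewrite ler_pdivlMr ?exprn_gt0// mulrC -expRM_natl mulr1.
by apply: le_trans (expR_ge1Dxn s (ltW s0)); rewrite lerDr.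
Qed.

(** Solving the bound on [s] for [k] gives [k <= (c1 * Na / s) ^ (1 / (lam - 1))]. The factor
    [Na / s] already present raises the exponent to [1 + 1 / (lam - 1) = lam / (lam - 1)]. *)
Lemma count_arith (R : realType) (lam c1 c2 C Na k : R) (s : nat) : 1 < lam -> 0 < Na -> 0 < k -> (0 < s)%N ->
  0 < c1 -> 0 < c2 -> c1 <= C -> c2 <= C ->
  s%:R <= c1 * k `^ (1 - lam) * Na ->
  (c2 * k * Na / s%:R) ^+ s <= (C * Na / s%:R) `^ (lam / (lam - 1) * s%:R).
Proof.
move=> lam1 Na0 k0 s0 c10 c20 cC1 cC2 sle.
have sR : 0 < s%:R :> R by rewrite ltr0n.
have l0 : 0 < lam - 1 by rewrite subr_gt0.
pose y := Na / s%:R; have y0 : 0 < y by rewrite divr_gt0.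
have C0 : 0 < C by apply: lt_le_trans cC1.
rewrite powRrM powR_mulrn ?powR_ge0// lerXn2r ?nnegrE ?powR_ge0//.
  by rewrite ltW// divr_gt0// !mulr_gt0.
have kle : k <= (c1 * y) `^ (lam - 1)^-1.
  have -> : k = (k `^ (lam - 1)) `^ (lam - 1)^-1.
    by rewrite -powRrM mulfV ?gt_eqF// powRr1// ltW.
  apply: ge0_ler_powR; rewrite ?nnegrE ?powR_ge0 ?invr_ge0 ?(ltW l0)//.
    by rewrite ltW// mulr_gt0.
  rewrite /y mulrA ler_pdivlMr// mulrC -ler_pdivlMr ?powR_gt0// -powRN opprB.
  by rewrite mulrAC.
have -> : lam / (lam - 1) = 1 + (lam - 1)^-1 by field; rewrite gt_eqF.
rewrite -!mulrA -/y powRD ?(gt_eqF (mulr_gt0 C0 y0)) ?implybT//.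
rewrite powRr1 ?(ltW (mulr_gt0 C0 y0))// [X in X <= _]mulrCA [X in X <= _]mulrC.
apply: ler_pM; rewrite ?(ltW k0) ?(ltW (mulr_gt0 c20 y0))//.
  by rewrite ler_wpM2r// ltW.
apply: le_trans kle _; apply: ge0_ler_powR; rewrite ?nnegrE ?invr_ge0 ?(ltW l0)//.
- by rewrite ltW// mulr_gt0.
- by rewrite ltW// mulr_gt0.
by rewrite ler_wpM2r// ltW.
Qed.

(** * From colorings to colored graphs *)

Section ColoredContainers.
Variable n : nat.
Let col := {ffun {set 'I_n} -> option 'I_#|{set 'I_n}|.+1}.
Let pairs : {set {set 'I_n}} := [set x : {set 'I_n} | #|x| == 2%N].

(** Erasing the labels of sets that are not pairs makes the conversion total; colorings supported on
    pairs lose nothing. *)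
Definition cgraph_fun (c : col) : {ffun {set 'I_n} -> option nat} :=
  [ffun x : {set 'I_n} => if #|x| == 2%N then omap (@nat_of_ord _) (c x) else None].

Lemma cgraph_fun_subproof c :
  [forall x : {set 'I_n}, (cgraph_fun c x != None) ==> (#|x| == 2%N)].
Proof. by apply/forallP => x; rewrite ffunE; case: ifP => //; rewrite implybT. Qed.

Definition cgraph_of c : cgraph 'I_n := CGraph (cgraph_fun_subproof c).

Lemma sgraph_of_subproof (J : {set {set 'I_n}}) :
  [forall x : {set 'I_n} in J :&: pairs, #|x| == 2%N].
Proof. by apply/forall_inP => x; rewrite !inE => /andP[]. Qed.

Definition sgraph_of J : sgraph 'I_n := SGraph (sgraph_of_subproof J).

Lemma edges_cgraph_of c : colored c \subset pairs ->
  edges (underlying (cgraph_of c)) = colored c.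
Proof.
move=> /subsetP sub; apply/setP => x; rewrite !inE /= ffunE.
have [cx|cx] := eqVneq (c x) None; first by rewrite cx if_same.
have : x \in pairs by apply: sub; rewrite inE.
by rewrite inE => ->; case: (c x) cx.
Qed.

Lemma cgraph_of_inj c c' : colored c \subset pairs -> colored c' \subset pairs ->
  cgraph_of c = cgraph_of c' -> c = c'.
Proof.
move=> /subsetP sub /subsetP sub' [/ffunP eqc]; apply/ffunP => x.
have := eqc x; rewrite !ffunE; case: ifP => x2; last first.
  have out c0 : {subset colored c0 <= pairs} -> c0 x = None.
    move=> s0; apply/eqP; apply: contraFT x2 => cx.
    by have := s0 x; rewrite !inE; apply.
  by rewrite !out.
by case: (c x) (c' x) => [i|] [j|] //= [/ord_inj ->].
Qed.

Lemma card_pairs_le : (#|pairs| <= n ^ 2)%N.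
Proof. by apply: card_graph_le => x; rewrite inE => /eqP. Qed.

End ColoredContainers.

Local Open Scope fset_scope.
Local Open Scope ring_scope.

Theorem theorem4p6 (R : realType) (h l : nat) (V : finType) (H : sgraph V)
    (Hh : #|V| = h) (Hl : #|edges H| = l)
    (Hbip : bipartite H) (Hcyc : has_cycle H)
    (A alpha : R) (A_gt0 : 0 < A) (alpha_gt0 : 0 < alpha)
    (Hex : forall n : nat, (ex n H)%:R <= A * n%:R `^ alpha) :
  exists C : R, 0 < C /\
  exists (n0 : nat) (k0 : R),
  forall (n : nat) (k : R), (n0 <= n)%N -> 0 < k -> k0 <= k ->
  exists (S : {fset cgraph 'I_n})
         (g : sgraph 'I_n -> cgraph 'I_n) (f : cgraph 'I_n -> sgraph 'I_n),
    [/\ (forall G, G \in S ->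
           #|edges (underlying G)|%:R
             <= C * k `^ (1 - lambda alpha H) * n%:R `^ alpha),
        (forall I, I \in free_graphs H n -> g I \in S),
        (forall G, G \in S -> f G \in sparse_graphs alpha n k),
        (forall s : nat, (1 <= s)%N ->
           #|` [fset G in S | #|edges (underlying G)| == s] |%:R
             <= (C * n%:R `^ alpha / s%:R)
                  `^ (lambda alpha H / (lambda alpha H - 1) * s%:R)
                * expR (C * k `^ (1 - lambda alpha H) * n%:R `^ alpha))
      & (forall I, I \in free_graphs H n ->
           (edges (underlying (g I)) \subset edges I) /\
           (edges I \subset edges (f (g I)) :|: edges (underlying (g I))))].
Proof.
(* For [alpha >= 2] and [k >= 1] the complete graph has at most [k n^alpha] edges, so a single
   colored graph without edges serves every [I]. *)
have [a2|a2] := leP 2 alpha.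
  exists 1; split=> //; exists 1%N, 1 => n k n1 k0 k1.
  have N1 : 1 <= n%:R :> R by rewrite ler1n.
  pose G0 := cgraph_of [ffun=> None : option 'I_#|{set 'I_n}|.+1].
  have E0 : edges (underlying G0) = set0.
    by apply/setP => x; rewrite !inE /= !ffunE if_same.
  exists [fset G0], (fun=> G0), (fun=> sgraph_of setT); split.
  - by move=> G; rewrite inE => /eqP ->; rewrite E0 cards0 !mulr_ge0 ?powR_ge0.
  - by move=> I _; rewrite inE.
  - move=> G _; rewrite inE /= setTI.
    apply: (@le_trans _ _ (n%:R `^ 2)).
      by rewrite powR_mulrn// -natrX ler_nat card_pairs_le.
    apply: (@le_trans _ _ (n%:R `^ alpha)); first exact: ler_powR.
    by rewrite ler_peMl ?powR_ge0.
  - move=> s s1; rewrite (_ : [fset G in _ | _] = fset0).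
      by rewrite cardfs0 /= mulr_ge0 ?powR_ge0 ?expR_ge0.
    apply/fsetP => G; rewrite !inE; apply/negP => /andP[/eqP ->].
    by rewrite E0 cards0 => /eqP s0; rewrite -s0 in s1.
  - move=> I _; rewrite E0 sub0set setU0; split=> //.
    by apply/subsetP => x xI; rewrite !inE /= (card_edge xI).
have agt := exponent_gt Hcyc A_gt0 Hex.
pose A' := Num.max A 1.
have A'1 : 1 <= A' by rewrite le_max lexx orbT.
have Hex' n : (ex n H)%:R <= A' * n%:R `^ alpha.
  by rewrite (le_trans (Hex n))// ler_wpM2r ?powR_ge0// le_max lexx.
set lam := lambda alpha H.
have m1 := m2_gt1 R Hcyc.
have lam1 : 1 < lam.
  rewrite /lam /lambda div1r invf_gt1 ?mulr_gt0 ?subr_gt0//; last exact: lt_trans m1.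
  rewrite mulrC -ltr_pdivlMr ?div1r; last exact: lt_trans m1.
  by move: agt; lra.
have eta0 : 0 < lam - 1 by rewrite subr_gt0.
have [d [C0 [d0 d2 C00 cstep]]] := graph_container_step Hcyc A'1 a2 agt Hex'.
have r0 : 0 < 1 - d by rewrite subr_gt0; lra.
(* The three potentials at their upper bounds, which do not depend on the size of the initial
   container: [c1] for the number of colored edges, [c2] for the choices per edge including the [e]
   from the factorial, [c3] for the overhead. *)
pose c1 := C0 * ((1 - d) `^ (- (lam - 1)) / gain d (lam - 1)).
pose c2 := (1 - d) `^ (- 1) / gain d 1 * expR 1.
pose c3 := C0 * (4 / (lam - 1) * ((1 - d) `^ (- ((lam - 1) / 2)) / gain d ((lam - 1) / 2))).
have gain0 b : 0 < b -> 0 < gain d b by apply: gain_gt0.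
have c10 : 0 < c1 by rewrite mulr_gt0 ?divr_gt0 ?powR_gt0 ?gain0.
have c20 : 0 < c2 by rewrite mulr_gt0 ?divr_gt0 ?powR_gt0 ?gain0 ?expR_gt0.
have eta20 : 0 < (lam - 1) / 2 by rewrite divr_gt0.
have c30 : 0 < c3 by rewrite !mulr_gt0 ?invr_gt0 ?powR_gt0 ?gain0.
pose C := c1 + c2 + c3.
have [cC1 cC2 cC3] : [/\ c1 <= C, c2 <= C & c3 <= C].
  rewrite /C; split.
  - by rewrite -addrA lerDl addr_ge0 ?(ltW c20) ?(ltW c30).
  - by rewrite addrAC lerDr addr_ge0 ?(ltW c10) ?(ltW c30).
  - by rewrite lerDr addr_ge0 ?(ltW c10) ?(ltW c20).
have Cgt0 : 0 < C by apply: lt_le_trans cC1.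
(* From this [k] on, every graph with more than [k n^alpha] edges is dense enough for the container
   step. *)
exists C; split=> //; exists 1%N, (12 * A') => n k n1 k0 k12.
have N0 : 0 < n%:R :> R by rewrite ltr0n.
pose Na := n%:R `^ alpha; have Na0 : 0 < Na by rewrite powR_gt0.
pose M0 := k * Na; have M00 : 0 < M0 by rewrite mulr_gt0.
pose U0 := C0 * k `^ (1 - lam) * Na; have U00 : 0 < U0 by rewrite !mulr_gt0 ?powR_gt0.
pose pairs : {set {set 'I_n}} := [set x : {set 'I_n} | #|x| == 2%N].
have pairs2 (G : {set {set 'I_n}}) : G \subset pairs ->
    {in G, forall x : {set 'I_n}, #|x| = 2%N}.
  by move=> /subsetP sub x /sub; rewrite inE => /eqP.
have free_sub (I J : {set {set 'I_n}}) : J \subset I -> copy_free H I -> copy_free H J.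
  move=> JI /forallP fI; apply/forallP => phi; apply/implyP => inj.
  by have := fI phi; rewrite inj /=; apply: contraNN => /subset_trans; apply.
have step (G : {set {set 'I_n}}) : G \subset pairs -> M0 < #|G|%:R ->
    exists (s : nat) F, container_system (copy_free H (n := n)) G s (d * #|G|%:R) F /\
      s%:R <= U0 * (#|G|%:R / M0) `^ (- (lam - 1)).
  move=> Gp GM; have [|s [F [FP sle]]] := cstep n G n1 (pairs2 G Gp).
    by rewrite (le_trans _ (ltW GM))// ler_wpM2r ?powR_ge0.
  exists s, F; split=> //; apply: le_trans sle _; rewrite -/lam -/Na /U0 opprB.
  have -> : #|G|%:R / Na = k * (#|G|%:R / M0).
    by rewrite /M0; field; rewrite !gt_eqF.
  by rewrite powRM ?divr_ge0 ?(ltW k0) ?(ltW M00)// le_eqVlt; apply/orP; left; apply/eqP; ring.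
have [Cl [fin [sysP sysI _ sysC]]] :=
  coloring_system_exists free_sub M00 (ltW U00) d0 d2 eta0 step (subxx pairs).
set x := #|pairs|%:R / M0 in sysP sysC.
have supp2 I : copy_free H I -> colored (Cl I) \subset pairs.
  by move=> /sysP[s1 _ _ _ _]; apply: subset_trans s1 (subsetIr _ _).
have tot : total_bound U0 d (lam - 1) x <= c1 * k `^ (1 - lam) * Na.
  have -> : c1 * k `^ (1 - lam) * Na =
      U0 * ((1 - d) `^ (- (lam - 1)) / gain d (lam - 1)) by rewrite /c1 /U0; ring.
  by rewrite ler_wpM2l ?(ltW U00)// ler_wpM2r ?invr_ge0 ?(ltW (gain0 _ eta0))// pot_le.
pose g (I : sgraph 'I_n) := cgraph_of (Cl (edges I)).
pose S : {fset cgraph 'I_n} := [fset g I | I in free_graphs H n].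
(* The final container has to be a function of the colored graph. Any preimage may be picked,
   because by [sysI] all of them have the same final container. *)
pose f (G : cgraph 'I_n) : sgraph 'I_n :=
  if [pick J in free_graphs H n | g J == G] is Some J then sgraph_of (fin (edges J))
  else sgraph_of set0.
have SP G : G \in S -> exists2 I, copy_free H (edges I) & G = g I.
  by move=> /imfsetP[I /= If ->]; exists I; rewrite // -copy_freeE.
have edges_g I : copy_free H (edges I) ->
    edges (underlying (g I)) = colored (Cl (edges I)).
  by move=> If; rewrite edges_cgraph_of// supp2.
have fg I : copy_free H (edges I) -> edges (f (g I)) = fin (edges I).
  move=> If; rewrite /f; case: pickP => [J /andP[Jf /eqP gJ]|/(_ I)]; last first.
    by rewrite eqxx andbT copy_freeE If.
  rewrite copy_freeE in Jf.
  have -> : fin (edges J) = fin (edges I).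
    by apply: sysI => //; apply: cgraph_of_inj gJ; apply: supp2.
  by rewrite /= (setIidPl _)//; have [] := sysP _ If.
exists S, g, f; split.
- move=> G /SP[I If ->]; rewrite edges_g//; have [_ _ _ _ s5] := sysP _ If.
  apply: le_trans s5 (le_trans tot _).
  by rewrite !ler_wpM2r ?powR_ge0.
- by move=> I If; apply/imfsetP; exists I.
- by move=> G /SP[I If ->]; rewrite inE fg//; have [] := sysP _ If.
- move=> s s1; have lef : (#|` [fset G in S | #|edges (underlying G)| == s] | <=
      #|counted (copy_free H (n := n)) Cl s|)%N.
    rewrite cardE; apply: leq_trans (leq_imfset_card imfset_key
      (@cgraph_of n) (mem (counted (copy_free H (n := n)) Cl s))).
    apply: fsubset_leq_card; apply/fsubsetP => G; rewrite !inE => /andP[/SP[I If ->]].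
    rewrite edges_g// => sI; apply/imfsetP; exists (Cl (edges I)) => //=.
    by apply: imset_f; rewrite inE If sI.
  apply: (@le_trans _ _ #|counted (copy_free H (n := n)) Cl s|%:R); first by rewrite ler_nat.
  have [->|/set0Pn[c /imsetP[I]]] := eqVneq (counted (copy_free H (n := n)) Cl s) set0.
    by rewrite cards0 /= mulr_ge0 ?powR_ge0 ?expR_ge0.
  rewrite inE => /andP[If /eqP sI] _.
  have sle : s%:R <= c1 * k `^ (1 - lam) * Na.
    by rewrite -sI; have [_ _ _ _ s5] := sysP _ If; apply: le_trans s5 tot.
  apply: le_trans (sysC s) _; rewrite mulrC.
  have edge0 : 0 <= edge_bound M0 d x.
    by rewrite mulr_ge0 ?(ltW M00)// pot_gain_ge0.
  apply: ler_pM; rewrite ?expR_ge0 ?divr_ge0 ?exprn_ge0//.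
    apply: le_trans (expr_div_fact_le edge0 s1) _.
    apply: le_trans (count_arith lam1 Na0 k0 s1 c10 c20 cC1 cC2 sle).
    have l1 : 0 <= edge_bound M0 d x * expR 1 / s%:R.
      by rewrite divr_ge0// (mulr_ge0 edge0)// expR_ge0.
    have l2 : 0 <= c2 * k * Na / s%:R.
      by rewrite ltW// divr_gt0 ?ltr0n// (mulr_gt0 (mulr_gt0 c20 k0)).
    rewrite lerXn2r ?nnegrE// ler_wpM2r ?invr_ge0//.
    have -> : c2 * k * Na = M0 * ((1 - d) `^ (- 1) / gain d 1) * expR 1.
      by rewrite /c2 /M0; ring.
    rewrite ler_wpM2r ?expR_ge0// ler_wpM2l ?(ltW M00)//.
    by rewrite ler_wpM2r ?invr_ge0 ?(ltW (gain0 _ ltr01))// pot_le.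
  rewrite ler_expR; apply: (@le_trans _ _ (c3 * k `^ (1 - lam) * Na)); last first.
    by rewrite !ler_wpM2r ?powR_ge0.
  have -> : c3 * k `^ (1 - lam) * Na = U0 * (4 / (lam - 1) *
      ((1 - d) `^ (- ((lam - 1) / 2)) / gain d ((lam - 1) / 2))) by rewrite /c3 /U0; ring.
  rewrite ler_wpM2l ?(ltW U00)// ler_wpM2l ?divr_ge0 ?(ltW eta0)//.
  by rewrite ler_wpM2r ?invr_ge0 ?(ltW (gain0 _ eta20))// pot_le.
move=> I; rewrite copy_freeE => If; rewrite edges_g// fg//.
have [s1 s2 _ _ _] := sysP _ If; split; first exact: subset_trans s1 (subsetIl _ _).
apply: subset_trans s2; rewrite subsetI subxx /=.
by apply/subsetP => y yI; rewrite inE (card_edge yI).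
Qed.
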